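(* Let $\kappa=-2$, let $p\in\mathbb{Z}_{\ge0}$, and let $$\bm{\chi}(z)=\sum_{n=-p}^{\infty}\chi_{-n}z^{n-1}\in\mathbb{C}((z)).$$ Let $\varphi:\mathcal{S}_{-1,p}\to\mathbb{C}$ be the Lie algebra homomorphism with $\varphi(K)=-2$ and $$\varphi(h(i))=-\chi_i,\qquad \varphi(e(i))=\varphi(f(i+p+1))=0\qquad\text{for } i\ge0.$$ Assume that $\bm{\chi}$ satisfies one of the following conditions: (i) there is $p'\in\mathbb{Z}_{>0}$ such that $\bm{\chi}(z)=\sum_{n=-p'}^{\infty}\chi_{-n}z^{n-1}$ and $\chi_{p'}\neq0$; (ii) $\bm{\chi}(z)=\sum_{n=0}^{\infty}\chi_{-n}z^{n-1}$ and $\chi_0\in\{1\}\cup(\mathbb{C}\setminus\mathbb{Z})$; (iii) there is a positive integer $\ell$ such that $\bm{\chi}(z)=\frac{\ell+1}{z}+\sum_{n=1}^{\infty}\chi_{-n}z^{n-1}$ and $S_\ell(-\chi_{-1},-\chi_{-2},\dots)\neq0$, where $S_\ell$ is the Schur polynomial. Then the Wakimoto module $W_{-\bm{\chi}}$ is a simple quotient of the $V^{-2}(\mathfrak{sl}_2)$-module $\widehat{M}(\varphi)$. Moreover, if $p\ge1$ and $\chi_p\neq0$, then $\overline{M}(\varphi,\theta)\cong W_{-\bm{\chi}}$ as $V^{-2}(\mathfrak{sl}_2)$-modules, where $$\theta(z)=\frac12\left(\bm{\chi}(z)^2+2\frac{d}{dz}\bm{\chi}(z)\right)=\sum_{i\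ge0}\theta_{2p-i}\,z^{-2p+i-2}.$$
   Context: **Affine algebra.** $\mathfrak{sl}_2$ has standard basis $e,f,h$ with $[e,f]=h$, $[h,e]=2e$, $[h,f]=-2f$ and invariant form $(e,f)=1$, $(h,h)=2$. $\widehat{\mathfrak{sl}}_2=\mathfrak{sl}_2\otimes\mathbb{C}[t,t^{-1}]\oplus\mathbb{C}K$ with $K$ central, $x(n)=x\otimes t^n$, and $[x(n),y(m)]=[x,y](n+m)+n(x,y)\delta_{n+m,0}K$. $V^{-2}(\mathfrak{sl}_2)$ is the universal affine vertex algebra of level $-2$ (the critical level); its (weak) modules are the same as smooth $\widehat{\mathfrak{sl}}_2$-modules on which $K=-2$ (smooth: for each vector $w$ and each $x\in\mathfrak{sl}_2$, $x(n)w=0$ for $n\gg0$). **Center.** Let $t=\frac12\big(e(-1)f(-1)+f(-1)e(-1)+\frac12h(-1)^2\big)\mathbf{1}\in V^{-2}(\mathfrak{sl}_2)$ and $T(z)=Y(t,z)=\sum_{n}T(n)z^{-n-2}$. The operators $T(n)$ commute with the action of $\widehat{\mathfrak{sl}}_2$ on every $V^{-2}(\mathfrak{sl}_2)$-module. **The modules $\widehat{M}(\varphi)$ and $\overline{M}(\varphi,\theta)$.** For $p\ge0$, $\mathcal{S}_{-1,p}\subset\widehat{\mathfrak{sl}}_2$ is the Lie subalgebra generated by $K$ and $\{e(n),\,f(m),\,h(k)\mid n>-1,\ m>p,\ k\ge0\}$. For a Lie algebra homomorphism $\varphi:\mathcal{S}_{-1,p}\to\mathbb{C}$ with $\varphi(K)=-2$,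 let $\mathbb{C}v$ be the one-dimensional module with $x\cdot v=\varphi(x)v$, set $\widehat{M}(\varphi)=U(\widehat{\mathfrak{sl}}_2)\otimes_{U(\mathcal{S}_{-1,p})}\mathbb{C}v$ and $u=1\otimes v$. For $p\ge1$ and $n\ge p$ the vector $T(n)u$ is a scalar multiple of $u$. Given $\theta(z)=\sum_n\theta_nz^{-n-2}\in\mathbb{C}((z))$ such that $T(n)u=\theta_nu$ for all $n\ge p$ (the coefficients $\theta_n$ with $n<p$ being arbitrary), let $\widehat{M}(\varphi,\theta)$ be the submodule of $\widehat{M}(\varphi)$ generated by the vectors $(T(p-i)-\theta_{p-i})u$, $i>0$, and set $\overline{M}(\varphi,\theta)=\widehat{M}(\varphi)/\widehat{M}(\varphi,\theta)$. **Wakimoto modules at the critical level.** The Weyl algebra $\widehat{\mathcal{A}}$ is the associative algebra generated by $a(n),a^*(n)$, $n\in\mathbb{Z}$, with only nontrivial commutators $[a(n),a^*(m)]=\delta_{n+m,0}$. $W$ is the simple $\widehat{\mathcal{A}}$-module generated by $\mathbf{1}$ with $a(n)\mathbf{1}=a^*(n+1)\mathbf{1}=0$ for $n\ge0$; it is a vertex algebra with fields $a(z)=\sum_na(n)z^{-n-1}$, $a^*(z)=\sum_na^*(n)z^{-n}$. $\pi^0$ is the commutative vertex algebra generated by a field $b(z)=\sum_nb(n)z^{-n-1}$. For $\bm{\psi}(z)=\sum_n\psi_nz^{-n-1}\in\mathbb{C}((z))$, $L(\bm{\psi})$ is the one-dimensional $\pi^0$-module on which $b(n)$ acts as $\psi_n$,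 i.e. $b(z)$ acts as $\bm{\psi}(z)$. The module $W_{\bm{\psi}}=W\otimes L(\bm{\psi})$ is a $V^{-2}(\mathfrak{sl}_2)$-module via $$e(z)=a(z),\quad h(z)=-2{:}a^*(z)a(z){:}+b(z),\quad f(z)=-{:}a^*(z)^2a(z){:}-2\,\partial_za^*(z)+a^*(z)b(z).$$ Thus on $W_{-\bm{\chi}}$ the field $b(z)$ acts as $-\bm{\chi}(z)$. In the expansion of $\bm{\chi}$, $\chi_n$ is the coefficient of $z^{-n-1}$ (and $\chi_n=0$ for $n>p$). **Schur polynomials.** $S_r(x_1,x_2,\dots)$ is defined by $\exp\big(\sum_{n\ge1}\frac{x_n}{n}y^n\big)=\sum_{r\ge0}S_r(x_1,x_2,\dots)y^r$.
   Formalization: The formula for θ is corrected to θ(z) = ¼(χ(z)² + 2χ′(z)); with the stated t, T(2p)u = ¼χ_p² u, so the printed factor ½ violates T(n)u = θ_n u for n ≥ p, which is needed to define M̄(φ,θ). *)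

(* Defs.v *)
From HB Require Import structures.
From mathcomp Require Import all_boot all_order all_algebra.
From mathcomp Require Import generic_quotient ring_quotient.
From mathcomp Require Import finmap.
From mathcomp Require Import ring.
From mathcomp Require Import boolp classical_sets fsbigop reals complex.
From mathcomp.multinomials Require Import monalg.

Set Implicit Arguments.
Unset Strict Implicit.
Unset Printing Implicit Defensive.

Import GRing.Theory Num.Theory.

Local Open Scope ring_scope.
Local Open Scope quotient_scope.
Local Open Scope classical_set_scope.

Definition subspace (K : fieldType) (V : lmodType K) (N : set V) : Prop :=
  N 0 /\ forall (a : K) (x y : V), N x -> N y -> N (a *: x + y).

Definition lspan (K : fieldType) (V : lmodType K) (S : set V) : set V :=
  smallest (@subspace K V) S.

Lemma subspace_lspan (K : fieldType) (V : lmodType K) (S : set V) :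
  subspace (lspan S).
Proof.
split=> [|a x y Sx Sy] N [sN SN]; first by case: sN.
by case: (sN) => _; apply; [apply: Sx | apply: Sy].
Qed.

Lemma lspan_id (K : fieldType) (V : lmodType K) (N : set V) :
  subspace N -> lspan N = N.
Proof. exact: smallest_id. Qed.

Definition lspan_pred (K : fieldType) (V : lmodType K) (S : set V) : V -> bool :=
  fun x => `[< lspan S x >].

Lemma lspan_pred_closed (K : fieldType) (V : lmodType K) (S : set V) :
  GRing.submod_closed (lspan_pred S).
Proof.
have [S0 SD] := subspace_lspan S; split; first by rewrite unfold_in; apply/asboolP.
move=> a x y; rewrite !unfold_in => /asboolP Sx /asboolP Sy.
by apply/asboolP; exact: SD.
Qed.

HB.instance Definition _ (K : fieldType) (V : lmodType K) (S : set V) :=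
  GRing.isSubmodClosed.Build K V (lspan_pred S)
    (GRing.submod_closed_semi (lspan_pred_closed S)).

Definition lspan_zmod (K : fieldType) (V : lmodType K) (S : set V) :=
  GRing.ZmodClosed.clone V (lspan_pred S) _.

(* [lquot S] is the quotient of V by the linear span of S, so V/S when S is a
   subspace. *)
Definition lquot (K : fieldType) (V : lmodType K) (S : set V) : Type :=
  {ideal_quot lspan_zmod S}.

HB.instance Definition _ (K : fieldType) (V : lmodType K) (S : set V) :=
  GRing.Zmodule.on (lquot S).

Definition lpi (K : fieldType) (V : lmodType K) (S : set V) (x : V) : lquot S :=
  \pi_({ideal_quot lspan_zmod S}) x.

Definition lrepr (K : fieldType) (V : lmodType K) (S : set V) (q : lquot S) : V :=
  repr (q : {ideal_quot lspan_zmod S}).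

Section LinearQuotient.
Context {K : fieldType} {V : lmodType K} {S : set V}.
Implicit Types (x y : V) (q : lquot S).

Lemma lreprK q : lpi S (lrepr q) = q.
Proof. exact: reprK. Qed.

Lemma lpiP x y : lpi S x = lpi S y <-> lspan S (x - y).
Proof.
have := Quotient.idealrBE (lspan_zmod S) x y.
rewrite unfold_in => e; split=> [h|/asboolP h].
  by apply/asboolP; rewrite [X in is_true X]e; apply/eqP.
by apply/eqP; rewrite /lpi -[X in is_true X]e.
Qed.

Lemma lpiD x y : lpi S (x + y) = lpi S x + lpi S y.
Proof. exact: pi_addr. Qed.

Definition lscale (a : K) q : lquot S := lpi S (a *: lrepr q).

Lemma lscaleE a x : lscale a (lpi S x) = lpi S (a *: x).
Proof.
apply/lpiP; rewrite -scalerBr -[_ *: _]addr0.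
have [S0 SD] := subspace_lspan S; apply: SD => //.
by apply/lpiP; rewrite lreprK.
Qed.

Lemma lscaleA a b q : lscale a (lscale b q) = lscale (a * b) q.
Proof. by rewrite -[q]lreprK !lscaleE scalerA. Qed.

Lemma lscale1 : left_id 1 lscale.
Proof. by move=> q; rewrite -[q]lreprK !lscaleE scale1r. Qed.

Lemma lscaleDr : right_distributive lscale +%R.
Proof.
by move=> a p q; rewrite -[p]lreprK -[q]lreprK !(lscaleE, =^~ lpiD) scalerDr.
Qed.

Lemma lscaleDl q : {morph lscale^~ q : a b / a + b}.
Proof. by move=> a b; rewrite -[q]lreprK !(lscaleE, =^~ lpiD) scalerDl. Qed.

HB.instance Definition _ := GRing.Zmodule_isLmodule.Build K (lquot S)
  lscaleA lscale1 lscaleDr lscaleDl.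

Lemma lpi_is_linear : linear (lpi S).
Proof. by move=> a x y; rewrite lpiD -lscaleE. Qed.

HB.instance Definition _ := GRing.isLinear.Build K V (lquot S) *:%R (lpi S)
  lpi_is_linear.

Lemma lpi_eq0 x : lpi S x = 0 <-> lspan S x.
Proof. by rewrite -(linear0 (lpi S)) lpiP subr0. Qed.

End LinearQuotient.

HB.mixin Record Lmodule_isLieAlgebra (K : fieldType) L of GRing.Lmodule K L := {
  lie : L -> L -> L;
  lie_linearl : forall y, linear (lie^~ y);
  lie_linearr : forall x, linear (lie x);
  liexx : forall x, lie x x = 0;
  lie_jacobi : forall x y z,
    lie x (lie y z) + lie y (lie z x) + lie z (lie x y) = 0
}.

#[short(type="lieAlgType")]
HB.structure Definition LieAlgebra (K : fieldType) :=
  { L of Lmodule_isLieAlgebra K L & GRing.Lmodule K L }.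

Section LieAlgebraDefs.
Context {K : fieldType} {g : lieAlgType K}.

Definition lie_subalgebra (S : set g) : Prop :=
  subspace S /\ forall x y, S x -> S y -> S (lie x y).

Definition lie_gen (G : set g) : set g := smallest lie_subalgebra G.

(* Lie algebra homomorphisms from the subalgebra S to the abelian Lie algebra
   K; the values of phi outside of S are irrelevant. *)
Definition lie_character (S : set g) (phi : g -> K) : Prop :=
  (forall a x y, S x -> S y -> phi (a *: x + y) = a * phi x + phi y) /\
  (forall x y, S x -> S y -> phi (lie x y) = 0).

(* The enveloping algebra is the free algebra on the symbols [fsym x], x in g,
   modulo the two-sided ideal making [fsym] linear and turning brackets into
   commutators. *)
Notation falg := {malg K[{fmonom g}]}.

Definition fsym (x : g) : falg := << fmu x >>.

Definition two_sided_ideal (I : set falg) : Prop :=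
  subspace I /\ forall a x, I x -> I (a * x) /\ I (x * a).

Definition uea_relations : set falg :=
  [set r | (exists a x y, r = fsym (a *: x + y) - (a *: fsym x + fsym y)) \/
           (exists x y, r = fsym x * fsym y - fsym y * fsym x - fsym (lie x y))].

Definition uea_ideal : set falg := smallest two_sided_ideal uea_relations.

End LieAlgebraDefs.
Arguments uea_ideal {K} g.

Definition uea (K : fieldType) (g : lieAlgType K) : Type := lquot (uea_ideal g).
HB.instance Definition _ (K : fieldType) (g : lieAlgType K) :=
  GRing.Lmodule.on (uea g).

Section EnvelopingAlgebra.
Context {K : fieldType} {g : lieAlgType K}.
Notation falg := {malg K[{fmonom g}]}.
Notation I := (uea_ideal g).
Implicit Types (x y : falg) (p q : uea g).

Lemma uea_ideal_two_sided : two_sided_ideal I.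
Proof.
have H : subspace I.
  split=> [|a x y Ix Iy] J [sJ SJ]; first by case: sJ => -[].
  by case: (sJ) => -[_ D] _; apply: D; [apply: Ix | apply: Iy].
by split=> // a x Ix; split=> J [sJ SJ]; case: (sJ) => _ /(_ a x (Ix J _))[].
Qed.

Lemma uea_eq x y : lpi I x = lpi I y <-> I (x - y).
Proof. by rewrite lpiP lspan_id //; case: uea_ideal_two_sided. Qed.

Lemma uea_ideal_coef1 x : I x -> x@_(mone : {fmonom g}) = 0.
Proof.
pose J : set falg := [set x | x@_(mone : {fmonom g}) = 0].
have c1 (z : g) : (fsym z)@_(mone : {fmonom g}) = 0.
  by rewrite mcoeffU; case: eqP => // /(congr1 val); rewrite /= fm1 fmuE.
have c1M (u v : falg) :
    (u * v)@_(mone : {fmonom g}) =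
    u@_(mone : {fmonom g}) * v@_(mone : {fmonom g}).
  exact: (mcoeff1g_is_multiplicative {fmonom g} K).1.
suff: I `<=` J by apply.
apply: smallest_sub => [|r].
  split; first split; rewrite /J /=; first by rewrite mcoeff0.
    by move=> a u v u0 v0; rewrite mcoeffD mcoeffZ u0 v0 mulr0 addr0.
  by move=> a u u0; split; rewrite (c1M, c1M) u0 ?mulr0 ?mul0r.
case=> -[].
  by move=> a [u [v ->]]; rewrite /J /= mcoeffB mcoeffD mcoeffZ !c1 mulr0 addr0 subr0.
have cc (u v : g) : (fsym u * fsym v)@_(mone : {fmonom g}) = 0.
  by apply: etrans (c1M _ _) _; rewrite c1 mul0r.
move=> u [v ->]; move: (cc u v) (cc v u) (c1 (lie u v)); rewrite /J /=.
move: (fsym u * fsym v) (fsym v * fsym u) (fsym (lie u v)) => r1 r2 r3.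
by rewrite !mcoeffB => -> -> ->; rewrite !subr0.
Qed.

Definition uea1 : uea g := lpi I 1.
Definition uea_mul p q : uea g := lpi I (lrepr p * lrepr q).

Lemma uea_mulE x y : uea_mul (lpi I x) (lpi I y) = lpi I (x * y).
Proof.
have [[I0 ID] IM] := uea_ideal_two_sided.
apply/uea_eq; set x' := lrepr _; set y' := lrepr _.
have Ix : I (x' - x) by apply/uea_eq; rewrite lreprK.
have Iy : I (y' - y) by apply/uea_eq; rewrite lreprK.
have -> : x' * y' - x * y = 1 *: ((x' - x) * y') + x * (y' - y).
  by rewrite scale1r mulrBl mulrBr addrA subrK.
by apply: ID; [case: (IM y' _ Ix) | case: (IM x _ Iy)].
Qed.

Lemma uea_mulA : associative uea_mul.
Proof.
by move=> p q r; rewrite -[p]lreprK -[q]lreprK -[r]lreprK !uea_mulE mulrA.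
Qed.

Lemma uea_mul1 : left_id uea1 uea_mul.
Proof. by move=> p; rewrite -[p]lreprK uea_mulE mul1r. Qed.

Lemma uea_mulr1 : right_id uea1 uea_mul.
Proof. by move=> p; rewrite -[p]lreprK uea_mulE mulr1. Qed.

Lemma uea_mulDl : left_distributive uea_mul +%R.
Proof.
move=> p q r; rewrite -[p]lreprK -[q]lreprK -[r]lreprK.
by rewrite -[_ + lpi I _]lpiD !uea_mulE mulrDl lpiD.
Qed.

Lemma uea_mulDr : right_distributive uea_mul +%R.
Proof.
move=> p q r; rewrite -[p]lreprK -[q]lreprK -[r]lreprK.
by rewrite -[_ + lpi I _]lpiD !uea_mulE mulrDr lpiD.
Qed.

Lemma uea1_neq0 : uea1 != 0.
Proof.
apply/eqP; rewrite /uea1 -(linear0 (lpi I)) => /uea_eq; rewrite subr0.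
by move=> /uea_ideal_coef1/eqP; rewrite mcoeff1 eqxx oner_eq0.
Qed.

HB.instance Definition _ := GRing.Zmodule_isNzRing.Build (uea g)
  uea_mulA uea_mul1 uea_mulr1 uea_mulDl uea_mulDr uea1_neq0.

Lemma malg_scalerAr (a : K) x y : a *: (x * y) = x * (a *: y).
Proof.
apply/malgP => k.
rewrite mcoeffZ.
apply: etrans (esym (mcoeffMlw k (fsubset_refl (msupp x)) (msuppZ_le a y))).
rewrite [X in a * X](mcoeffMl x y k) mulr_sumr.
apply: eq_bigr => i _; rewrite mulr_sumr; apply: eq_bigr => j _.
by rewrite mcoeffZ mulrnAr mulrCA.
Qed.

Lemma uea_scaleAl (a : K) p q : a *: (p * q) = (a *: p) * q.
Proof.
have M x y : (lpi I x : uea g) * (lpi I y : uea g) = lpi I (x * y).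
  exact: uea_mulE.
rewrite -[p]lreprK -[q]lreprK; move: (lrepr p) (lrepr q) => x y.
rewrite M -[X in _ = X * _](linearZ_LR (lpi I)) M.
by rewrite -[LHS](linearZ_LR (lpi I)) scalerAl.
Qed.

HB.instance Definition _ := GRing.Lmodule_isLalgebra.Build K (uea g) uea_scaleAl.

Lemma uea_scaleAr (a : K) p q : a *: (p * q) = p * (a *: q).
Proof.
have M x y : (lpi I x : uea g) * (lpi I y : uea g) = lpi I (x * y).
  exact: uea_mulE.
rewrite -[p]lreprK -[q]lreprK; move: (lrepr p) (lrepr q) => x y.
rewrite M -[X in _ = _ * X](linearZ_LR (lpi I)) M.
by rewrite -[LHS](linearZ_LR (lpi I)) malg_scalerAr.
Qed.

HB.instance Definition _ := GRing.Lalgebra_isAlgebra.Build K (uea g) uea_scaleAr.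

Definition uea_in (x : g) : uea g := lpi I (fsym x).

Lemma uea_in_linear : linear uea_in.
Proof.
move=> a x y; rewrite /uea_in -linearP; apply/uea_eq.
by apply: sub_gen_smallest; left; exists a, x, y.
Qed.

HB.instance Definition _ := GRing.isLinear.Build K g (uea g) *:%R uea_in
  uea_in_linear.

Lemma uea_in_lie (x y : g) :
  uea_in (lie x y) = uea_in x * uea_in y - uea_in y * uea_in x.
Proof.
rewrite [_ * _]uea_mulE [X in _ - X]uea_mulE -[_ - _]linearB; apply/esym/uea_eq.
by apply: sub_gen_smallest; right; exists x, y.
Qed.

End EnvelopingAlgebra.

(* A vector space with a family of operators indexed by I: modules over a Lie
    algebra g are the case I = g, modules over an algebra given by generators
    and relations are the case where I is the set of generators. *)
Record opModule (K : fieldType) (I : Type) := OpModule {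
  opspace :> lmodType K;
  act : I -> opspace -> opspace
}.

Section OpModules.
Context {K : fieldType} {I : Type}.
Implicit Types (M N : opModule K I).

Definition submodule M (N : set M) : Prop :=
  subspace N /\ forall i w, N w -> N (act i w).

Definition gen_submodule M (S : set M) : set M := smallest (@submodule M) S.

Definition simple_module M : Prop :=
  (exists w : M, w != 0) /\
  forall N : set M, submodule N -> N = [set 0] \/ N = setT.

Definition module_hom M N (F : M -> N) : Prop :=
  linear F /\ forall i w, F (act i w) = act i (F w).

Definition module_iso M N : Prop :=
  exists F : M -> N, module_hom F /\ bijective F.

Definition simple_quotient M N : Prop :=
  simple_module N /\
  exists F : M -> N, module_hom F /\ forall w, exists v, F v = w.

Definition quotient_module M (S : set M) : opModule K I :=
  OpModule (fun i (q : lquot (gen_submodule S)) =>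
              lpi (gen_submodule S) (act i (lrepr q))).

Lemma gen_submoduleP M (S : set M) : submodule (gen_submodule S).
Proof.
split; first split=> [|a x y Nx Ny]; last move=> i w Nw; move=> J [sJ SJ].
- by case: sJ => -[].
- by case: (sJ) => -[_ D] _; apply: D; [apply: Nx | apply: Ny].
- by case: (sJ) => _; apply; apply: Nw.
Qed.

Lemma quotient_moduleE M (S : set M) i (w : M) : linear (act (o:=M) i) ->
  act (o:=quotient_module S) i (lpi (gen_submodule S) w) =
  lpi (gen_submodule S) (act i w).
Proof.
move=> lin; have [sN actN] := gen_submoduleP S.
apply/lpiP; rewrite lspan_id //.
have := (lpiP _ _).1 (lreprK (lpi (gen_submodule S) w)).
rewrite lspan_id // => /(actN i); congr gen_submodule.
by rewrite addrC -scaleN1r lin scaleN1r addrC.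
Qed.

End OpModules.
Arguments act {K I o}.

Section LieModules.
Context {K : fieldType} {g : lieAlgType K}.

Definition lie_module (M : opModule K g) : Prop :=
  [/\ forall w : M, linear (fun x => act x w),
      forall x, linear (act x : M -> M) &
      forall x y (w : M), act (lie x y) w = act x (act y w) - act y (act x w)].

(* U(g) (x)_{U(S)} K v, where S acts on v by phi. Identifying U(g) (x)_K K v
   with U(g), it is the quotient of U(g) by the span of the elements
   a x - phi(x) a with a in U(g) and x in S. *)
Definition balanced (S : set g) (phi : g -> K) : set (uea g) :=
  [set r | exists a x, S x /\ r = a * uea_in x - phi x *: a].

Definition induced (S : set g) (phi : g -> K) : opModule K g :=
  OpModule (fun x (q : lquot (balanced S phi)) =>
              lpi (balanced S phi) (uea_in x * lrepr q)).

Definition induced_vec (S : set g) (phi : g -> K) : induced S phi :=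
  lpi (balanced S phi) 1.

Lemma induced_actE S phi x (a : uea g) :
  act (o := induced S phi) x (lpi (balanced S phi) a) =
  lpi (balanced S phi) (uea_in x * a).
Proof.
set B := balanced S phi; apply/lpiP; rewrite -mulrBr.
have : lspan B (lrepr (lpi B a) - a) by apply/lpiP; rewrite lreprK.
move: (_ - a) => b; pose J : set (uea g) := [set b | lspan B (uea_in x * b)].
have [B0 BD] := subspace_lspan B.
suff: lspan B `<=` J by apply.
apply: smallest_sub => [|r [c [y [Sy ->]]]].
  split; rewrite /J /=; first by rewrite mulr0.
  move=> k u v Ju Jv; rewrite mulrDr.
  suff -> : uea_in x * (k *: u) = k *: (uea_in x * u) by apply: BD.
  by rewrite scalerAr.
rewrite /J /= mulrBr mulrA -scalerAr; apply: sub_gen_smallest.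
by exists (uea_in x * c), y.
Qed.

Lemma induced_vecE S phi x : S x ->
  act x (induced_vec S phi) = phi x *: induced_vec S phi.
Proof.
move=> Sx; rewrite /induced_vec induced_actE mulr1 -linearZ.
apply/lpiP; apply: sub_gen_smallest; exists 1, x; split=> //.
by rewrite mul1r.
Qed.

Lemma lie_module_induced S phi : lie_module (induced S phi).
Proof.
split=> [w a x y|x a v w|x y w].
- rewrite -[w]lreprK !induced_actE -linearP /=.
  by rewrite linearP mulrDl -scalerAl.
- rewrite -[v]lreprK -[w]lreprK; move: (lrepr v) (lrepr w) => b c.
  rewrite -linearP !induced_actE -linearP /=.
  by rewrite [uea_in x * _]mulrDr -scalerAr.
- rewrite -[w]lreprK !induced_actE -linearB /=.
  by rewrite uea_in_lie mulrBl !mulrA.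
Qed.

Lemma lie_module_quotient (M : opModule K g) (S : set M) :
  lie_module M -> lie_module (quotient_module S).
Proof.
case=> linl linr br; pose E x := quotient_moduleE S _ (linr x).
split=> [w a x y|x a v w|x y w].
- by rewrite -[w]lreprK !E -linearP /= linl.
- by rewrite -[v]lreprK -[w]lreprK -linearP !E -linearP /= linr.
- by rewrite -[w]lreprK !E -linearB /= br.
Qed.

End LieModules.

Inductive sl2_basis := sl2_e | sl2_f | sl2_h.

Definition sl2_code (x : sl2_basis) : 'I_3 :=
  match x with sl2_e => inord 0 | sl2_f => inord 1 | sl2_h => inord 2 end.
Definition sl2_decode (i : 'I_3) : sl2_basis :=
  match val i with 0 => sl2_e | 1 => sl2_f | _ => sl2_h end.
Lemma sl2_codeK : cancel sl2_code sl2_decode.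
Proof. by case; rewrite /sl2_decode /= inordK. Qed.
HB.instance Definition _ := Choice.copy sl2_basis (can_type sl2_codeK).

(* [Some (x, n)] stands for x(n) = x (x) t^n, and [None] for K. *)
Definition affine_sl2 (K : numFieldType) : Type :=
  {malg K[option (sl2_basis * int)]}.
HB.instance Definition _ (K : numFieldType) := GRing.Lmodule.on (affine_sl2 K).

Definition lin_ext (K : fieldType) (I : choiceType) (V : lmodType K)
  (F : I -> V) (x : {malg K[I]}) : V := \sum_(i <- msupp x) x@_i *: F i.

Section AffineSl2.
Context {K : numFieldType}.
Notation ghat := (affine_sl2 K).

Definition mode (x : sl2_basis) (n : int) : ghat := << Some (x, n) >>.
Definition central : ghat := << None >>.

(* [sl2_lie x y n] is [x, y](n). *)
Definition sl2_lie (x y : sl2_basis) (n : int) : ghat :=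
  match x, y with
  | sl2_e, sl2_f => mode sl2_h n
  | sl2_f, sl2_e => - mode sl2_h n
  | sl2_h, sl2_e => 2 *: mode sl2_e n
  | sl2_e, sl2_h => - (2 *: mode sl2_e n)
  | sl2_h, sl2_f => - (2 *: mode sl2_f n)
  | sl2_f, sl2_h => 2 *: mode sl2_f n
  | _, _ => 0
  end.

Definition sl2_form (x y : sl2_basis) : K :=
  match x, y with
  | sl2_e, sl2_f | sl2_f, sl2_e => 1
  | sl2_h, sl2_h => 2
  | _, _ => 0
  end.

Definition basis_lie (i j : option (sl2_basis * int)) : ghat :=
  match i, j with
  | Some (x, n), Some (y, m) =>
      sl2_lie x y (n + m) +
      (n%:~R * sl2_form x y * (n + m == 0)%:R) *: central
  | _, _ => 0
  end.

Definition affine_lie (x y : ghat) : ghat :=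
  lin_ext (fun i => lin_ext (basis_lie i) y) x.

Lemma lin_ext_linear (I : choiceType) (V : lmodType K) (F : I -> V) :
  linear (lin_ext F).
Proof.
have E (d : {fset I}) (x : {malg K[I]}) : (msupp x `<=` d)%fset ->
    lin_ext F x = \sum_(i <- d) x@_i *: F i.
  move=> le; rewrite [LHS](big_fset_incl _ le) => //= i _ /mcoeff_outdom ->.
  by rewrite scale0r.
move=> a x y; set d := (msupp x `|` msupp y)%fset.
have lx : (msupp x `<=` d)%fset by exact: fsubsetUl.
have ly : (msupp y `<=` d)%fset by exact: fsubsetUr.
have lxy : (msupp (a *: x + y) `<=` d)%fset.
  apply: fsubset_trans (msuppD_le _ _) _; apply: fsetSU; exact: msuppZ_le.
rewrite (E _ _ lx) (E _ _ ly) (E _ _ lxy) scaler_sumr -big_split /=.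
by apply: eq_bigr => i _; rewrite mcoeffD mcoeffZ scalerDl scalerA.
Qed.

HB.instance Definition _ (I : choiceType) (V : lmodType K) (F : I -> V) :=
  GRing.isLinear.Build K {malg K[I]} V *:%R (lin_ext F) (lin_ext_linear F).

Lemma lin_extU (I : choiceType) (V : lmodType K) (F : I -> V) i :
  lin_ext F << i >> = F i.
Proof. by rewrite /lin_ext msuppU oner_eq0 big_seq_fset1 mcoeffUU scale1r. Qed.

Lemma affine_lieE i j : affine_lie << i >> << j >> = basis_lie i j.
Proof. by rewrite /affine_lie !lin_extU. Qed.

Lemma affine_lie_linearl y : linear (affine_lie^~ y).
Proof. exact: lin_ext_linear. Qed.

Lemma affine_lie_linearr x : linear (affine_lie x).
Proof.
have E t : affine_lie x t = \sum_(i <- msupp x) x@_i *: lin_ext (basis_lie i) t.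
  by [].
move=> a y z; rewrite !E scaler_sumr -big_split /=; apply: eq_bigr => i _.
by rewrite (lin_ext_linear (basis_lie i)) scalerDr !scalerA mulrC.
Qed.

Lemma affine_ind (P : ghat -> Prop) :
  P 0 -> (forall a x y, P x -> P y -> P (a *: x + y)) ->
  (forall i, P << i >>) -> forall x, P x.
Proof.
move=> P0 PD PU x; rewrite [x]monalgE.
elim: (enum_fset (msupp x)) => [|i s IH]; first by rewrite big_nil.
rewrite big_cons; suff -> : << x@_i *g i >> = x@_i *: << i >> by apply: PD.
by apply/malgP => k; rewrite mcoeffZ !mcoeffU mulrnAr mulr1.
Qed.

HB.instance Definition _ x :=
  GRing.isLinear.Build K ghat ghat *:%R (affine_lie x) (affine_lie_linearr x).

Lemma affine_lieC x y : affine_lie x y = - affine_lie y x.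
Proof.
move: x; apply: affine_ind.
- by rewrite raddf0 /affine_lie linear0 oppr0.
- by move=> a u v Eu Ev; rewrite affine_lie_linearl linearP Eu Ev opprD scalerN.
move=> i; move: y; apply: affine_ind.
- by rewrite raddf0 /affine_lie linear0 oppr0.
- move=> a u v Eu Ev; rewrite affine_lie_linearl linearP /= Eu Ev.
  by rewrite opprD scalerN.
move=> j; rewrite !affine_lieE; case: i j => [[x n]|] [[y m]|] /=; rewrite ?oppr0 //.
rewrite [m + n]addrC opprD; congr (_ + _); last first.
  rewrite -scaleNr; case: eqP => [e|_]; last by rewrite !mulr0 oppr0.
  have -> : m = - n by apply/eqP; rewrite -addr_eq0 addrC e.
  by rewrite !mulr1 rmorphN /= mulNr opprK; case: x y => [] [].
by case: x y => [] []; rewrite /= ?opprK ?oppr0.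
Qed.

Lemma affine_liexx x : affine_lie x x = 0.
Proof.
have := affine_lieC x x; move: (affine_lie x x) => v /eqP.
by rewrite -addr_eq0 -mulr2n -scaler_nat scaler_eq0 (pnatr_eq0 K) => /orP[|/eqP].
Qed.

Lemma jacobi_linear (V : lmodType K) (br : V -> V -> V)
    (J := fun x y z => br x (br y z) + br y (br z x) + br z (br x y)) :
  (forall y, linear (br^~ y)) -> (forall x, linear (br x)) ->
  forall y z, linear (fun x => J x y z).
Proof.
move=> linl linr y z a u v; rewrite /J.
have LL b p q w : br (b *: p + q) w = b *: br p w + br q w by exact: linl.
have LR b p q w : br w (b *: p + q) = b *: br w p + br w q by exact: linr.
rewrite !(LL, LR) !scalerDr.
by rewrite [X in X + _ = _]addrACA [LHS]addrACA.
Qed.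

Lemma affine_lie_central x : affine_lie x central = 0.
Proof.
rewrite affine_lieC /affine_lie lin_extU /lin_ext big1 ?oppr0 // => i _.
exact: scaler0.
Qed.

Lemma cyclic_linear_eq0 (J : ghat -> ghat -> ghat -> ghat) :
  (forall u v w, J u v w = J v w u) ->
  (forall v w, linear (fun u => J u v w)) ->
  (forall i j k, J << i >> << j >> << k >> = 0) -> forall x y z, J x y z = 0.
Proof.
move=> Jrot Jlin Jbasis.
have J0 v w : J 0 v w = 0.
  have := Jlin v w 1 0 0; rewrite /= scaler0 addr0 scale1r => /eqP.
  by rewrite eq_sym -subr_eq0 addrK => /eqP.
have Jind v w : (forall i, J << i >> v w = 0) -> forall u, J u v w = 0.
  move=> H; apply: affine_ind => [|a p q Ep Eq|]; [exact: J0| |exact: H].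
  by rewrite [LHS](Jlin v w a p q) Ep Eq scaler0 addr0.
move=> x y z; apply: (Jind y z) => i; rewrite Jrot; apply: (Jind) => j.
by rewrite Jrot; apply: Jind => k; rewrite Jrot; exact: Jbasis.
Qed.

Lemma affine_jacobi x y z :
  affine_lie x (affine_lie y z) + affine_lie y (affine_lie z x) +
  affine_lie z (affine_lie x y) = 0.
Proof.
pose J x y z := affine_lie x (affine_lie y z) + affine_lie y (affine_lie z x) +
  affine_lie z (affine_lie x y).
have Jrot u v w : J u v w = J v w u by rewrite /J [RHS]addrC addrA.
apply: (@cyclic_linear_eq0 J Jrot) => [v w|i j k].
  exact: jacobi_linear affine_lie_linearl affine_lie_linearr v w.
have R0 u : affine_lie u 0 = 0 by exact: linear0.
have JC v w : J central v w = 0.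
  have C0 u : affine_lie central u = 0 by rewrite affine_lieC affine_lie_central oppr0.
  by rewrite /J affine_lie_central !C0 !R0 !addr0.
case: i => [[a n]|]; last exact: JC.
case: j => [[b m]|]; last by rewrite Jrot; exact: JC.
case: k => [[c k]|]; last by rewrite Jrot Jrot; exact: JC.
pose co a b : K := match a, b with
  | sl2_e, sl2_f => 1 | sl2_f, sl2_e => - 1 | sl2_h, sl2_e => 2
  | sl2_e, sl2_h => - 2 | sl2_h, sl2_f => - 2 | sl2_f, sl2_h => 2
  | _, _ => 0 end.
pose tg a b := match a, b with
  | sl2_e, sl2_h | sl2_h, sl2_e => sl2_e | sl2_f, sl2_h | sl2_h, sl2_f => sl2_f
  | _, _ => sl2_h end.
have S u v s : sl2_lie u v s = co u v *: mode (tg u v) s.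
  by case: u v => [] []; rewrite /= ?scale0r ?scale1r ?scaleN1r ?scaleNr.
have B u p v q w r l : l = p + (q + r) ->
    affine_lie << Some (u, p) >>
      (affine_lie << Some (v, q) >> << Some (w, r) >>) =
    (co v w * co u (tg v w)) *: mode (tg u (tg v w)) l +
    (co v w * (p%:~R * sl2_form u (tg v w) * (l == 0)%:R)) *: central.
  move=> ->; have e := affine_lieE (Some (v, q)) (Some (w, r)).
  apply: (etrans (congr1 (affine_lie _) e)); rewrite [LHS](linearD (affine_lie _)) !(linearZ_LR (affine_lie _)) /=.
  rewrite affine_lie_central scaler0 addr0 S (linearZ_LR (affine_lie _)) /=.
  by rewrite affine_lieE /= S scalerDr !scalerA.
have final (V : lmodType K) (M : sl2_basis -> V) (Z : V) (n' m' k' d : K) :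
    d = 0 \/ k' = - n' - m' ->
    ((co b c * co a (tg b c)) *: M (tg a (tg b c)) +
     (co b c * (n' * sl2_form a (tg b c) * d)) *: Z) +
    ((co c a * co b (tg c a)) *: M (tg b (tg c a)) +
     (co c a * (m' * sl2_form b (tg c a) * d)) *: Z) +
    ((co a b * co c (tg a b)) *: M (tg c (tg a b)) +
     (co a b * (k' * sl2_form c (tg a b) * d)) *: Z) = 0.
  move=> dE; rewrite [X in X + _ = _]addrACA [LHS]addrACA -!scalerDl.
  set s := (X in _ + X *: Z); have -> : s = 0.
    by rewrite /s; case: dE => ->; case: (a) (b) (c) => [] [] [] /=; ring.
  rewrite scale0r addr0.
  case: (a) (b) (c) => [] [] [] /=;
    rewrite ?(mul0r, mulr0, mulr1, mul1r, scale0r, addr0, add0r) // -?scalerDl;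
    by rewrite (_ : _ + _ = 0) ?scale0r //; ring.
pose l := n + (m + k).
have El2 : l = m + (k + n) by rewrite /l addrC addrA.
have El3 : l = k + (n + m) by rewrite /l addrA addrC.
have B1 := B a n b m c k l erefl; have B2 := B b m c k a n l El2.
have B3 := B c k a n b m l El3.
apply: (etrans (congr2 +%R (congr2 +%R B1 B2) B3)).
have kE : l == 0 -> k%:~R = - n%:~R - m%:~R :> K.
  have -> : k = l - n - m by rewrite /l; ring.
  by move=> /eqP ->; rewrite sub0r rmorphB rmorphN.
have dE : (l == 0)%:R = 0 :> K \/ k%:~R = - n%:~R - m%:~R :> K.
  by case: eqP kE => [_ /(_ isT)|_ _]; [right | left].
apply: (final ghat (mode^~ l) central _ _ _ _ dE).
Qed.

HB.instance Definition _ := Lmodule_isLieAlgebra.Build K ghat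
  affine_lie_linearl affine_lie_linearr affine_liexx affine_jacobi.

End AffineSl2.

Definition S_alg (K : numFieldType) (p : nat) : set (affine_sl2 K) :=
  lie_gen [set x | [\/ x = central,
                       exists2 n : int, -1 < n & x = mode sl2_e n,
                       exists2 m : int, p%:Z < m & x = mode sl2_f m |
                       exists2 k : int, 0 <= k & x = mode sl2_h k]].

Definition Mhat (K : numFieldType) (p : nat) (phi : affine_sl2 K -> K) :
  opModule K (affine_sl2 K) := induced (S_alg p) phi.

Definition Mhat_vec (K : numFieldType) (p : nat) (phi : affine_sl2 K -> K) :
  Mhat p phi := induced_vec (S_alg p) phi.

(* Modules over the universal affine vertex algebra V^k(sl_2) are the smooth
   modules on which the central element acts by k. *)
Definition vertex_module (K : numFieldType) (k : K)
    (M : opModule K (affine_sl2 K)) : Prop :=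
  [/\ lie_module M,
      forall w : M, act central w = k *: w &
      forall (x : sl2_basis) (w : M),
        exists N : int, forall n, N < n -> act (mode x n) w = 0].

(* A : field_on V stands for the series sum_n A_n z^(-n-1). A sum over a set of
   indices is 0 when its support is infinite; this never happens below, since
   A_n w = 0 for n large in all the fields considered. *)
Definition field_on (K : fieldType) (V : lmodType K) := int -> V -> V.

Section Fields.
Context {K : fieldType} {V : lmodType K}.
Implicit Types (A B : field_on V).

(* :A(z)B(z): = A(z)_- B(z) + B(z) A(z)_+, where A(z)_- collects the modes A_k
   with k < 0 and A(z)_+ the others. *)
Definition normal_prod A B : field_on V := fun n w =>
  \sum_(k \in [set k : int | k < 0]) A k (B (n - 1 - k) w) +
  \sum_(k \in [set k : int | 0 <= k]) B (n - 1 - k) (A k w).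

(* A(z)B(z), for fields whose modes commute. *)
Definition plain_prod A B : field_on V := fun n w =>
  \sum_(k \in [set: int]) A k (B (n - 1 - k) w).

Definition deriv_field A : field_on V := fun n w => (- n%:~R) *: A (n - 1) w.

End Fields.

(* T(n), the coefficient of z^(-n-2) in Y(t, z), by the formula
   Y(x(-1)y(-1)1, z) = :x(z)y(z): for x, y in sl_2. *)
Definition sugawara (K : numFieldType) (M : opModule K (affine_sl2 K))
    (n : int) (w : M) : M :=
  let X (x : sl2_basis) : field_on M := fun k => act (mode x k) in
  2^-1 *: (normal_prod (X sl2_e) (X sl2_f) (n + 1) w +
           normal_prod (X sl2_f) (X sl2_e) (n + 1) w +
           2^-1 *: normal_prod (X sl2_h) (X sl2_h) (n + 1) w).

(* [theta n] is the coefficient of z^(-n-2); the indices n < p are the p - i with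
   i > 0. *)
Definition Mbar (K : numFieldType) (p : nat) (phi : affine_sl2 K -> K)
    (theta : int -> K) : opModule K (affine_sl2 K) :=
  let u := Mhat_vec p phi in
  quotient_module
    [set w : Mhat p phi | exists2 n : int, n < p%:Z &
       w = sugawara n u - theta n *: u].

(* f : int -> K stands for the Laurent series sum_k f_k z^k. *)
Section Laurent.
Context {K : fieldType}.
Implicit Types (f g : int -> K).

Definition laurent_mul f g : int -> K :=
  fun k => \sum_(i \in [set: int]) f i * g (k - i).

Definition laurent_deriv f : int -> K := fun k => (k + 1)%:~R * f (k + 1).

(* The coefficient of z^(-n-d). *)
Definition lcoef (d : int) f (n : int) : K := f (- n - d).

End Laurent.

(* [weyl_a n] and [weyl_as n] stand for a(n) and a^*(n). *)
Inductive weyl_gen := weyl_a of int | weyl_as of int.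

Definition weyl_module (K : fieldType) (W : opModule K weyl_gen) : Prop :=
  [/\ forall i, linear (act i : W -> W),
      forall n m (w : W), act (weyl_a n) (act (weyl_a m) w) =
                          act (weyl_a m) (act (weyl_a n) w),
      forall n m (w : W), act (weyl_as n) (act (weyl_as m) w) =
                          act (weyl_as m) (act (weyl_as n) w) &
      forall n m (w : W), act (weyl_a n) (act (weyl_as m) w) -
                          act (weyl_as m) (act (weyl_a n) w) =
                          (n + m == 0)%:R *: w].

Definition weyl_vacuum_module (K : fieldType) (W : opModule K weyl_gen)
    (vac : W) : Prop :=
  [/\ weyl_module W, simple_module W, gen_submodule [set vac] = setT,
      forall n : int, 0 <= n -> act (weyl_a n) vac = 0 &
      forall n : int, 0 <= n -> act (weyl_as (n + 1)) vac = 0].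

(* W_psi = W (x) L(psi); as L(psi) has dimension one, its space is that of W,
   with b(z) acting by psi(z). *)
Section Wakimoto.
Context {K : numFieldType} (W : opModule K weyl_gen) (psi : int -> K).

Definition weyl_field_a : field_on W := fun n => act (weyl_a n).

(* a^*(z) = sum_n a^*(n) z^(-n), so a^*(n+1) is its mode of index n. *)
Definition weyl_field_as : field_on W := fun n => act (weyl_as (n + 1)).

Definition wakimoto_b : field_on W := fun n w => lcoef 1 psi n *: w.

Definition wakimoto_mode (x : sl2_basis) : field_on W := fun n w =>
  let a := weyl_field_a in
  let as_ := weyl_field_as in
  match x with
  | sl2_e => a n w
  | sl2_h => - 2 *: normal_prod as_ a n w + wakimoto_b n w
  | sl2_f => - normal_prod as_ (normal_prod as_ a) n w
             - 2 *: deriv_field as_ n w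
             + plain_prod as_ wakimoto_b n w
  end.

Definition wakimoto_basis_act (w : W) (i : option (sl2_basis * int)) : W :=
  match i with
  | Some (x, n) => wakimoto_mode x n w
  | None => - 2 *: w
  end.

Definition wakimoto : opModule K (affine_sl2 K) :=
  OpModule (fun (x : affine_sl2 K) (w : W) => lin_ext (wakimoto_basis_act w) x).

End Wakimoto.

(* S_r(x_1, x_2, ...), the coefficient of y^r in exp(sum_n x_n y^n / n); the
   terms x_n with n > r and the powers > r of the exponent do not contribute. *)
Definition schur (K : numFieldType) (r : nat) (x : nat -> K) : K :=
  (\sum_(m < r.+1) (m`!%:R)^-1 *:
     (\sum_(1 <= n < r.+1) (x n / n%:R) *: 'X^n) ^+ m : {poly K})`_r.

(* The series by which T(z) acts on W_{-chi}. The factor 1/4 goes with the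
   factor 1/2 in t: since t contains (1/4) h(-1)^2 1, T(2p) acts on the vacuum
   vector of W_{-chi} by chi_p^2 / 4 when p > 0. *)
Definition theta_series (K : numFieldType) (chi : int -> K) : int -> K :=
  fun k => 4^-1 * (laurent_mul chi chi k + 2 * laurent_deriv chi k).

(* Main.v *)
Require Import Defs.
From HB Require Import structures.
From mathcomp Require Import all_boot all_order all_algebra.
From mathcomp Require Import finmap.
From mathcomp Require Import ring zify.
From mathcomp Require Import boolp classical_sets functions fsbigop reals complex.
From mathcomp.multinomials Require Import monalg.

(* The vacuum vector of W_{-chi} satisfies the relations defining M^(phi), so
   M^(phi) maps to W_{-chi}, and everything reduces to the simplicity of W_{-chi}
   and, for the last part, to the injectivity of the map induced on the quotient.

   A submodule is stable under the modes of a, of J = :a* a: and of f. If it contains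
   the vacuum it is everything: f(p') produces all powers of a*(0), the modes of J
   spread them to all products of creation operators a*(-j), and W is cyclic over the
   Weyl algebra. Conversely, any nonzero vector of the submodule can be lowered with
   a(n) (n >= 0), J and f(p' + 1) to the vacuum, or else p' = 0, chi_0 = l + 1 and the
   submodule contains a(-1)^l 1; then f(0)^l a(-1)^l 1 is a multiple of the vacuum whose
   coefficient is, up to sign, l!^2 times the Schur polynomial.

   At level -2 the modes T(n) commute with the action and act on W_{-chi} by theta_n. In
   the quotient where T(n) = theta_n for all n, the leading term chi_p h(-i) of T(p - i)
   eliminates the modes h(-i), so the quotient is spanned by the products of e(-k)
   (k > 0) and f(p - j) (j >= 0) applied to the generator. Their images in W_{-chi} have
   leading terms proportional to the corresponding products of a(-k) and a*(-j), hence
   are linearly independent, and the map is injective. *)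

Set Implicit Arguments.
Unset Strict Implicit.
Unset Printing Implicit Defensive.

Import Order.TTheory GRing.Theory Num.Theory.

Local Open Scope ring_scope.

(** Commutators are computed mode by mode, with normally ordered sums whose cut between the two
    orders is a parameter. Commuting with a mode shifts indices and drags the cut along; moving the
    cut back produces the anomalous terms. As b(z) acts by scalars, only the Weyl modes contribute
    to the commutators of e, h, f. The obstacle to simplicity is that a submodule is stable under
    a(n) and J(n) but not visibly under a^*(n). Each a^*(n) has to be reached indirectly: for n > 1
    it occurs in J(n-1) as a(-1) a^*(n), and a(-1) is injective and commutes with it. This stops at
    a^*(1), where only f(p'+1) and J(0) are left; the exceptional value of chi_0 is the one for
    which f(1) fails to lower the degree in a(-1). Linear independence is expressed without bases:
    words of annihilation operators serve as test functionals, and a relation that they cannot see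
    is transported to the module to be bounded. *)

Section LinearTerms.
Context {K : fieldType} {V : lmodType K}.

(** Linear combinations reflected over a list of atoms, so that an identity in a module becomes one
    ring identity per atom. Positions are compared with [Nat.eqb], which [cbn] evaluates. *)
Inductive lterm :=
  | LVar of nat
  | LZero
  | LAdd of lterm & lterm
  | LOpp of lterm
  | LNat of lterm & nat
  | LScale of K & lterm.

Fixpoint leval (e : seq V) (t : lterm) : V :=
  match t with
  | LVar i => nth 0 e i
  | LZero => 0
  | LAdd s t => leval e s + leval e t
  | LOpp t => - leval e t
  | LNat t n => leval e t *+ n
  | LScale a t => a *: leval e t
  end.

Fixpoint lcoefs (t : lterm) (i : nat) : K :=
  match t with
  | LVar j => if Nat.eqb j i then 1 else 0
  | LZero => 0
  | LAdd s t => lcoefs s i + lcoefs t i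
  | LOpp t => - lcoefs t i
  | LNat t n => lcoefs t i *+ n
  | LScale a t => a * lcoefs t i
  end.

Lemma leval_sum e t : leval e t = \sum_(i < size e) lcoefs t i *: nth 0 e i.
Proof.
elim: t => [j||s IHs t IHt|t IHt|t IHt n|a t IHt] /=.
- have [lt|le] := ltnP j (size e).
    rewrite (bigD1 (Ordinal lt)) //= PeanoNat.Nat.eqb_refl scale1r big1 ?addr0 //.
    move=> i ne; case: (PeanoNat.Nat.eqb_spec j i) => [e1|]; last by rewrite scale0r.
    by case/eqP: ne; apply: val_inj.
  rewrite nth_default // big1 // => i _.
  case: (PeanoNat.Nat.eqb_spec j i) => [e1|]; last by rewrite scale0r.
  by move: le; rewrite e1 leqNgt ltn_ord.
- by rewrite big1 // => i _; rewrite scale0r.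
- by rewrite IHs IHt -big_split /=; apply: eq_bigr => i _; rewrite scalerDl.
- by rewrite IHt -sumrN; apply: eq_bigr => i _; rewrite scaleNr.
- by rewrite IHt -sumrMnl; apply: eq_bigr => i _; rewrite scalerMnl.
- by rewrite IHt scaler_sumr; apply: eq_bigr => i _; rewrite scalerA.
Qed.

Fixpoint lagree (n : nat) (s t : lterm) : Prop :=
  match n with
  | 0 => True
  | n'.+1 => lcoefs s n' = lcoefs t n' /\ lagree n' s t
  end.

Lemma leval_eq e s t : lagree (size e) s t -> leval e s = leval e t.
Proof.
rewrite !leval_sum => H; apply: eq_bigr => -[i lt] _ /=; congr (_ *: _).
elim: (size e) H lt => [|n IH] //= [E H]; rewrite ltnS leq_eqVlt => /orP[/eqP->|] //.
exact: IH.
Qed.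

End LinearTerms.

Ltac lmod_mem x e :=
  lazymatch e with
  | nil => constr:(false)
  | x :: _ => constr:(true)
  | _ :: ?r => lmod_mem x r
  end.
Ltac lmod_index x e :=
  lazymatch e with
  | x :: _ => constr:(O)
  | _ :: ?r => let n := lmod_index x r in constr:(S n)
  end.
Ltac lmod_atoms t e :=
  lazymatch t with
  | @GRing.add _ ?a ?b => let e1 := lmod_atoms a e in lmod_atoms b e1
  | @GRing.opp _ ?a => lmod_atoms a e
  | @GRing.natmul _ ?a _ => lmod_atoms a e
  | @GRing.scale _ _ _ ?a => lmod_atoms a e
  | @GRing.zero _ => e
  | _ => lazymatch lmod_mem t e with true => e | false => constr:(t :: e) end
  end.
Ltac lmod_reify K t e :=
  lazymatch t with
  | @GRing.add _ ?a ?b =>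
      let a1 := lmod_reify K a e in let b1 := lmod_reify K b e in
      constr:(@LAdd K a1 b1)
  | @GRing.opp _ ?a => let a1 := lmod_reify K a e in constr:(@LOpp K a1)
  | @GRing.natmul _ ?a ?n =>
      let a1 := lmod_reify K a e in constr:(@LNat K a1 n)
  | @GRing.scale _ _ ?k ?a =>
      let a1 := lmod_reify K a e in constr:(@LScale K k a1)
  | @GRing.zero _ => constr:(@LZero K)
  | _ => let i := lmod_index t e in constr:(@LVar K i)
  end.
(* Proves an equation in a left module by comparing the coefficients of the
   atoms with [ring]. *)
Ltac lmod_of K V :=
  lazymatch goal with
  | |- ?a = ?b =>
      let e0 := constr:(@nil V) in
      let e1 := lmod_atoms a e0 in
      let e := lmod_atoms b e1 in
      let s := lmod_reify K a e in
      let t := lmod_reify K b e in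
      refine (@leval_eq K V e s t _);
      cbn [lagree size lcoefs Nat.eqb]; repeat split; try ring
  end.

(** * Linear maps as bare functions, subspaces as predicates *)

Section LinearFunctions.
Context {K : fieldType} {U V : lmodType K} (f : U -> V).
Hypothesis lf : linear f.

Let F : {linear U -> V} := HB.pack f (GRing.isLinear.Build K U V *:%R f lf).

Lemma lf0 : f 0 = 0. Proof. exact: (linear0 F). Qed.
Lemma lfD x y : f (x + y) = f x + f y. Proof. exact: (linearD F). Qed.
Lemma lfN x : f (- x) = - f x. Proof. exact: (linearN F). Qed.
Lemma lfB x y : f (x - y) = f x - f y. Proof. exact: (linearB F). Qed.
Lemma lfZ a x : f (a *: x) = a *: f x. Proof. exact: (linearZ_LR F). Qed.
Lemma lf_sum I (r : seq I) P (G : I -> U) :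
  f (\sum_(i <- r | P i) G i) = \sum_(i <- r | P i) f (G i).
Proof. exact: (linear_sum F). Qed.

End LinearFunctions.

Section Subspaces.
Context {K : fieldType} {V : lmodType K} (N : set V).
Hypothesis sN : subspace N.

Lemma sub0 : N 0. Proof. by case: sN. Qed.
Lemma subZ a x : N x -> N (a *: x).
Proof. by case: sN => N0 ND Nx; rewrite -[_ *: _]addr0; apply: ND. Qed.
Lemma subD x y : N x -> N y -> N (x + y).
Proof. by case: sN => N0 ND Nx Ny; rewrite -[x]scale1r; apply: ND. Qed.
Lemma subN x : N x -> N (- x). Proof. by rewrite -scaleN1r; apply: subZ. Qed.
Lemma subB x y : N x -> N y -> N (x - y).
Proof. by move=> Nx Ny; apply: subD => //; apply: subN. Qed.
Lemma sub_sum I (r : seq I) (P : pred I) (G : I -> V) :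
  (forall i, P i -> N (G i)) -> N (\sum_(i <- r | P i) G i).
Proof. by move=> H; elim/big_rec: _ => [|i x Pi Nx]; [apply: sub0|apply: subD; auto]. Qed.
Lemma subZE a x : a != 0 -> N (a *: x) -> N x.
Proof. by move=> a0 /(subZ a^-1); rewrite scalerA mulVf // scale1r. Qed.
End Subspaces.

(** * Sums over the integers *)

Section IntegerSums.
Context {K : fieldType} {V : lmodType K}.
Implicit Types (F G : int -> V).

(* The value is 0 when the support is infinite. *)
Definition isum F : V := \sum_(k \in [set: int]) F k.

Definition fsupp F := exists N : nat, forall k : int,
  (k < - N%:Z) || (N%:Z < k) -> F k = 0.

Definition irange (N : nat) : seq int := [seq (i%:Z - N%:Z)%R | i <- iota 0 (N.*2.+1)].

Lemma irange_uniq N : uniq (irange N).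
Proof. by rewrite map_inj_uniq ?iota_uniq // => i j; lia. Qed.

Lemma mem_irange N k : (k \in irange N) = (- N%:Z <= k <= N%:Z).
Proof.
apply/mapP/idP => [[j]|H]; first by rewrite mem_iota; lia.
by exists (absz (k + N%:Z)%R); rewrite ?mem_iota; lia.
Qed.

Lemma isum_seq (s : seq int) F : uniq s -> (forall k, k \notin s -> F k = 0) ->
  isum F = \sum_(k <- s) F k.
Proof.
move=> us H; rewrite (fsbig_seq _ _ us) /isum; apply/esym; apply: fsbig_widen => //.
by move=> k [? ns]; apply: H; apply/negP.
Qed.

Lemma isumE N F : (forall k : int, (k < - N%:Z) || (N%:Z < k) -> F k = 0) ->
  isum F = \sum_(k <- irange N) F k.
Proof.
move=> H; apply: isum_seq (irange_uniq N) _ => k; rewrite mem_irange => nk.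
by apply: H; lia.
Qed.

Lemma fsupp2 F G : fsupp F -> fsupp G -> exists N : nat,
  (forall k : int, (k < - N%:Z) || (N%:Z < k) -> F k = 0) /\
  (forall k : int, (k < - N%:Z) || (N%:Z < k) -> G k = 0).
Proof.
move=> [M HM] [N HN]; exists (maxn M N); split=> k Hk; [apply: HM|apply: HN]; lia.
Qed.

Lemma fsupp_bounds F (lo hi : int) : (forall k, k < lo -> F k = 0) ->
  (forall k, hi < k -> F k = 0) -> fsupp F.
Proof.
move=> H1 H2; exists (maxn (absz lo) (absz hi))%N => k /orP[Hk|Hk]; [apply: H1|apply: H2]; lia.
Qed.

Lemma fsuppZ a F : fsupp F -> fsupp (fun k => a *: F k).
Proof. by move=> [N H]; exists N => k Hk; rewrite H // scaler0. Qed.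

Lemma eq_isum F G : (forall k, F k = G k) -> isum F = isum G.
Proof. by move=> /funext ->. Qed.

Lemma isumD F G : fsupp F -> fsupp G -> isum (fun k => F k + G k) = isum F + isum G.
Proof.
move=> fF fG; have [N [HF HG]] := fsupp2 fF fG.
rewrite (isumE HF) (isumE HG) -big_split /=; apply: isumE => k Hk.
by rewrite HF // HG // addr0.
Qed.

Lemma isumZ a F : fsupp F -> isum (fun k => a *: F k) = a *: isum F.
Proof.
move=> [N HF]; rewrite (isumE HF) scaler_sumr; apply: isumE => k Hk.
by rewrite HF // scaler0.
Qed.

Lemma isumB F G : fsupp F -> fsupp G -> isum (fun k => F k - G k) = isum F - isum G.
Proof.
move=> fF fG; rewrite -scaleN1r -isumZ // -isumD //; last exact: fsuppZ.
by apply: eq_isum => k; rewrite scaleN1r.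
Qed.

Lemma isum0 F : (forall k, F k = 0) -> isum F = 0.
Proof. by move=> H; rewrite (@isumE 0) ?big1. Qed.

Lemma isum1 k0 F : (forall k, k != k0 -> F k = 0) -> isum F = F k0.
Proof.
move=> H; rewrite (@isum_seq [:: k0]) ?big_seq1 // => k.
by rewrite inE; apply: H.
Qed.

Lemma isum_reindex (h : int -> int) F : bijective h -> isum (F \o h) = isum F.
Proof. by move=> bh; rewrite [RHS](@reindex_fsbigT _ _ +%R _ _ h F bh). Qed.

Lemma isum_shift m F : isum (fun k => F (k + m)) = isum F.
Proof.
by apply: (@isum_reindex (fun k => k + m)); exists (fun k => k - m) => k; lia.
Qed.

Lemma isum_flip m F : isum (fun k => F (m - k)) = isum F.
Proof.
by apply: (@isum_reindex (fun k => m - k)); exists (fun k => m - k) => k; lia.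
Qed.

(** An infinite support causes no trouble: the sum is then 0, which also lies in [N]. *)
Lemma isum_sub (N : set V) F : subspace N -> (forall k, N (F k)) -> N (isum F).
Proof.
by move=> sN H; apply: sub_sum.
Qed.

End IntegerSums.

Lemma lf_isum (K : fieldType) (U V : lmodType K) (f : U -> V) F : linear f ->
  fsupp F -> f (isum F) = isum (fun k => f (F k)).
Proof.
move=> lf [N HF]; rewrite (isumE HF) lf_sum //; apply/esym; apply: isumE => k Hk.
by rewrite HF // lf0.
Qed.

(** * Normally ordered products with a movable cut *)

Section Fields.
Context {K : fieldType} {V : lmodType K}.
Implicit Types (X Y : field_on V) (i k n m c : int) (w : V).

Definition is_field X : Prop := (forall n, linear (X n)) /\
  (forall w, exists N : int, forall n, N < n -> X n w = 0).

(* [np 0 X Y n] is the mode of index n + 1 of :X(z)Y(z):, and [np c X Y n] is the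
   same sum with the cut between the two orders at c. *)
Definition np c X Y n w : V :=
  isum (fun i => if i < c then X i (Y (n - i) w) else Y (n - i) (X i w)).

Lemma np_fsupp c X Y n w : is_field X -> is_field Y ->
  fsupp (fun i => if i < c then X i (Y (n - i) w) else Y (n - i) (X i w)).
Proof.
move=> [lX sX] [lY sY]; have [M HM] := sX w; have [N HN] := sY w.
apply: (@fsupp_bounds _ _ _ (Order.min c (n - N)) (Order.max c M)) => k Hk.
  by rewrite ifT ?HN ?(lf0 (lX _)) //; lia.
by rewrite ifF ?HM ?(lf0 (lY _)) //; lia.
Qed.

Lemma lin_np c X Y n : is_field X -> is_field Y -> linear (np c X Y n).
Proof.
move=> fX fY a u v; rewrite /np -isumZ; last exact: (np_fsupp _ _ _ fX fY).
rewrite -isumD; [|by apply: fsuppZ; exact: (np_fsupp _ _ _ fX fY)|exact: (np_fsupp _ _ _ fX fY)].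
have [lX _] := fX; have [lY _] := fY.
by apply: eq_isum => i; case: ifP => _; rewrite ?(lX, lY).
Qed.

Lemma np_field c X Y : is_field X -> is_field Y -> is_field (np c X Y).
Proof.
move=> fX fY; split=> [n|w]; first exact: lin_np.
have [[lX sX] [lY sY]] := (fX, fY); have [M HM] := sX w; have [N HN] := sY w.
(* Only the vectors [X i w] with [c <= i <= M] can be nonzero to the right of [Y]; there are
   finitely many, so one bound serves them all. *)
have [L HL] : exists L : int, forall i n : int, c <= i <= M -> L < n -> Y n (X i w) = 0.
  have : forall k : nat, exists L : int, forall i n : int, c <= i < c + k%:Z -> L < n ->
      Y n (X i w) = 0.
    elim=> [|k [L HL]]; first by exists 0 => i n; lia.
    have [L' HL'] := sY (X (c + k%:Z) w); exists (Order.max L L') => i n Hi Hn.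
    have [->|ne] := eqVneq i (c + k%:Z); first by apply: HL'; lia.
    by apply: HL; lia.
  move=> /(_ (absz (M + 1 - c)%R)) [L HL]; exists L => i n Hi Hn; apply: HL; lia.
exists (Order.max (N + c) (L + M)) => n Hn; apply: isum0 => i; case: ifP => ic.
  by rewrite HN ?(lf0 (lX _)) //; lia.
have [Mi|iM] := ltP M i; first by rewrite HM ?(lf0 (lY _)).
by apply: HL; lia.
Qed.

(** The commutator with [D] is a derivation of each summand and leaves the cut alone. That [X'] and
    [Y'] are fields follows from their being commutators with a fixed operator. *)
Lemma np_der c X Y X' Y' (D : V -> V) n w : is_field X -> is_field Y -> linear D ->
  (forall i u, D (X i u) - X i (D u) = X' i u) ->
  (forall i u, D (Y i u) - Y i (D u) = Y' i u) ->
  D (np c X Y n w) - np c X Y n (D w) = np c X' Y n w + np c X Y' n w.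
Proof.
move=> fX fY lD EX EY; have [[lX sX] [lY sY]] := (fX, fY).
have fX' : is_field X'.
  split=> [i a u v|u]; first by rewrite -!EX !(lX, lD, lX); lmod_of K V.
  have [M HM] := sX u; have [N HN] := sX (D u); exists (Order.max M N) => i Hi.
  by rewrite -EX HM ?HN ?(lf0 lD) ?subrr //; lia.
have fY' : is_field Y'.
  split=> [i a u v|u]; first by rewrite -!EY !(lY, lD, lY); lmod_of K V.
  have [M HM] := sY u; have [N HN] := sY (D u); exists (Order.max M N) => i Hi.
  by rewrite -EY HM ?HN ?(lf0 lD) ?subrr //; lia.
have S w' := np_fsupp c n w' fX fY.
have lS : fsupp (fun i => D (if i < c then X i (Y (n - i) w) else Y (n - i) (X i w))).
  by have [N HN] := S w; exists N => k Hk; rewrite HN // (lf0 lD).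
rewrite /np (lf_isum lD (S w)) -(isumB lS (S (D w))).
rewrite -(isumD (np_fsupp c n w fX' fY) (np_fsupp c n w fX fY')).
apply: eq_isum => i; case: ifP => _; rewrite -EX -EY ?(lfB (lX _)) ?(lfB (lY _));
  lmod_of K V.
Qed.

(** The cut moves with the indices of the left factor, whereas [np_shiftr] leaves it in place; this
    discrepancy is the source of the anomalies. *)
Lemma np_shiftl c X Y n w m :
  np c (fun i => X (i + m)) Y n w = np (c + m) X Y (n + m) w.
Proof.
rewrite /np -[RHS](isum_shift m); apply: eq_isum => i.
by rewrite ltrD2r (_ : n + m - (i + m) = n - i) //; lia.
Qed.

Lemma np_shiftr c X Y n w m : np c X (fun i => Y (i + m)) n w = np c X Y (n + m) w.
Proof.
by apply: eq_isum => i; rewrite (_ : n + m - i = n - i + m) //; lia.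
Qed.

Lemma np_flip c X Y n w : np c X Y n w = np (n + 1 - c) Y X n w.
Proof.
rewrite /np -[RHS](isum_flip n); apply: eq_isum => i; rewrite opprB addrCA subrr addr0.
by case: ifP => H; [rewrite ifF //|rewrite ifT //]; lia.
Qed.

Lemma np_scalel c X Y n w a : is_field X -> is_field Y ->
  np c (fun i u => a *: X i u) Y n w = a *: np c X Y n w.
Proof.
move=> fX fY; rewrite /np -isumZ; last exact: (np_fsupp _ _ _ fX fY).
by apply: eq_isum => i; case: ifP => // _; rewrite (lfZ (fY.1 _)).
Qed.

Lemma np_scaler c X Y n w a : is_field X -> is_field Y ->
  np c X (fun i u => a *: Y i u) n w = a *: np c X Y n w.
Proof.
move=> fX fY; rewrite np_flip np_scalel // [in RHS]np_flip.
by [].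
Qed.

Lemma np_addr c X Y Z n w : is_field X -> is_field Y -> is_field Z ->
  np c X (fun i u => Y i u + Z i u) n w = np c X Y n w + np c X Z n w.
Proof.
move=> fX fY fZ; rewrite /np -(isumD (np_fsupp c n w fX fY) (np_fsupp c n w fX fZ)).
by apply: eq_isum => i; case: ifP => // _; rewrite (lfD (fX.1 _)).
Qed.

Lemma np_0r c X n w : is_field X -> np c X (fun _ _ => 0) n w = 0.
Proof.
by move=> fX; apply: isum0 => i; case: ifP => // _; rewrite (lf0 (fX.1 _)).
Qed.

Lemma np_0l c Y n w : is_field Y -> np c (fun _ _ => 0) Y n w = 0.
Proof. by move=> fY; rewrite np_flip np_0r. Qed.

Lemma np_deltar c X n w m a : is_field X ->
  np c X (fun i u => ((m + i == 0)%:R * a) *: u) n w = a *: X (n + m) w.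
Proof.
move=> fX; have lX := fX.1.
have -> : a *: X (n + m) w = (((m + (n - (n + m))) == 0)%:R * a) *: X (n + m) w.
  by rewrite (_ : _ == 0) ?mul1r //; lia.
rewrite /np (@isum1 _ _ (n + m)) => [|k ne].
  by case: ifP => _ //; rewrite (lfZ (lX _)).
have -> : (m + (n - k) == 0) = false by lia.
by case: ifP => _; rewrite mul0r scale0r ?(lf0 (lX _)).
Qed.

Lemma np_deltal c Y n w m a : is_field Y ->
  np c (fun i u => ((m + i == 0)%:R * a) *: u) Y n w = a *: Y (n + m) w.
Proof. by move=> fY; rewrite np_flip np_deltar. Qed.

(** Between the two cuts the order of the factors is exchanged, so the difference is a sum of
    commutators; a discrete primitive [G] telescopes it, whichever of [c] and [d] is larger. *)
Lemma np_cut X Y n w (G : int -> V) c d : is_field X -> is_field Y ->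
  (forall i, X i (Y (n - i) w) - Y (n - i) (X i w) = G (i + 1) - G i) ->
  np d X Y n w = np c X Y n w + (G d - G c).
Proof.
move=> fX fY EG.
have step e : np (e + 1) X Y n w - G (e + 1) = np e X Y n w - G e.
  apply/eqP; rewrite -subr_eq0; apply/eqP.
  have -> : np (e + 1) X Y n w - G (e + 1) - (np e X Y n w - G e) =
    (np (e + 1) X Y n w - np e X Y n w) - (G (e + 1) - G e) by lmod_of K V.
  rewrite -EG /np -isumB; [|exact: (np_fsupp _ _ _ fX fY)..].
  rewrite (@isum1 _ _ e) => [|k ne]; first by rewrite ifT ?ifF ?subrr //; lia.
  have -> : (k < e + 1) = (k < e) by lia.
  by rewrite subrr.
have H (k : nat) e : np (e + k%:Z) X Y n w - G (e + k%:Z) = np e X Y n w - G e.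
  elim: k => [|k IH]; first by rewrite addr0.
  have -> : e + k.+1%:Z = e + k%:Z + 1 by lia.
  by rewrite step.
have -> : np c X Y n w + (G d - G c) = (np c X Y n w - G c) + G d by lmod_of K V.
have [le|lt] := leP c d.
  rewrite -(H (absz (d - c)%R)). have -> : c + (absz (d - c)%R)%:Z = d by lia.
  by rewrite subrK.
have := H (absz (c - d)%R) d; have -> : d + (absz (c - d)%R)%:Z = c by lia.
by move=> ->; rewrite subrK.
Qed.

Lemma np_comm X Y n w c d : is_field X -> is_field Y ->
  (forall i j u, X i (Y j u) = Y j (X i u)) -> np d X Y n w = np c X Y n w.
Proof.
move=> fX fY E; rewrite (@np_cut _ _ _ _ (fun=> 0) c) ?subrr ?addr0 // => i.
by rewrite E !subrr.
Qed.

Lemma np_linear_cut X Y n w g c d : is_field X -> is_field Y ->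
  (forall i, X i (Y (n - i) w) - Y (n - i) (X i w) = g) ->
  np d X Y n w = np c X Y n w + (d - c)%:~R *: g.
Proof.
move=> fX fY E; rewrite (@np_cut _ _ _ _ (fun i => i%:~R *: g) c) //.
  by rewrite -scalerBl -rmorphB.
by move=> i; rewrite E -scalerBl -rmorphB /= (_ : i + 1 - i = 1) ?scale1r //; lia.
Qed.

Lemma np_sub (N : set V) c X Y n w : subspace N ->
  (forall i, i < c -> N (X i (Y (n - i) w))) ->
  (forall i, c <= i -> N (Y (n - i) (X i w))) -> N (np c X Y n w).
Proof.
move=> sN H1 H2; apply: isum_sub => // i; case: ifP => ic; first exact: H1.
by apply: H2; lia.
Qed.

Lemma fsum_cond (P : int -> bool) (F : int -> V) :
  \sum_(k \in [set k : int | P k]) F k = isum (fun k => if P k then F k else 0).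
Proof.
rewrite fsbig_mkcond; apply: eq_isum => k; rewrite /patch.
by case: ifPn => [/set_mem|/negP nk] /=; [move=> ->|rewrite ifF //; apply/negP => Pk;
  apply: nk; apply/mem_set].
Qed.

Lemma normal_prodE X Y n w : is_field X -> is_field Y ->
  normal_prod X Y n w = np 0 X Y (n - 1) w.
Proof.
move=> fX fY; rewrite /normal_prod.
rewrite (fsum_cond (fun k => k < 0)) (fsum_cond (fun k => 0 <= k)) /np.
have [N HN] := np_fsupp 0 (n - 1) w fX fY.
rewrite -isumD; first by apply: eq_isum => k; case: ltP => _; rewrite ?addr0 ?add0r.
  by exists N => k /HN; case: ltP.
by exists N => k /HN; case: ltP.
Qed.

Lemma plain_prodE X Y n w c : is_field X -> is_field Y ->
  (forall i j u, X i (Y j u) = Y j (X i u)) ->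
  plain_prod X Y n w = np c X Y (n - 1) w.
Proof. by move=> fX fY XY; apply: eq_isum => k; case: ifP. Qed.

End Fields.

(** * Linear spans and abstract Fock spaces *)

Lemma lspan_ind (K : fieldType) (V : lmodType K) (S : set V) (N : V -> Prop) w :
  lspan S w -> subspace N -> (forall u, S u -> N u) -> N w.
Proof. by move=> H sN SN; apply: H. Qed.

Lemma lspan_gen (K : fieldType) (V : lmodType K) (S : set V) w : S w -> lspan S w.
Proof. by move=> Sw N [_]; apply. Qed.

Lemma lspan_list (K : fieldType) (V : lmodType K) (J : eqType) (P : J -> Prop)
    (y : J -> V) w : lspan [set u | exists2 s, P s & u = y s] w ->
  exists2 L : seq (K * J), (forall p, p \in L -> P p.2) &
    w = \sum_(p <- L) p.1 *: y p.2.
Proof.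
pose N u := exists2 L : seq (K * J), (forall p, p \in L -> P p.2) &
    u = \sum_(p <- L) p.1 *: y p.2.
move/(@lspan_ind _ _ _ N); apply => [|u [s Ps ->]]; last first.
  exists [:: (1, s)]; last by rewrite big_seq1 scale1r.
  by move=> p; rewrite inE => /eqP ->.
split; first by exists [::]; rewrite ?big_nil.
move=> a u v [L1 H1 ->] [L2 H2 ->].
exists ([seq (a * p.1, p.2) | p <- L1] ++ L2).
  by move=> p; rewrite mem_cat => /orP[/mapP[q /H1 ? ->]|/H2].
rewrite big_cat big_map scaler_sumr; congr (_ + _).
by apply: eq_bigr => p _; rewrite scalerA.
Qed.

Lemma list_max (T : eqType) (le : rel T) (s : seq T) : total le -> transitive le ->
  s != [::] -> exists2 t, t \in s & forall u, u \in s -> le u t.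
Proof.
move=> tot tr; elim: s => [|x s IH] // _; have [->|/IH[t ts H]] := eqVneq s [::].
  exists x => [|u]; rewrite ?mem_head // inE => /eqP ->.
  by case/orP: (tot x x).
case/orP: (tot x t) => xt; [exists t|exists x]; rewrite ?inE ?ts ?eqxx ?orbT // => u.
  by rewrite inE => /orP[/eqP ->|/H].
rewrite inE => /orP[/eqP ->|/H ut]; last exact: tr xt.
by case/orP: (tot x x).
Qed.

Section Fock.
Context {K : numFieldType} {V : lmodType K} {I : eqType}.
Variables (x d : I -> V -> V) (vac : V).
Hypothesis lx : forall i, linear (x i).
Hypothesis ld : forall i, linear (d i).
Hypothesis xC : forall i j w, x i (x j w) = x j (x i w).
Hypothesis dC : forall i j w, d i (d j w) = d j (d i w).
Hypothesis dx : forall i j w, d i (x j w) - x j (d i w) = (i == j)%:R *: w.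
Hypothesis d_vac : forall i, d i vac = 0.
Hypothesis vac0 : vac != 0.
Hypothesis cyc : forall N : V -> Prop, subspace N -> N vac ->
  (forall i w, N w -> N (x i w)) -> (forall i w, N w -> N (d i w)) -> forall w, N w.

Definition mon (s : seq I) (w : V) : V := foldr x w s.
Definition dmon (s : seq I) (w : V) : V := foldr d w s.

Lemma lin_dmon s : linear (dmon s).
Proof. by elim: s => [|i s IH] a u v //=; rewrite IH ld. Qed.

Lemma mon_rem i s w : i \in s -> mon s w = x i (mon (rem i s) w).
Proof.
elim: s => [|j s IH] //=; rewrite inE eq_sym; have [->|ne] //= := eqVneq j i.
by move=> /IH ->; rewrite xC.
Qed.

Lemma mon_perm s t w : perm_eq s t -> mon s w = mon t w.
Proof.
elim: s t => [|i s IH] t; first by rewrite perm_sym => /perm_nilP ->.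
move=> st; have it : i \in t by rewrite -(perm_mem st) mem_head.
rewrite (mon_rem w it) /= (IH (rem i t)) //.
by rewrite -(perm_cons i) (permPl st) perm_to_rem.
Qed.

Lemma dmon_d i s w : dmon s (d i w) = d i (dmon s w).
Proof. by elim: s => [|j s IH] //=; rewrite IH dC. Qed.

(** The operator [d i] differentiates with respect to the variable [x i], and the exponent is the
    multiplicity of [i] in the word. *)
Lemma d_mon i s : d i (mon s vac) = (count_mem i s)%:R *: mon (rem i s) vac.
Proof.
elim: s => [|j s IH] /=; first by rewrite d_vac scale0r.
have := dx i j (mon s vac); rewrite IH => /eqP; rewrite subr_eq => /eqP ->.
rewrite (lfZ (lx _)) eq_sym; have [->|ne] /= := eqVneq j i; last first.
  by rewrite scale0r !add0r.
have [ins|nin] := boolP (i \in s).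
  by rewrite -mon_rem // natrD scalerDl.
by rewrite (count_memPn nin) scale0r addr0.
Qed.

Lemma dmon_mon t s : dmon t (mon s vac) <> 0 -> exists r, perm_eq s (t ++ r).
Proof.
elim: t s => [|i t IH] s /=; first by exists s.
rewrite -dmon_d d_mon (lfZ (lin_dmon _)) => H.
have ins : i \in s.
  by apply: contra_notT H => /count_memPn ->; rewrite scale0r.
have /IH[r Hr] : dmon t (mon (rem i s) vac) <> 0.
  by move=> e; apply: H; rewrite e scaler0.
by exists r; rewrite (permPl (perm_to_rem ins)) perm_cons.
Qed.

Lemma dmon_mon_perm t s : perm_eq s t ->
  exists2 c : K, c != 0 & dmon t (mon s vac) = c *: vac.
Proof.
move=> st; rewrite (mon_perm _ st) => {s st}; elim: t => [|i t [c c0 IH]].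
  by exists 1; rewrite ?oner_eq0 ?scale1r.
have -> : dmon (i :: t) (mon (i :: t) vac) = dmon t (d i (mon (i :: t) vac)).
  by rewrite dmon_d.
rewrite d_mon (lfZ (lin_dmon _)) /= eqxx IH scalerA.
by eexists; last reflexivity; rewrite mulf_neq0 // pnatr_eq0.
Qed.

Lemma mon_span w : lspan [set u | exists2 s, True & u = mon s vac] w.
Proof.
set Sp := lspan _; have sl : subspace Sp by exact: subspace_lspan.
have xSp i u : Sp u -> Sp (x i u).
  move/(@lspan_ind _ _ _ (fun u => Sp (x i u))); apply=> [|_ [s _ ->]]; last first.
    by apply: lspan_gen; exists (i :: s).
  by split=> [|a u1 u2 H1 H2]; rewrite ?(lf0 (lx _)) ?lx; [apply: (sub0 sl)|apply: sl.2].
apply: (cyc sl _ xSp); first by apply: lspan_gen; exists [::].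
move=> i u; move/(@lspan_ind _ _ _ (fun u => Sp (d i u))); apply=> [|_ [s _ ->]].
  by split=> [|a u1 u2 H1 H2]; rewrite ?(lf0 (ld _)) ?ld; [apply: (sub0 sl)|apply: sl.2].
by rewrite d_mon; apply: (subZ sl); apply: lspan_gen; exists (rem i s).
Qed.

Lemma mon_ind (N : V -> Prop) : subspace N -> (forall s, N (mon s vac)) -> forall w, N w.
Proof. by move=> sN H w; apply: (lspan_ind (mon_span w) sN) => u [s _ ->]. Qed.

Lemma dmon_nilp w : exists n, forall t, (n <= size t)%N -> dmon t w = 0.
Proof.
move: w; apply: (@mon_ind (fun w => exists n, forall t, (n <= size t)%N -> dmon t w = 0)) => [|s].
  split=> [|a u v [m Hm] [n Hn]]; first by exists 0%N => t _; rewrite (lf0 (lin_dmon _)).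
  exists (maxn m n) => t; rewrite geq_max => /andP[H1 H2].
  by rewrite lin_dmon Hm // Hn // scaler0 addr0.
exists (size s).+1 => t lt; apply/eqP; apply: contraTT lt => /eqP/dmon_mon[r].
by move=> /perm_size ->; rewrite size_cat -leqNgt leq_addr.
Qed.

(** Lowering must stop, since all long words of annihilation operators kill [w] ([dmon_nilp]); the
    induction is on the length from which they do. *)
Lemma dmon_max (P : pred I) w : w != 0 -> exists t,
  [/\ all P t, dmon t w != 0 & forall i, P i -> d i (dmon t w) = 0].
Proof.
have [n] := dmon_nilp w; elim: n w => [|n IH] w Hn w0.
  by case/eqP: w0; apply: (Hn [::]).
have [[i Pi di]|no] := pselect (exists2 i, P i & d i w <> 0); last first.
  by exists [::]; split=> // i Pi; apply: contra_notP no => ?; exists i.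
have [||t [Pt t0 Ht]] := IH (d i w); last first.
- by exists (rcons t i); rewrite all_rcons Pi Pt /dmon -cats1 foldr_cat.
- exact/eqP.
- by move=> t nt; rewrite dmon_d; apply: (Hn (i :: t)).
Qed.

Variable e : I -> nat.
Definition energy (s : seq I) : nat := sumn (map e s).

Lemma energy_perm s t : perm_eq s t -> energy s = energy t.
Proof. by move=> st; apply/perm_sumn/perm_map. Qed.

Lemma energy_cat s t : energy (s ++ t) = (energy s + energy t)%N.
Proof. by rewrite /energy map_cat sumn_cat. Qed.

(** This is the span of the monomials of energy less than [n], described by the test functionals
    vanishing on it. *)
Definition low (n : nat) : set V :=
  [set w | forall t, (n <= energy t)%N -> dmon t w = 0].

(* A triangularity argument: among the words of maximal energy, one of maximal
   length detects its own coefficient. *)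
Lemma triangular_relation (M : lmodType K) (k : seq I -> K) (y : seq I -> V)
    (z : seq I -> M) (L : seq (K * seq I)) :
  (forall s, k s != 0) ->
  (forall s, low (energy s) (y s - k s *: mon s vac)) ->
  (forall s t, perm_eq s t -> y s = y t) ->
  (forall s t, perm_eq s t -> z s = z t) ->
  (forall p, p \in L -> dmon p.2 (\sum_(q <- L) q.1 *: y q.2) = 0) ->
  \sum_(q <- L) q.1 *: z q.2 = 0.
Proof.
move=> k0 ylow yp zp; have [n] := ubnP (size L); elim: n L => // n IH L ltn HL.
have [->|L0] := eqVneq L [::]; first by rewrite big_nil.
(* Letters of energy 0 are allowed, as a^*(0) will be, so energy alone does not separate a word from
   its extensions; length breaks the tie. *)
pose le : rel (K * seq I) := fun p q => (energy p.2 < energy q.2)%N ||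
  (energy p.2 == energy q.2) && (size p.2 <= size q.2)%N.
have [||t tL maxt] := @list_max _ le L _ _ L0; rewrite /le.
- by move=> p q; lia.
- by move=> p q r; lia.
(* If [dmon t.2] does not kill the leading monomial, then [s] is [t.2] with extra letters; the bound
   on energy and length leaves none. *)
have yt s : ~~ perm_eq s t.2 -> le (0, s) t -> dmon t.2 (y s) = 0.
  move=> nst lst; rewrite -(subrK (k s *: mon s vac) (y s)) (lfD (lin_dmon _)).
  rewrite ylow ?add0r; last by move: lst; rewrite /le /=; lia.
  rewrite (lfZ (lin_dmon _)).
  suff -> : dmon t.2 (mon s vac) = 0 by rewrite scaler0.
  apply/eqP; apply: contraNT nst => /eqP/dmon_mon[r sr].
  move: lst; rewrite /le /= (energy_perm sr) (perm_size sr) energy_cat size_cat.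
  rewrite ltnNge leq_addr /= -[X in (_ <= X)%N]addn0 leq_add2l leqn0 => /andP[_ /eqP].
  by move=> /size0nil r0; rewrite r0 cats0 in sr.
(* Words are only considered up to permutation, so coefficients are collected over the class of
   [t.2]; testing with [dmon t.2] shows that their sum vanishes. *)
pose C : K := \sum_(q <- L | perm_eq q.2 t.2) q.1.
have S (U : lmodType K) (v : seq I -> U) : (forall s t, perm_eq s t -> v s = v t) ->
    \sum_(q <- L) q.1 *: v q.2 = C *: v t.2 +
    \sum_(q <- [seq q <- L | ~~ perm_eq q.2 t.2]) q.1 *: v q.2.
  move=> vp; rewrite big_filter (bigID (fun q => perm_eq q.2 t.2)) /=.
  rewrite scaler_suml; congr (_ + _); apply: eq_bigr => q qt; by rewrite (vp _ _ qt).
have C0 : C = 0.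
  have := HL _ tL; rewrite (S _ _ yp) (lfD (lin_dmon _)) (lf_sum (lin_dmon _)).
  rewrite big1_seq ?addr0 => [|q]; last first.
    rewrite mem_filter /= => /andP[nq qL]; rewrite (lfZ (lin_dmon _)) yt ?scaler0 //.
    exact: maxt qL.
  rewrite (lfZ (lin_dmon _)) -(subrK (k t.2 *: mon t.2 vac) (y t.2)).
  rewrite (lfD (lin_dmon _)) ylow // add0r (lfZ (lin_dmon _)).
  have [c c0 ->] := dmon_mon_perm (perm_refl t.2).
  rewrite !scalerA => /eqP; rewrite scaler_eq0 (negbTE vac0) orbF !mulf_eq0.
  by rewrite (negbTE c0) (negbTE (k0 _)) !orbF => /eqP.
rewrite (S _ _ zp) C0 scale0r add0r; apply: IH.
  rewrite size_filter -ltnS; apply: leq_trans ltn; rewrite ltnS.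
  rewrite -(count_predC (fun q : K * seq I => perm_eq q.2 t.2) L).
  by rewrite -[X in (X < _)%N]add0n ltn_add2r -has_count; apply/hasP; exists t.
move=> p; rewrite mem_filter => /andP[_ pL].
by have := HL p pL; rewrite (S _ y yp) C0 scale0r add0r.
Qed.

(** Without its constant term, [w] is a combination of nonempty monomials killed by every nonempty
    word of annihilation operators; the triangularity argument, with monomials for both [y] and [z],
    makes it 0. *)
Lemma vac_unique w : (forall i, d i w = 0) -> exists c : K, w = c *: vac.
Proof.
move=> dw; have [L _ wE] := lspan_list (mon_span w).
pose L' := [seq q <- L | q.2 != [::]].
pose c := \sum_(q <- L | q.2 == [::]) q.1.
have E : w = c *: vac + \sum_(q <- L') q.1 *: mon q.2 vac.
  rewrite wE big_filter (bigID (fun q => q.2 == [::])) /= scaler_suml.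
  by congr (_ + _); apply: eq_bigr => q /eqP ->.
exists c; rewrite E -[RHS]addr0; congr (_ + _).
apply: (@triangular_relation V (fun=> 1) (fun s => mon s vac) (fun s => mon s vac)).
- by move=> s; rewrite oner_eq0.
- by move=> s t _; rewrite scale1r subrr (lf0 (lin_dmon _)).
- by move=> s t /mon_perm ->.
- by move=> s t /mon_perm ->.
move=> p; rewrite mem_filter => /andP[p0 _].
have -> : \sum_(q <- L') q.1 *: mon q.2 vac = w - c *: vac by rewrite E addrC addKr.
case: p.2 p0 => // i s _; rewrite /= -dmon_d (lfB (ld _)) (lfZ (ld _)) dw d_vac.
by rewrite scaler0 subrr (lf0 (lin_dmon _)).
Qed.

Definition created : set V := lspan [set u | exists i w, u = x i w].

(** A vector of [created] is a combination of nonempty monomials. Taking for [z] the indicator of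
    the empty word in [triangular_relation] reads off the constant coefficient. *)
Lemma created_vac c : created (c *: vac) -> c = 0.
Proof.
move=> H; have : lspan [set u | exists2 s, s != [::] & u = mon s vac] (c *: vac).
  apply: (lspan_ind H) => [|_ [i [w ->]]]; first exact: subspace_lspan.
  have sl := subspace_lspan [set u | exists2 s, s != [::] & u = mon s vac].
  apply: (@mon_ind (fun w => lspan _ (x i w))) => [|s].
    by split=> [|a u1 u2 H1 H2]; rewrite ?(lf0 (lx _)) ?lx; [apply: (sub0 sl)|apply: sl.2].
  by apply: lspan_gen; exists (i :: s).
move=> /lspan_list[L HL cE].
have : \sum_(q <- (- c, [::]) :: L) q.1 *: (if q.2 == [::] then vac else 0) = 0.
  apply: (@triangular_relation V (fun=> 1) (fun s => mon s vac)
    (fun s => if s == [::] then vac else 0)) => [s|s t _|s t /mon_perm ->//|s t st|p _].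
  - by rewrite oner_eq0.
  - by rewrite scale1r subrr (lf0 (lin_dmon _)).
  - by rewrite -!size_eq0 (perm_size st).
  - by rewrite big_cons /= -cE scaleNr addNr (lf0 (lin_dmon _)).
rewrite big_cons big1_seq /= => [|q /HL/negbTE ->]; last by rewrite scaler0.
by rewrite addr0 scaleNr => /eqP; rewrite oppr_eq0 scaler_eq0 (negbTE vac0) orbF => /eqP.
Qed.

Lemma createdP i w : created (x i w).
Proof. by apply: lspan_gen; exists i, w. Qed.

End Fock.

(** * The vacuum module of the Weyl algebra as a Fock space *)

Section WeylModule.
Context {K : numFieldType} {W : opModule K weyl_gen} {vac : W}.
Hypothesis HW : weyl_vacuum_module vac.

Definition Aop : field_on W := fun n => act (weyl_a n).
Definition Bop : field_on W := fun n => act (weyl_as n).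
Local Notation A := Aop.
Local Notation B := Bop.

Lemma lA n : linear (A n). Proof. by case: HW => -[H _ _ _] _ _ _ _; apply: H. Qed.
Lemma lB n : linear (B n). Proof. by case: HW => -[H _ _ _] _ _ _ _; apply: H. Qed.
Lemma A_A n m w : A n (A m w) = A m (A n w).
Proof. by case: HW => -[_ H _ _] _ _ _ _; apply: H. Qed.
Lemma B_B n m w : B n (B m w) = B m (B n w).
Proof. by case: HW => -[_ _ H _] _ _ _ _; apply: H. Qed.
Lemma A_B n m w : A n (B m w) - B m (A n w) = (n + m == 0)%:R *: w.
Proof. by case: HW => -[_ _ _ H] _ _ _ _; apply: H. Qed.
Lemma A_BE n m w : A n (B m w) = B m (A n w) + (n + m == 0)%:R *: w.
Proof. by rewrite -A_B addrC subrK. Qed.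
Lemma A_Bne n m w : n + m != 0 -> A n (B m w) = B m (A n w).
Proof. by rewrite A_BE => /negbTE ->; rewrite scale0r addr0. Qed.
Lemma A_vac (n : int) : 0 <= n -> A n vac = 0.
Proof. by case: HW => _ _ _ H _; apply: H. Qed.
Lemma B_vac (n : int) : 0 < n -> B n vac = 0.
Proof.
case: HW => _ _ _ _ H n0; have -> : n = n - 1 + 1 by lia.
by apply: H; lia.
Qed.

Lemma weyl_ind (N : W -> Prop) : subspace N -> N vac ->
  (forall n w, N w -> N (A n w)) -> (forall n w, N w -> N (B n w)) -> forall w, N w.
Proof.
move=> sN Nv NA NB w; case: HW => _ _ gen _ _.
have : gen_submodule [set vac] w by rewrite gen.
apply; split; last by move=> _ ->.
by split=> // -[n|n] u; [apply: NA|apply: NB].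
Qed.

Lemma vac_neq0 : vac != 0.
Proof.
apply/eqP => v0; case: HW => _ [[w /eqP w0] _] _ _ _; apply: w0.
apply: (@weyl_ind (fun w => w = 0)) => // [|n u ->|n u ->].
- by split=> // a u v -> ->; rewrite scaler0 addr0.
- by rewrite (lf0 (lA n)).
- by rewrite (lf0 (lB n)).
Qed.

Lemma field_AB : is_field A /\ is_field B.
Proof.
pose P w := exists N : int, forall n, N < n -> A n w = 0 /\ B n w = 0.
suff H : forall w, P w.
  by split; (split=> [|w]; [exact: lA||exact: lB|]); have [N HN] := H w;
    exists N => n /HN[].
apply: weyl_ind.
- split=> [|a u v [M HM] [N HN]].
    by exists 0 => n _; rewrite (lf0 (lA n)) (lf0 (lB n)).
  exists (Order.max M N) => n Hn; rewrite lA lB.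
  have [|-> ->] := HM n; first by lia.
  have [|-> ->] := HN n; first by lia.
  by rewrite !scaler0 !addr0.
- by exists 0 => n Hn; rewrite A_vac ?B_vac //; lia.
- move=> m w [N HN]; exists (Order.max N (- m)) => n Hn.
  have [|E1 E2] := HN n; first by lia.
  have := A_B m n w; rewrite A_A E1 E2 (lf0 (lA m)) sub0r.
  have -> : (m + n == 0) = false by lia.
  by rewrite scale0r => /eqP; rewrite oppr_eq0 => /eqP.
- move=> m w [N HN]; exists (Order.max N (- m)) => n Hn.
  have [|E1 E2] := HN n; first by lia.
  have := A_B n m w; rewrite B_B E1 E2 (lf0 (lB m)) subr0.
  have -> : (n + m == 0) = false by lia.
  by rewrite scale0r.
Qed.
Definition fA := field_AB.1.
Definition fB := field_AB.2.

Definition cre (i : bool * nat) : W -> W :=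
  if i.1 then A (- i.2.+1%:Z) else B (- i.2%:Z).
(** The sign compensates [a^*(n), a(-n)] = -1, so that [ann] and [cre] satisfy the relations of
    derivatives and variables. *)
Definition ann (i : bool * nat) : W -> W :=
  if i.1 then fun w => - B i.2.+1%:Z w else A i.2%:Z.

Lemma creT k w : cre (true, k) w = A (- k.+1%:Z) w. Proof. by []. Qed.
Lemma creF k w : cre (false, k) w = B (- k%:Z) w. Proof. by []. Qed.
Lemma annT k w : ann (true, k) w = - B k.+1%:Z w. Proof. by []. Qed.
Lemma annF k w : ann (false, k) w = A k%:Z w. Proof. by []. Qed.

Lemma lcre i : linear (cre i).
Proof. by case: i => [[] n]; [exact: lA|exact: lB]. Qed.
Lemma lann i : linear (ann i).
Proof.
by case: i => [[] n]; [move=> a u v; rewrite /ann /= lB; lmod_of K W|exact: lA].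
Qed.
Lemma creC i j w : cre i (cre j w) = cre j (cre i w).
Proof.
case: i j => [[] i] [[] j].
- exact: A_A.
- by apply: A_Bne; lia.
- by apply/esym/A_Bne; lia.
- exact: B_B.
Qed.
Lemma annC i j w : ann i (ann j w) = ann j (ann i w).
Proof.
case: i j => [[] i] [[] j].
- by rewrite !annT !(lfN (lB _)) B_B.
- by rewrite !(annT, annF) (lfN (lA _)) A_Bne //; lia.
- by rewrite !(annT, annF) (lfN (lA _)) A_Bne //; lia.
- exact: A_A.
Qed.
Lemma ann_cre i j w : ann i (cre j w) - cre j (ann i w) = (i == j)%:R *: w.
Proof.
have E k l : (k%:Z - l%:Z == 0) = (k == l) by lia.
case: i j => [[] i] [[] j]; rewrite !(annT, annF, creT, creF).
- by rewrite (lfN (lA _)) opprK addrC A_B addrC E eqSS.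
- by rewrite (lfN (lB _)) B_B opprK addNr scale0r.
- by rewrite A_A subrr scale0r.
- by rewrite A_B E.
Qed.
Lemma ann_vac i : ann i vac = 0.
Proof. by case: i => [[] i]; rewrite ?annT ?annF ?A_vac ?B_vac ?oppr0. Qed.
Lemma weyl_cyc (N : W -> Prop) : subspace N -> N vac ->
  (forall i w, N w -> N (cre i w)) -> (forall i w, N w -> N (ann i w)) -> forall w, N w.
Proof.
move=> sN Nv Nc Na; apply: weyl_ind => // n w Nw.
  case: n => [n|n]; first exact: (Na (false, n)).
  by rewrite NegzE; exact: (Nc (true, n)).
case: n => [[|n]|n].
- exact: (Nc (false, 0)).
- by rewrite -[B _ w]opprK; apply: (subN sN); exact: (Na (true, n)).
- by rewrite NegzE; exact: (Nc (false, n.+1)).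
Qed.

Definition wmax P w := dmon_max lcre lann creC annC ann_cre ann_vac weyl_cyc P (w := w).
Definition wvac_unique w :=
  vac_unique lcre lann creC annC ann_cre ann_vac vac_neq0 weyl_cyc (fun=> 0%N) (w := w).
Definition wcreated : set W := created cre.
Definition wcreated_vac c :=
  created_vac lcre lann creC annC ann_cre ann_vac vac_neq0 weyl_cyc (fun=> 0%N) (c := c).

(** An operator commuting with the Weyl algebra sends the vacuum to a vector killed by all
    annihilation operators, hence to a multiple of the vacuum; cyclicity spreads the scalar. *)
Lemma weyl_scalar (Z : W -> W) : linear Z -> (forall n w, Z (A n w) = A n (Z w)) ->
  (forall n w, Z (B n w) = B n (Z w)) -> exists c : K, forall w, Z w = c *: w.
Proof.
move=> lZ ZA ZB; have [|c Hc] := @wvac_unique (Z vac).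
  case=> [[] n]; rewrite ?annT ?annF.
    by rewrite -ZB B_vac // (lf0 lZ) oppr0.
  by rewrite -ZA A_vac // (lf0 lZ).
exists c; apply: weyl_ind => // [|n w E|n w E].
- by split=> [|a u v Eu Ev]; rewrite ?(lf0 lZ) ?scaler0 // lZ Eu Ev; lmod_of K W.
- by rewrite ZA E (lfZ (lA n)).
- by rewrite ZB E (lfZ (lB n)).
Qed.

(** The cut is 1 because [B] is indexed by the n of a^*(n), which kills the vacuum from n = 1 on. *)
Definition Jop : field_on W := np 1 B A.
Definition Fop : field_on W := np 1 B Jop.
Definition AAop : field_on W := np 0 B B.
Local Notation J := Jop.
Local Notation F := Fop.
Local Notation AA := AAop.

Lemma fJ : is_field J. Proof. exact: np_field fB fA. Qed.
Lemma fF : is_field F. Proof. exact: np_field fB fJ. Qed.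
Lemma fAA : is_field AA. Proof. exact: np_field fB fB. Qed.
Lemma lJ n : linear (J n). Proof. exact: fJ.1. Qed.
Lemma lF n : linear (F n). Proof. exact: fF.1. Qed.

Lemma subr_sym (U : zmodType) (x y z : U) : x - y = - z -> y - x = z.
Proof. by move=> /(congr1 -%R); rewrite opprB opprK. Qed.

Lemma J_A n m w : J n (A m w) - A m (J n w) = - A (n + m) w.
Proof.
apply: subr_sym; rewrite opprK.
rewrite (@np_der _ _ _ _ _ (fun i u => ((m + i == 0)%:R * 1) *: u) (fun _ _ => 0)).
- by rewrite (np_deltal _ _ _ _ _ fA) (np_0r _ _ _ fB) scale1r addr0.
- exact: fB.
- exact: fA.
- exact: lA.
- by move=> i u; rewrite A_B mulr1.
- by move=> i u; rewrite A_A subrr.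
Qed.

Lemma J_B n m w : J n (B m w) - B m (J n w) = B (n + m) w.
Proof.
apply: subr_sym.
rewrite (@np_der _ _ _ _ _ (fun _ _ => 0) (fun i u => ((m + i == 0)%:R * -1) *: u)).
- by rewrite (np_deltar _ _ _ _ _ fB) (np_0l _ _ _ fA) scaleN1r add0r.
- exact: fB.
- exact: fA.
- exact: lB.
- by move=> i u; rewrite B_B subrr.
- by move=> i u; apply: subr_sym; rewrite A_B mulrN1 scaleNr opprK addrC.
Qed.

(** The two derived sums are the same product cut at [1 + m] and at 1, with opposite signs; the [m]
    terms in between each contribute a constant commutator. *)
Lemma J_J m n w : J m (J n w) - J n (J m w) = (- m%:~R * (m + n == 0)%:R) *: w.
Proof.
rewrite (@np_der _ _ _ _ _ (fun i => B (i + m)) (fun i u => -1 *: A (i + m) u)).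
- have fA' : is_field (fun i => A (i + m)).
    split=> [i|u]; first exact: lA.
    by have [N HN] := fA.2 u; exists (N - m) => i Hi; apply: HN; lia.
  rewrite (np_scaler _ _ _ _ fB fA') np_shiftl np_shiftr.
  rewrite (@np_linear_cut _ _ _ _ _ _ (- (m + n == 0)%:R *: w) 1 (1 + m)).
  + rewrite (_ : 1 + m - 1 = m); last by lia.
    by lmod_of K W.
  + exact: fB.
  + exact: fA.
  + move=> i; apply: subr_sym; rewrite A_B scaleNr opprK.
    by have -> : (n + m - i + i == 0) = (m + n == 0) by lia.
- exact: fB.
- exact: fA.
- exact: lJ.
- by move=> i u; rewrite J_B addrC.
- by move=> i u; rewrite J_A scaleN1r addrC.
Qed.

Lemma A_F m n w : A m (F n w) - F n (A m w) = 2 *: J (n + m) w.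
Proof.
rewrite (@np_der _ _ _ _ _ (fun i u => ((m + i == 0)%:R * 1) *: u) (fun i => A (i + m))).
- rewrite (np_deltal _ _ _ _ _ fJ) np_shiftr /J; lmod_of K W.
- exact: fB.
- exact: fJ.
- exact: lA.
- by move=> i u; rewrite A_B mulr1.
- by move=> i u; apply: subr_sym; rewrite J_A.
Qed.

(** The correction [2 m] comes half from the central term of [J, J] and half from the displacement
    of the cut by [m]. *)
Lemma J_F m n w : J m (F n w) - F n (J m w) = F (n + m) w - (2 * m%:~R) *: B (n + m) w.
Proof.
rewrite (@np_der _ _ _ _ _ (fun i => B (i + m))
  (fun i u => ((m + i == 0)%:R * - m%:~R) *: u)).
- rewrite (np_deltar _ _ _ _ _ fB) np_shiftl.
  rewrite (@np_linear_cut _ _ _ _ _ _ (- B (n + m) w) 1 (1 + m) fB fJ) => [|i].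
    rewrite (_ : 1 + m - 1 = m); last by lia.
    by rewrite /F; lmod_of K W.
  by apply: subr_sym; rewrite J_B opprK subrK.
- exact: fB.
- exact: fJ.
- exact: lJ.
- by move=> i u; rewrite J_B addrC.
- by move=> i u; rewrite J_J mulrC.
Qed.

Lemma B_F k n w : B k (F n w) - F n (B k w) = - AA (n + k) w.
Proof.
rewrite (@np_der _ _ _ _ _ (fun _ _ => 0) (fun i u => -1 *: B (i + k) u)).
- have fB' : is_field (fun i => B (i + k)).
    split=> [i|u]; first exact: lB.
    by have [N HN] := fB.2 u; exists (N - k) => i Hi; apply: HN; lia.
  rewrite (np_scaler _ _ _ _ fB fB') np_shiftr (np_0l _ _ _ fJ) add0r scaleN1r.
  by rewrite (np_comm _ _ 0 _ fB fB B_B).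
- exact: fB.
- exact: fJ.
- exact: lB.
- by move=> i u; rewrite B_B subrr.
- by move=> i u; apply: subr_sym; rewrite J_B scaleN1r opprK.
Qed.

Lemma AA_B m n w : AA m (B n w) = B n (AA m w).
Proof.
apply/eqP; rewrite eq_sym -subr_eq0; apply/eqP.
rewrite (@np_der _ _ _ _ _ (fun _ _ => 0) (fun _ _ => 0)).
- by rewrite (np_0l _ _ _ fB) (np_0r _ _ _ fB) addr0.
- exact: fB.
- exact: fB.
- exact: lB.
- by move=> i u; rewrite B_B subrr.
- by move=> i u; rewrite B_B subrr.
Qed.

End WeylModule.
Arguments Aop {K W}.
Arguments Bop {K W}.
Arguments Jop {K W}.
Arguments Fop {K W}.
Arguments AAop {K W}.

(** * Lie algebra modules from relations between basis elements *)

Lemma lie_act_basis (K : numFieldType) (V : lmodType K) (a : affine_sl2 K -> V -> V) :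
  (forall w, linear (a^~ w)) -> (forall x, linear (a x)) ->
  (forall (i j : option (sl2_basis * int)) w (x := << i >> : affine_sl2 K)
     (y := << j >> : affine_sl2 K), a (lie x y) w = a x (a y w) - a y (a x w)) ->
  forall x y w, a (lie x y) w = a x (a y w) - a y (a x w).
Proof.
move=> aL aR H x y w; move: x; apply: affine_ind => [|c x z Ex Ez|i].
- by rewrite (lf0 (lie_linearl y)) !(lf0 (aL _)) (lf0 (aR y)) subrr.
- by rewrite (lie_linearl y) !aL aR Ex Ez; lmod_of K V.
move: y; apply: affine_ind => [|c x z Ex Ez|j]; last exact: H.
- by rewrite (lf0 (lie_linearr _)) !(lf0 (aL _)) (lf0 (aR _)) subrr.
- by rewrite (lie_linearr _) !aL aR Ex Ez; lmod_of K V.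
Qed.

Section LieModuleFromBasis.
Context {K : numFieldType} (V : lmodType K) (op : option (sl2_basis * int) -> V -> V).
Hypothesis lop : forall i, linear (op i).
Hypothesis op_lie : forall i j w,
  lin_ext (fun k => op k w) (affine_lie << i >> << j >>) =
  op i (op j w) - op j (op i w).

Definition ext_module : opModule K (affine_sl2 K) :=
  OpModule (fun (x : affine_sl2 K) w => lin_ext (fun k => op k w) x).

Lemma lin_ext_op_linear (x : affine_sl2 K) : linear (fun w => lin_ext (fun k => op k w) x).
Proof.
move=> a u v; move: x; apply: affine_ind => [|c x y Ex Ey|i].
- by rewrite !linear0 addr0.
- by rewrite !lin_ext_linear Ex Ey; lmod_of K V.
- by rewrite !lin_extU lop.
Qed.

Lemma lie_module_ext : lie_module ext_module.
Proof.
split=> [w|x|x y w] /=; [exact: lin_ext_linear|exact: lin_ext_op_linear|].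
apply: (@lie_act_basis K V (fun x w => lin_ext (fun k => op k w) x)) => [u|u|i j u].
- exact: lin_ext_linear.
- exact: lin_ext_op_linear.
- by rewrite /= !lin_extU; exact: op_lie.
Qed.

End LieModuleFromBasis.

Lemma addzC (m n : int) : m + n = n + m.
Proof. exact: addrC. Qed.

(** * The Wakimoto module and its commutation relations *)

Section Wakimoto.
Context {K : numFieldType} {W : opModule K weyl_gen} {vac : W}.
Hypothesis HW : weyl_vacuum_module vac.
Variable psi : int -> K.
Variable p0 : int.
Hypothesis psi0 : forall n, p0 < n -> lcoef 1 psi n = 0.
Local Notation A := (@Aop K W).
Local Notation B := (@Bop K W).
Local Notation J := (@Jop K W).
Local Notation F := (@Fop K W).
Local Notation AA := (@AAop K W).
Local Notation b := (lcoef 1 psi).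
Let fA := fA HW.
Let fB := fB HW.
Let fJ := fJ HW.
Let fF := fF HW.
Let fAA := fAA HW.
Let lA n := fA.1 n.
Let lB n := fB.1 n.
Let lJ n := fJ.1 n.

Definition bfield : field_on W := fun i w => b i *: w.
Lemma fb : is_field bfield.
Proof.
split=> [n a u v|w]; first by rewrite /bfield; lmod_of K W.
by exists p0 => n /psi0 E; rewrite /bfield E scale0r.
Qed.
Definition Bb : field_on W := np 1 B bfield.
Lemma fBb : is_field Bb. Proof. exact: np_field fB fb. Qed.

Definition wh : field_on W := locked (fun n w => -2 *: J n w + b n *: w).
(** The term [2 n] stems from -2 times the derivative of a^*(z), since differentiation multiplies
    the mode of index n by -n. *)
Definition wf : field_on W :=
  locked (fun n w => - F n w + (2 * n%:~R) *: B n w + Bb n w).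
Lemma whE n w : wh n w = -2 *: J n w + b n *: w.
Proof. by rewrite /wh -lock. Qed.
Lemma wfE n w : wf n w = - F n w + (2 * n%:~R) *: B n w + Bb n w.
Proof. by rewrite /wf -lock. Qed.

Lemma wakimoto_modeE x n w : wakimoto_mode psi x n w =
  match x with sl2_e => A n w | sl2_h => wh n w | sl2_f => wf n w end.
Proof.
have fB1 : is_field (fun i => B (i + 1)).
  split=> [i|u]; first exact: lB.
  by have [N HN] := fB.2 u; exists (N - 1) => i Hi; apply: HN; lia.
have E Y m u : is_field Y -> normal_prod (@weyl_field_as K W) Y m u = np 1 B Y m u.
  move=> fY; rewrite (normal_prodE _ _ fB1 fY) np_shiftl add0r.
  by have -> : m - 1 + 1 = m by lia.
have EJ : normal_prod (@weyl_field_as K W) (@weyl_field_a K W) = J.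
  by apply/funext => m; apply/funext => u; rewrite E.
case: x => //=; last by rewrite EJ whE.
rewrite EJ E // !wfE /deriv_field /weyl_field_as subrK.
rewrite (plain_prodE _ _ 0 fB1 fb) => [|i j u]; last by rewrite /bfield (lfZ (lB _)).
rewrite np_shiftl add0r; have -> : n - 1 + 1 = n by lia.
by rewrite -/F /Bb /Bop; lmod_of K W.
Qed.

Lemma lwh n : linear (wh n).
Proof. by move=> a u v; rewrite !whE lJ; lmod_of K W. Qed.
Lemma lwf n : linear (wf n).
Proof. by move=> a u v; rewrite !wfE fF.1 lB fBb.1; lmod_of K W. Qed.

Lemma wf_field : is_field wf.
Proof.
split=> [|w]; first exact: lwf.
have [M HM] := fF.2 w; have [N HN] := fB.2 w; have [L HL] := fBb.2 w.
exists (Order.max M (Order.max N L)) => n Hn.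
by rewrite !wfE HM ?HN ?HL ?oppr0 ?scaler0 ?addr0 //; lia.
Qed.
Lemma wh_field : is_field wh.
Proof.
split=> [|w]; first exact: lwh.
have [M HM] := fJ.2 w; exists (Order.max M p0) => n Hn.
by rewrite !whE HM ?psi0 ?scaler0 ?scale0r ?addr0 //; lia.
Qed.

Lemma wh_J n w : J n w = 2^-1 *: (b n *: w - wh n w).
Proof. by rewrite !whE; lmod_of K W; field. Qed.

Lemma A_Bb m n w : A m (Bb n w) - Bb n (A m w) = b (n + m) *: w.
Proof.
rewrite (@np_der _ _ _ _ _ (fun i u => ((m + i == 0)%:R * 1) *: u) (fun _ _ => 0)).
- by rewrite (np_deltal _ _ _ _ _ fb) (np_0r _ _ _ fB) scale1r addr0.
- exact: fB.
- exact: fb.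
- exact: lA.
- by move=> i u; rewrite (A_B HW) mulr1.
- by move=> i u; rewrite /bfield (lfZ (lA _)) subrr.
Qed.

Lemma B_Bb m n w : B m (Bb n w) = Bb n (B m w).
Proof.
apply/eqP; rewrite -subr_eq0; apply/eqP.
rewrite (@np_der _ _ _ _ _ (fun _ _ => 0) (fun _ _ => 0)).
- by rewrite (np_0l _ _ _ fb) (np_0r _ _ _ fB) addr0.
- exact: fB.
- exact: fb.
- exact: lB.
- by move=> i u; rewrite (B_B HW) subrr.
- by move=> i u; rewrite /bfield (lfZ (lB _)) subrr.
Qed.

Lemma J_Bb m n w : J m (Bb n w) - Bb n (J m w) = Bb (n + m) w.
Proof.
rewrite (@np_der _ _ _ _ _ (fun i => B (i + m)) (fun _ _ => 0)).
- rewrite np_shiftl (np_0r _ _ _ fB) addr0; apply: (np_comm _ _ _ _ fB fb) => i j u.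
  by rewrite /bfield (lfZ (lB _)).
- exact: fB.
- exact: fb.
- exact: lJ.
- by move=> i u; rewrite (J_B HW) addrC.
- by move=> i u; rewrite /bfield (lfZ (lJ _)) subrr.
Qed.

Lemma eq_subl (U : zmodType) (x y z : U) : x - y = z -> x = y + z.
Proof. by move=> <-; rewrite addrC subrK. Qed.

(** On the support of the delta, [2 n] equals [-2 m], the central term of [e(m), f(n)] at level
    -2. *)
Lemma A_wf m n w :
  A m (wf n w) - wf n (A m w) = wh (n + m) w + (2 * n%:~R * (n + m == 0)%:R) *: w.
Proof.
rewrite !wfE !whE !(lfD (lA _), lfN (lA _), lfZ (lA _)).
rewrite (eq_subl (A_F HW m n w)) (A_BE HW) (eq_subl (A_Bb m n w)) (addzC m n).
by lmod_of K W.
Qed.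

Lemma wh_A m n w : wh m (A n w) - A n (wh m w) = 2 *: A (m + n) w.
Proof.
by rewrite !whE !(lfD (lA _), lfZ (lA _)) (eq_subl (J_A HW m n w)); lmod_of K W.
Qed.

Lemma wh_wh m n w : wh m (wh n w) - wh n (wh m w) = (-4 * m%:~R * (m + n == 0)%:R) *: w.
Proof.
by rewrite !whE !(lfD (lJ _), lfZ (lJ _)) (eq_subl (J_J HW m n w)); lmod_of K W.
Qed.

Lemma wh_wf m n w : wh m (wf n w) - wf n (wh m w) = -2 *: wf (m + n) w.
Proof.
rewrite ![in LHS]wfE !whE !(lfD (fF.1 _), lfZ (fF.1 _), lfD (lB _), lfZ (lB _)).
rewrite !(lfD (fBb.1 _), lfZ (fBb.1 _), lfD (lJ _), lfZ (lJ _), lfN (lJ _)).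
rewrite (eq_subl (J_F HW m n w)) (eq_subl (J_B HW m n w)) (eq_subl (J_Bb m n w)).
by rewrite !wfE (addzC n m) intrD; lmod_of K W.
Qed.

Lemma B_wf k n w : B k (wf n w) - wf n (B k w) = AA (n + k) w.
Proof.
rewrite !wfE !(lfD (lB _), lfN (lB _), lfZ (lB _)).
by rewrite (eq_subl (B_F HW k n w)) B_Bb (B_B HW k n); lmod_of K W.
Qed.

(** Only the dependence on [n + m] matters: it makes the double commutator of f(m), f(n) with a^*(k)
    symmetric in [m] and [n], so that their commutator commutes with a^*(k). *)
Lemma wf_AA : exists G : field_on W,
  forall n m w, wf n (AA m w) - AA m (wf n w) = G (n + m) w.
Proof.
exists (fun N w => - (np 0 AA B N w + np 0 B AA N w)) => n m w.
have fAA' : is_field (fun i => AA (i + n)).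
  split=> [i|u]; first exact: fAA.1.
  by have [N HN] := fAA.2 u; exists (N - n) => i Hi; apply: HN; lia.
have E i u : wf n (B i u) - B i (wf n u) = -1 *: AA (i + n) u.
  by apply: subr_sym; rewrite B_wf scaleN1r opprK addrC.
rewrite (@np_der _ _ _ _ _ (fun i u => -1 *: AA (i + n) u) (fun i u => -1 *: AA (i + n) u)).
- rewrite (np_scalel _ _ _ _ fAA' fB) (np_scaler _ _ _ _ fB fAA').
  rewrite np_shiftl np_shiftr (np_comm _ _ 0 _ fAA fB (AA_B HW)) addrC (addzC m n).
  by lmod_of K W.
- exact: fB.
- exact: fB.
- exact: lwf.
- exact: E.
- exact: E.
Qed.

(* The commutator of f(m) and f(n) commutes with the Weyl algebra, so it is a
   scalar; having weight -4 for h(0), it vanishes. *)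
Lemma wf_wf m n w : wf m (wf n w) = wf n (wf m w).
Proof.
pose Z w := wf m (wf n w) - wf n (wf m w).
have lZ : linear Z by move=> a u v; rewrite /Z !lwf; lmod_of K W.
have ZA k u : Z (A k u) = A k (Z u).
  have e x v : wf x (A k v) = A k (wf x v) - (wh (x + k) v +
      (2 * x%:~R * (x + k == 0)%:R) *: v) by rewrite -A_wf opprB addrC subrK.
  have hf x y v := eq_subl (wh_wf x y v).
  rewrite /Z !e !(lfB (lwf _), lfN (lwf _), lfD (lwf _), lfZ (lwf _), e, hf, lfB (lA _)).
  rewrite (_ : n + k + m = m + k + n); last by lia.
  by lmod_of K W.
have ZB k u : Z (B k u) = B k (Z u).
  have e x v : wf x (B k v) = B k (wf x v) - AA (x + k) v.
    by rewrite -B_wf opprB addrC subrK.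
  have [G HG] := wf_AA.
  have hf x y v := eq_subl (HG x y v).
  rewrite /Z !e !(lfB (lwf _), e, hf, lfB (lB _)).
  rewrite (_ : m + (n + k) = n + (m + k)); last by lia.
  by lmod_of K W.
have [c Zc] := weyl_scalar HW lZ ZA ZB.
have : wh 0 (Z w) - Z (wh 0 w) = -4 *: Z w.
  have hf y v := eq_subl (wh_wf 0 y v).
  rewrite {1 2}/Z (lfB (lwh _)) !(hf, lfD (lwf _), lfZ (lwf _)) !add0r /Z.
  by lmod_of K W.
rewrite !Zc (lfZ (lwh _)) subrr => /esym/eqP.
rewrite scaler_eq0 oppr_eq0 pnatr_eq0 /= => /eqP cw.
by apply/eqP; rewrite -subr_eq0 -[_ - _]/(Z w) Zc cw.
Qed.

Lemma wakimoto_act_mode x n (w : W) : act (o := wakimoto W psi) (mode x n) w =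
  match x with sl2_e => A n w | sl2_h => wh n w | sl2_f => wf n w end.
Proof. by rewrite /= lin_extU /= wakimoto_modeE. Qed.

Lemma wakimoto_vertex_module : vertex_module (- 2) (wakimoto W psi).
Proof.
split; last first.
- move=> x w; have := wakimoto_act_mode x.
  case: x => E; [have [N HN] := fA.2 w|have [N HN] := wf_field.2 w|
    have [N HN] := wh_field.2 w]; by exists N => n Hn; rewrite E HN.
- by move=> w /=; rewrite lin_extU.
apply: (@lie_module_ext K W (fun i w => wakimoto_basis_act psi w i)).
  case=> [[x n]|] a u v /=; last by lmod_of K W.
  by rewrite !wakimoto_modeE; case: x; [apply: lA|apply: lwf|apply: lwh].
case=> [[x n]|] [[y m]|] w; rewrite affine_lieE /=; last 3 first.
- by rewrite linear0 !wakimoto_modeE; case: (x);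
    rewrite ?(lfZ (lA _)) ?(lfZ (lwf _)) ?(lfZ (lwh _)) subrr.
- by rewrite linear0 !wakimoto_modeE; case: (y);
    rewrite ?(lfZ (lA _)) ?(lfZ (lwf _)) ?(lfZ (lwh _)) subrr.
- by rewrite linear0 subrr.
rewrite !wakimoto_modeE; set ext := lin_ext _.
have Em z k : ext (mode z k) =
    match z with sl2_e => A k w | sl2_h => wh k w | sl2_f => wf k w end.
  by rewrite /ext lin_extU /= wakimoto_modeE.
have Ec : ext central = -2 *: w by rewrite /ext lin_extU.
have lext : linear ext by exact: lin_ext_linear.
have n0 : (n + m == 0) -> m%:~R = - n%:~R :> K.
  by move=> e; have -> : m = - n by [lia]; rewrite mulrNz.
case: x y => [] [] /=; rewrite !(lfD lext, lfN lext, lfZ lext, lf0 lext, Em, Ec).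
- by rewrite (A_A HW) subrr mulr0 mul0r scale0r addr0.
- rewrite (addzC n m) A_wf (addzC m n); case: eqP n0 => [_ /(_ isT) ->|_ _];
    rewrite /= ?mulr1n ?mulr0n; lmod_of K W.
- by rewrite -[RHS]opprB wh_A addrC (addzC m n); lmod_of K W.
- by rewrite -[RHS]opprB A_wf; lmod_of K W.
- by rewrite wf_wf subrr; lmod_of K W.
- by rewrite -[RHS]opprB wh_wf (addzC m n); lmod_of K W.
- by rewrite wh_A; lmod_of K W.
- by rewrite wh_wf; lmod_of K W.
- by rewrite wh_wh; lmod_of K W.
Qed.

End Wakimoto.

(** * Submodules containing the vacuum *)

Section Cyclicity.
Context {K : numFieldType} {W : opModule K weyl_gen} {vac : W}.
Hypothesis HW : weyl_vacuum_module vac.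
Variable psi : int -> K.
Variable p0 : int.
Hypothesis psi0 : forall n, p0 < n -> lcoef 1 psi n = 0.
Local Notation A := (@Aop K W).
Local Notation B := (@Bop K W).
Local Notation J := (@Jop K W).
Local Notation F := (@Fop K W).
Local Notation b := (lcoef 1 psi).
Local Notation wf := (wf (W := W) psi).
Local Notation wh := (wh (W := W) psi).
Let lA n := lA HW n.
Let lB n := lB HW n.
Let lJ n := lJ HW n.

(** Stability under h(n) is traded for stability under J(n), equivalent to it because b(n) is a
    scalar; a^* is deliberately absent. *)
Definition stable (N : set W) : Prop :=
  [/\ subspace N, forall n w, N w -> N (A n w), forall n w, N w -> N (J n w) &
      forall n w, N w -> N (wf n w)].

Lemma stable_submodule N : submodule (M := wakimoto W psi) N -> stable N.
Proof.
move=> [sN act_N]; have E := wakimoto_act_mode HW psi0.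
split=> // n w Nw.
- by have := act_N (mode sl2_e n) w Nw; rewrite E.
- rewrite (wh_J psi); apply: (subZ sN); apply: (subB sN); first exact: (subZ sN).
  by have := act_N (mode sl2_h n) w Nw; rewrite E.
- by have := act_N (mode sl2_f n) w Nw; rewrite E.
Qed.

Lemma J_killed (n : int) w : (forall m : int, 0 <= m -> A m w = 0) ->
  (forall m : int, 0 < m -> B m w = 0) -> 0 <= n -> J n w = 0.
Proof.
move=> Aw Bw n0; apply: isum0 => i; case: ifP => i1.
  by rewrite Aw ?(lf0 (lB _)) //; lia.
by rewrite Bw ?(lf0 (lA _)) //; lia.
Qed.

Definition vac_pow r := iter r (B 0) vac.

Lemma vac_powS r : vac_pow r.+1 = B 0 (vac_pow r). Proof. by []. Qed.

Lemma B_vac_pow (m : int) r : 0 < m -> B m (vac_pow r) = 0.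
Proof.
move=> m0; elim: r => [|r IH]; first exact: B_vac.
by rewrite vac_powS (B_B HW) IH (lf0 (lB _)).
Qed.

Lemma J_vac_pow (m : int) r : 0 <= m -> J m (vac_pow r) = ((m == 0)%:R * r%:R) *: vac_pow r.
Proof.
move=> m0; elim: r => [|r IH].
  by rewrite mulr0 scale0r J_killed // => n; [apply: A_vac|apply: B_vac].
rewrite vac_powS (eq_subl (J_B HW m 0 _)) IH addr0 (lfZ (lB _)) -vac_powS.
have [->|mne] := eqVneq m 0; first by rewrite -natr1 -vac_powS !mul1r; lmod_of K W.
by rewrite B_vac_pow ?addr0 ?mul0r //; lia.
Qed.

(** Only a^*(0) b(q) survives, together with a^*(0) J(0) when [q] is 0, where J(0) counts the
    factors a^*(0). The hypotheses on chi enter through the nonvanishing of this coefficient. *)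
Lemma wf_vac_pow (q r : nat) : (forall n, q%:Z < n -> b n = 0) ->
  wf q%:Z (vac_pow r) = (b q%:Z - (q == 0%N)%:R * r%:R) *: vac_pow r.+1.
Proof.
move=> bq; rewrite wfE.
have -> : F q%:Z (vac_pow r) = ((q == 0%N)%:R * r%:R) *: vac_pow r.+1.
  rewrite /Fop /np (@isum1 _ _ 0) => [|i i0].
    by rewrite subr0 J_vac_pow //= (lfZ (lB _)).
  case: ifP => i1; last by rewrite B_vac_pow ?(lf0 (lJ _)) //; lia.
  rewrite J_vac_pow; last by lia.
  have -> : (q%:Z - i == 0) = false by lia.
  by rewrite mul0r scale0r (lf0 (lB _)).
have -> : Bb psi q%:Z (vac_pow r) = b q%:Z *: vac_pow r.+1.
  rewrite /Bb /np (@isum1 _ _ 0) => [|i i0].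
    by rewrite subr0 /bfield (lfZ (lB _)).
  case: ifP => i1; last by rewrite B_vac_pow /bfield ?scaler0 //; lia.
  by rewrite /bfield bq ?scale0r ?(lf0 (lB _)) //; lia.
have -> : (2 * q%:Z%:~R) *: B q%:Z (vac_pow r) = 0.
  case: q {bq} => [|q]; first by rewrite mulr0 scale0r.
  by rewrite B_vac_pow ?scaler0.
by lmod_of K W.
Qed.

Fixpoint shifts (j : nat) (s : seq nat) : seq (seq nat) :=
  if s is k :: s' then ((k + j)%N :: s') :: [seq k :: t | t <- shifts j s'] else [::].

Lemma shiftsP j s t : t \in shifts j s -> size t = size s /\ sumn t = (sumn s + j)%N.
Proof.
elim: s t => [|k s IH] t //=; rewrite inE => /orP[/eqP ->|/mapP[u /IH[E1 E2] ->]] /=.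
  by split=> //; lia.
by rewrite E1 E2; split=> //; lia.
Qed.

Definition bmon (s : seq nat) w := foldr (fun j u => B (- j%:Z) u) w s.

Lemma lbmon s : linear (bmon s).
Proof. by elim: s => [|j s IH] a u v //=; rewrite IH lB. Qed.

Lemma bmon_B s n w : bmon s (B n w) = B n (bmon s w).
Proof. by elim: s => [|j s IH] //=; rewrite IH (B_B HW). Qed.

Lemma bmon_A s (n : int) w : n < 0 -> bmon s (A n w) = A n (bmon s w).
Proof.
by move=> n0; elim: s => [|j s IH] //=; rewrite IH (A_Bne HW) //; lia.
Qed.

Lemma J_bmon j s w : J (- j%:Z) (bmon s w) =
  bmon s (J (- j%:Z) w) + \sum_(t <- shifts j s) bmon t w.
Proof.
elim: s => [|k s IH] /=; first by rewrite big_nil addr0.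
rewrite (eq_subl (J_B HW _ _ _)) IH (lfD (lB _)) big_cons big_map /= (lf_sum (lB _)).
have -> : - j%:Z + - k%:Z = - (k + j)%N%:Z by lia.
by rewrite [X in _ = _ + X]addrC addrA.
Qed.

Lemma J_vac_powN j r : J (- j%:Z) (vac_pow r.+1) =
  r.+1%:R *: B (- j%:Z) (vac_pow r) + iter r.+1 (B 0) (J (- j%:Z) vac).
Proof.
elim: r => [|r IH]; first by rewrite vac_powS (eq_subl (J_B HW _ _ _)) addr0 /=; lmod_of K W.
rewrite vac_powS (eq_subl (J_B HW _ _ _)) addr0 IH (lfD (lB _)) (lfZ (lB _)).
by rewrite (B_B HW 0) -natr1 -vac_powS /=; lmod_of K W.
Qed.

Variable N : set W.
Hypothesis stN : stable N.
Hypothesis Nvac : N vac.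
Variable q : nat.
Hypothesis bq : forall n, q%:Z < n -> b n = 0.
Hypothesis bqr : forall r : nat, b q%:Z - (q == 0%N)%:R * r%:R != 0.
Let sN : subspace N. Proof. by case: stN. Qed.

Lemma stable_vac_pow r : N (vac_pow r).
Proof.
elim: r => [|r IH] //; apply: (subZE sN (bqr r)).
by rewrite -wf_vac_pow //; case: stN => _ _ _; apply.
Qed.

(* The mode J(-j) turns one factor a*(0) into a*(-j), up to terms of lower total
   degree or with fewer factors. *)
Lemma stable_bmon s r : N (bmon s (vac_pow r)).
Proof.
have [m] := ubnP (sumn s); elim: m s r => // m IHm s r.
have [k] := ubnP (size s); elim: k s r => // k IHk [|j s] r ks ms.
  exact: stable_vac_pow.
have [_ NA NJ _] := stN.
have -> : bmon (j :: s) (vac_pow r) = bmon s (B (- j%:Z) (vac_pow r)) by rewrite bmon_B.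
case: j ks ms => [|j] ks ms; first by apply: (IHk s r.+1).
apply: (@subZE _ _ _ sN r.+1%:R); first by rewrite pnatr_eq0.
rewrite -(lfZ (lbmon _)).
have -> : r.+1%:R *: B (- j.+1%:Z) (vac_pow r) =
  J (- j.+1%:Z) (vac_pow r.+1) - iter r.+1 (B 0) (J (- j.+1%:Z) vac).
  by rewrite J_vac_powN addrK.
rewrite (lfB (lbmon _)).
(* Moving J to the front adds [j + 1] to one letter of [s] at a time: the total degree is that of
   [j.+1 :: s], but with one letter fewer. *)
have -> : bmon s (J (- j.+1%:Z) (vac_pow r.+1)) = J (- j.+1%:Z) (bmon s (vac_pow r.+1))
    - \sum_(t <- shifts j.+1 s) bmon t (vac_pow r.+1) by rewrite J_bmon addrK.
apply: (subB sN); first apply: (subB sN).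
- by apply: NJ; apply: IHk => //=; move: ms => /=; lia.
- rewrite big_seq; apply: (sub_sum sN) => t /shiftsP[E1 E2].
  by apply: IHk; rewrite ?E1 ?E2; move: ks ms => /=; lia.
have lI : linear (fun u => bmon s (iter r.+1 (B 0) u)).
  move=> a u v; rewrite -(lbmon s); congr bmon.
  by elim: (r.+1) => //= n ->; rewrite lB.
rewrite /Jop /np (lf_isum lI); last exact: (np_fsupp _ _ _ (fB HW) (fA HW)).
apply: (isum_sub sN) => i; case: ifP => i1; last first.
  by rewrite (B_vac HW) ?(lf0 (lA _)) ?(lf0 lI); [apply: (sub0 sN)|lia].
have [le|lt] := leP i (- j.+1%:Z).
  by rewrite (A_vac HW) ?(lf0 (lB _)) ?(lf0 lI); [apply: (sub0 sN)|lia].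
(* In the remaining range both factors of this term of J are creation operators. The factor a moves
   to the front, under which [N] is stable, and the letter left behind is smaller than [j + 1]. *)
have -> : i = - (absz i)%:Z by lia.
set a := absz i; have an : - j.+1%:Z - - a%:Z < 0 by lia.
rewrite -(A_Bne HW); last by lia.
have -> : iter r.+1 (B 0) (A (- j.+1%:Z - - a%:Z) (B (- a%:Z) vac)) =
   A (- j.+1%:Z - - a%:Z) (B (- a%:Z) (vac_pow r.+1)).
  elim: (r.+1) => //= n ->; rewrite -(A_Bne HW); last by lia.
  by rewrite (B_B HW 0).
rewrite bmon_A // bmon_B; apply: NA.
by apply: (IHm (a :: s)); move: ms => /=; lia.
Qed.

Definition bword (s : seq int) w := foldl (fun u n => B n u) w s.

Lemma lbword s : linear (bword s).
Proof. by elim: s => [|n s IH] a u v //=; rewrite lB IH. Qed.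

Lemma stable_full w : N w.
Proof.
(* [N] is not known to be stable under a^*, so words in a^* are built into the induction property;
   a(n) then passes through them up to scalars. *)
pose X w := forall s, N (bword s w).
suff H : forall w, X w by exact: (H w [::]).
apply: (weyl_ind HW) => [||n u Xu|n u Xu].
- split=> [s|a u v Xu Xv s]; first by rewrite (lf0 (lbword s)); apply: (sub0 sN).
  by rewrite lbword; apply: (sN.2); [apply: Xu|apply: Xv].
- move=> s; have [/hasP[n ns n0]|/hasPn H] := boolP (has (fun n => 0 < n) s).
    have -> : bword s vac = 0; last exact: (sub0 sN).
    have Z t : bword t 0 = 0 by exact: (lf0 (lbword t)).
    elim: s ns => //= m s IH; rewrite inE => /orP[/eqP <-|/IH E].
      by rewrite (B_vac HW).
    have C t u : bword t (B m u) = B m (bword t u).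
      by elim: t u => //= k t IHt u; rewrite (B_B HW k) IHt.
    by rewrite -/(bword s _) C E (lf0 (lB _)).
  have -> : bword s vac = bmon (map absz (rev s)) (vac_pow 0).
    have {}H n : n \in rev s -> ~~ (0 < n) by rewrite mem_rev; apply: H.
    rewrite /bword -{1}(revK s) foldl_rev.
    elim: (rev s) H => //= n t IH H; rewrite IH => [|k kt]; last first.
      by apply: H; rewrite inE kt orbT.
    by have -> : - (absz n)%:Z = n by have := H n (mem_head _ _); lia.
  exact: stable_bmon.
- have [_ NA _ _] := stN => s; elim: s u Xu => [|k s IH] u Xu /=.
    by apply: NA; apply: (Xu [::]).
  have -> : B k (A n u) = A n (B k u) - (n + k == 0)%:R *: u.
    by rewrite (A_BE HW) addrK.
  rewrite -/(bword s _) (lfB (lbword s)) (lfZ (lbword s)); apply: (subB sN).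
    by apply: IH => t; apply: (Xu (k :: t)).
  by apply: (subZ sN).
- by move=> s; apply: (Xu (n :: s)).
Qed.

End Cyclicity.

(** * Lowering a nonzero vector of a submodule *)

Section SingularVectors.
Context {K : numFieldType} {W : opModule K weyl_gen} {vac : W}.
Hypothesis HW : weyl_vacuum_module vac.
Variable psi : int -> K.
Variable q : nat.
Local Notation A := (@Aop K W).
Local Notation B := (@Bop K W).
Local Notation J := (@Jop K W).
Local Notation F := (@Fop K W).
Local Notation b := (lcoef 1 psi).
Local Notation wf := (wf (W := W) psi).
Hypothesis bq : forall n, q%:Z < n -> b n = 0.
Let lA n := lA HW n.
Let lB n := lB HW n.
Let lJ n := lJ HW n.

(* The vectors killed by all annihilation operators except a*(1), ..., a*(m). *)
Definition depth (m : nat) (w : W) : Prop :=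
  (forall n : int, 0 <= n -> A n w = 0) /\ (forall n : int, m%:Z < n -> B n w = 0).

Lemma subspace_depth m : subspace (depth m).
Proof.
split; first by split=> n _; rewrite ?(lf0 (lA _)) ?(lf0 (lB _)).
move=> a u v [u1 u2] [v1 v2]; split=> n Hn.
  by rewrite lA u1 // v1 // scaler0 addr0.
by rewrite lB u2 // v2 // scaler0 addr0.
Qed.

Lemma depth_A m w (n : int) : (0 < m)%N -> depth m w -> - m%:Z <= n < 0 ->
  depth m (A n w).
Proof.
move=> m0 [w1 w2] Hn; split=> k Hk; first by rewrite (A_A HW) w1 // (lf0 (lA _)).
by rewrite -(A_Bne HW) ?w2 ?(lf0 (lA _)) //; lia.
Qed.

Lemma depth_B m w (n : int) : depth m w -> 0 < n -> depth m (B n w).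
Proof.
move=> [w1 w2] Hn; split=> k Hk; last by rewrite (B_B HW) w2 // (lf0 (lB _)).
by rewrite (A_Bne HW) ?w1 ?(lf0 (lB _)) //; lia.
Qed.

Lemma depth_iter m (X : W -> W) w k :
  (forall u, depth m u -> depth m (X u)) -> depth m w -> depth m (iter k X w).
Proof. by move=> HX Hw; elim: k => //= k; apply: HX. Qed.

(** In every other term of J(m) either a^* has index above [m + 1], or an annihilating a(k) reaches
    [w]. *)
Lemma J_depth (m : nat) w : depth m.+1 w -> J m%:Z w = A (-1) (B m.+1%:Z w).
Proof.
move=> [w1 w2]; rewrite /Jop /np (@isum1 _ _ m.+1%:Z) => [|i im].
  have -> : (m.+1%:Z < 1) = false by lia.
  by congr (A _ _); lia.
case: ifP => i1; first by rewrite w1 ?(lf0 (lB _)) //; lia.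
have [lt|le] := ltP m.+1%:Z i; first by rewrite w2 ?(lf0 (lA _)).
by rewrite (A_Bne HW) ?w1 ?(lf0 (lB _)) //; lia.
Qed.

Lemma J_depth0 (m : nat) w (n : int) : depth m w -> m%:Z <= n -> 0 < n -> J n w = 0.
Proof.
move=> [w1 w2] mn n0; apply: isum0 => i; case: ifP => i1.
  by rewrite w1 ?(lf0 (lB _)) //; lia.
have [lt|le] := ltP m%:Z i; first by rewrite w2 ?(lf0 (lA _)).
by rewrite (A_Bne HW) ?w1 ?(lf0 (lB _)) //; lia.
Qed.

Lemma depth0_vac w : depth 0 w -> exists c : K, w = c *: vac.
Proof.
move=> [w1 w2]; apply: (wvac_unique HW) => -[[] n]; rewrite ?annT ?annF ?w1 //.
by rewrite w2 ?oppr0.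
Qed.

Lemma B_nilp (m : int) w : 0 < m -> w != 0 ->
  exists r, iter r (B m) w != 0 /\ B m (iter r (B m) w) = 0.
Proof.
move=> m0 w0; have [t [/all_pred1P tE t0 tP]] := wmax HW (pred1 (true, (absz m).-1)) w0.
have mE : ((absz m).-1.+1)%:Z = m by lia.
have E r : dmon ann (nseq r (true, (absz m).-1)) w = (-1) ^+ r *: iter r (B m) w.
  elim: r => [|r IH]; first by rewrite scale1r.
  by rewrite /= -/(dmon _ _ _) IH annT mE (lfZ (lB _)) exprS mulN1r scaleNr.
rewrite tE E in t0 tP; exists (size t); split.
  by apply: contraNneq t0 => ->; rewrite scaler0.
have /eqP := tP (true, (absz m).-1) (eqxx _).
rewrite annT mE (lfZ (lB _)) -scaleNr scaler_eq0 oppr_eq0 signr_eq0 /=.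
by move/eqP.
Qed.

Lemma A_iterB r w :
  A (-1) (iter r (B 1) w) = iter r (B 1) (A (-1) w) + r%:R *: iter r.-1 (B 1) w.
Proof.
elim: r => [|r IH]; first by rewrite scale0r addr0.
rewrite iterS (A_BE HW) IH (lfD (lB _)) (lfZ (lB _)) /= scale1r -natr1.
by case: r {IH} => [|r] /=; lmod_of K W.
Qed.

(** Let x be the last nonzero vector among the a^*(1)^r w. If a(-1) w = 0, applying a^*(1) to
    [A_iterB] gives -x = r x, impossible in characteristic 0. *)
Lemma A_inj w : A (-1) w = 0 -> w = 0.
Proof.
move=> Aw; apply/eqP; apply: contraT => w0; have [r [r0 Br]] := B_nilp (ltr01) w0.
have := A_iterB r w; rewrite Aw.
have -> : iter r (B 1) 0 = 0 by elim: r {r0 Br} => //= r ->; rewrite (lf0 (lB _)).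
rewrite add0r => /(congr1 (B 1)).
have -> : B 1 (A (-1) (iter r (B 1) w)) = - iter r (B 1) w.
  have := A_BE HW (-1) 1 (iter r (B 1) w); rewrite Br (lf0 (lA _)) scale1r.
  by move/eqP; rewrite eq_sym addr_eq0 => /eqP.
have -> : B 1 (r%:R *: iter r.-1 (B 1) w) = r%:R *: iter r (B 1) w.
  by rewrite (lfZ (lB _)); case: (r) => [|r'] //=; rewrite !scale0r.
move/eqP; rewrite eq_sym -subr_eq0 opprK -{2}[iter r _ _]scale1r -scalerDl natr1.
by rewrite scaler_eq0 pnatr_eq0 /= (negbTE r0).
Qed.

Variable N : set W.
Hypothesis stN : stable psi N.
Let sN : subspace N. Proof. by case: stN. Qed.
Let NA n w : N w -> N (A n w). Proof. by case: stN => _ H _ _; apply: H. Qed.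
Let NJ n w : N w -> N (J n w). Proof. by case: stN => _ _ H _; apply: H. Qed.
Let Nwf n w : N w -> N (wf n w). Proof. by case: stN => _ _ _; apply. Qed.

(** After lowering with all a(n), n >= 0, the largest a^*(m+2) acting nontrivially is removed
    through J(m+1) = a(-1) a^*(m+2). The factors commute, so powers of J(m+1) are products of
    powers, and injectivity of a(-1) keeps the last one nonzero. *)
Lemma stable_depth1 w : N w -> w != 0 -> exists u, [/\ N u, u != 0 & depth 1 u].
Proof.
move=> Nw w0; have [t [Pt t0 tP]] := wmax HW (fun i => ~~ i.1) w0.
have Nu : N (dmon ann t w).
  elim: t Pt {t0 tP} => //= -[[] n] t IH /andP[//= _ Pt]; apply: NA; exact: IH.
move: (dmon ann t w) Nu t0 tP => u Nu u0 uP.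
have uA n : 0 <= n -> A n u = 0.
  by case: n => // n _; have := uP (false, n) isT.
have [M HM] := (fB HW).2 u.
have [m um] : exists m, depth m.+1 u.
  by exists (absz M); split=> // n Hn; apply: HM; lia.
elim: m u Nu u0 um {uP uA HM Nw w0} => [|m IH] u Nu u0 um; first by exists u.
have [r [r0 Br]] := @B_nilp m.+2%:Z u isT u0.
pose v j := iter j (A (-1)) (iter j (B m.+2%:Z) u).
have dA x : depth m.+2 x -> depth m.+2 (A (-1) x).
  by move=> dx; apply: depth_A => //; lia.
have dB x : depth m.+2 x -> depth m.+2 (B m.+2%:Z x).
  by move=> dx; apply: depth_B.
have CB j x : B m.+2%:Z (iter j (A (-1)) x) = iter j (A (-1)) (B m.+2%:Z x).
  elim: j => //= j <-; rewrite (A_Bne HW) //; lia.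
have dv j : depth m.+2 (v j) by exact: (depth_iter j dA (depth_iter j dB um)).
have Jv j : J m.+1%:Z (v j) = v j.+1.
  by rewrite (J_depth (dv j)) CB.
have Nv j : N (v j) by elim: j => [|j IHj] //; rewrite -Jv; apply: NJ.
have v0 : v r != 0.
  rewrite /v; move: (iter r _ u) r0 => x x0; elim: (r) => //= j.
  by apply: contraNneq => /A_inj ->.
apply: (IH (v r)) => //.
have [d1 d2] := dv r.
split=> // n Hn; have [->|ne] := eqVneq n m.+2%:Z; last by apply: d2; lia.
by rewrite /v CB Br; elim: (r) => //= j ->; rewrite (lf0 (lA _)).
Qed.

Lemma wf_depth1 w : depth 1 w ->
  wf (q%:Z + 1) w = b q%:Z *: B 1 w + (q == 0%N)%:R *: (2 *: B 1 w - A (-1) (B 1 (B 1 w))).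
Proof.
move=> dw; have [w1 w2] := dw; have dBw := depth_B dw ltr01.
rewrite wfE.
have -> : F (q%:Z + 1) w = (q == 0%N)%:R *: A (-1) (B 1 (B 1 w)).
  rewrite /Fop /np (@isum1 _ _ 1) => [|i i1].
    rewrite ltxx addrK; have [->|q0] := eqVneq q 0%N.
      rewrite scale1r; apply: (@J_depth 0); split=> n Hn; last by apply: dBw.2.
      exact: dBw.1.
    by rewrite scale0r (J_depth0 dBw) //; lia.
  case: ifP => ic; last by rewrite w2 ?(lf0 (lJ _)) //; lia.
  by rewrite (J_depth0 dw) ?(lf0 (lB _)) //; lia.
have -> : Bb psi (q%:Z + 1) w = b q%:Z *: B 1 w.
  rewrite /Bb /np (@isum1 _ _ 1) => [|i i1]; first by rewrite ltxx addrK.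
  case: ifP => ic; last by rewrite w2 /bfield ?scaler0 //; lia.
  by rewrite /bfield bq ?scale0r ?(lf0 (lB _)) //; lia.
have -> : (2 * (q%:Z + 1)%:~R) *: B (q%:Z + 1) w = ((q == 0%N)%:R * 2) *: B 1 w.
  have [->|q0] := eqVneq q 0%N.
    by have -> : 0%N%:Z + 1 = 1 by []; rewrite mul1r mulr1.
  by rewrite w2 ?scaler0 ?mul0r ?scale0r //; lia.
by lmod_of K W.
Qed.

(** Vectors of depth 1 are polynomials in y = a(-1) on which a^*(1) acts as -d/dy, so the hypothesis
    is Euler's equation for degree [k]. *)
Lemma depth1_power k w : depth 1 w -> A (-1) (B 1 w) = - k%:R *: w ->
  exists c : K, w = c *: iter k (A (-1)) vac.
Proof.
elim: k w => [|k IH] w dw; rewrite ?oppr0 ?scale0r => E.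
  have [w1 w2] := dw; apply: depth0_vac; split=> // n Hn.
  have [->|n1] := eqVneq n 1; first exact: A_inj.
  by apply: w2; lia.
have [||c Hc] := IH (B 1 w); first exact: depth_B.
  have := A_BE HW (-1) 1 (B 1 w); rewrite E scale1r (lfZ (lB _)) => ->.
  by rewrite -natr1; lmod_of K W.
exists (c / - k.+1%:R); have k0 : - k.+1%:R != 0 :> K by rewrite oppr_eq0 pnatr_eq0.
apply: (scalerI k0); rewrite -E Hc (lfZ (lA _)) scalerA mulrC divfK //.
Qed.

Hypothesis bq0 : (0 < q)%N -> b q%:Z != 0.

(** The induction is on the degree of [w] as a polynomial in a(-1), measured by the power of a^*(1)
    that kills it. *)
Lemma stable_vac w : N w -> w != 0 -> N vac \/
  exists k, [/\ q = 0%N, (0 < k)%N, b 0 = - k.+1%:R & N (iter k (A (-1)) vac)].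
Proof.
move=> Nw w0; have [u [Nu u0 du]] := stable_depth1 Nw w0; move: u Nu u0 du => {w Nw w0} w.
move=> Nw w0 dw; have [k [k0 Bk]] := B_nilp ltr01 w0.
have [m] := ubnP k; elim: m k w Nw w0 dw k0 Bk => // m IH k w Nw w0 dw k0 Bk km.
(* Any nonzero vector of [N] of depth 1 and smaller degree lets the induction continue. *)
have finish v : N v -> depth 1 v -> v != 0 -> iter k (B 1) v = 0 -> N vac \/
  exists k, [/\ q = 0%N, (0 < k)%N, b 0 = - k.+1%:R & N (iter k (A (-1)) vac)].
  move=> Nv dv v0 vk; have [r [r0 Br]] := B_nilp ltr01 v0.
  apply: (IH r v) => //; apply: (@leq_trans k); last by rewrite -ltnS.
  rewrite ltnNge.
  apply: contra r0 => kr; rewrite -(subnK kr) iterD vk.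
  by apply/eqP; elim: (r - k)%N => //= j ->; rewrite (lf0 (lB _)).
case: k k0 Bk km finish => [|k] k0 Bk km finish.
  have [w1 w2] := dw; have [|c wE] := @depth0_vac w.
    split=> // n Hn; have [->|n1] := eqVneq n 1; first exact: Bk.
    by apply: w2; lia.
  left; apply: (@subZE _ _ _ sN c); last by rewrite -wE.
  by apply: contraNneq w0 => c0; rewrite wE c0 scale0r.
have dB := depth_B dw ltr01; have dBB := depth_B dB ltr01.
have B0 : B 1 w != 0.
  apply: contraNneq k0 => Bw; rewrite iterSr Bw.
  by apply/eqP; elim: (k) => //= j ->; rewrite (lf0 (lB _)).
have Nf := Nwf (q%:Z + 1) Nw; rewrite (wf_depth1 dw) in Nf.
have [q0|q0] := posnP q; last first.
  move: Nf; rewrite (_ : (q == 0%N) = false); last by lia.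
  rewrite scale0r addr0 => /(subZE sN (bq0 q0)) NB.
  by apply: (finish (B 1 w)) => //; rewrite -iterSr.
rewrite q0 eqxx scale1r in Nf.
set v := (X in N X) in Nf.
have dv : depth 1 v.
  have sd := subspace_depth 1; apply: (subD sd); first exact: (subZ sd).
  by apply: (subB sd); [exact: (subZ sd)|exact: depth_A].
have lI j : linear (iter j (B 1)) by move=> a x y; elim: j => //= j ->; rewrite lB.
(* Here [v] is the image of [w] under f(1). The degree of [w] is [k + 1], and f(1) lowers it by
   exactly one unless [b 0 = - (k + 2)]. *)
have Bkv : iter k (B 1) v = (b 0 + k.+2%:R) *: iter k.+1 (B 1) w.
  have H := A_iterB k (B 1 (B 1 w)).
  have Z : A (-1) (iter k (B 1) (B 1 (B 1 w))) = 0.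
    by rewrite -!iterSr iterS Bk (lf0 (lA _)).
  rewrite Z in H.
  have E : k%:R *: iter k.-1 (B 1) (B 1 (B 1 w)) = k%:R *: iter k.+1 (B 1) w.
    by case: (k) => [|j]; [rewrite !scale0r|rewrite /= -!iterSr].
  rewrite E in H; move/eqP: H; rewrite eq_sym addr_eq0 => /eqP H.
  rewrite /v (lfD (lI k)) (lfZ (lI k)) (lfB (lI k)) (lfZ (lI k)) H -iterSr.
  by rewrite -[k.+2]addn2 natrD; lmod_of K W.
have [bk|bk] := eqVneq (b 0 + k.+2%:R) 0; last first.
  have v0 : v != 0.
    apply/eqP => v0; move/eqP: Bkv; rewrite v0 (lf0 (lI k)) eq_sym scaler_eq0.
    by rewrite (negbTE bk) (negbTE k0).
  apply: (finish v) => //.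
  by rewrite iterS Bkv (lfZ (lB _)) Bk scaler0.
(* J(0) is minus the degree, so this removes the top homogeneous component of [w]. If nothing
   remains, [w] is a multiple of a(-1)^(k+1) applied to the vacuum. *)
pose v' := J 0 w + k.+1%:R *: w.
have Jw : J 0 w = A (-1) (B 1 w) by exact: (@J_depth 0).
have Nv' : N v' by apply: (subD sN); [apply: NJ|apply: (subZ sN)].
have [e|v'0] := eqVneq v' 0; last first.
  apply: (finish v') => //.
    have sd := subspace_depth 1; apply: (subD sd); last exact: (subZ sd).
    by rewrite Jw; apply: depth_A.
  rewrite /v' (lfD (lI _)) (lfZ (lI _)) Jw.
  have := A_iterB k.+1 (B 1 w).
  have -> : A (-1) (iter k.+1 (B 1) (B 1 w)) = 0 by rewrite -iterSr iterS Bk (lf0 (lA _)).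
  by rewrite -iterSr => <-.
have [|c wE] := @depth1_power k.+1 w dw.
  by rewrite -Jw; apply/eqP; rewrite -subr_eq0 scaleNr opprK; apply/eqP.
right; exists k.+1; split=> //.
  by apply/eqP; rewrite -subr_eq0 opprK bk.
apply: (@subZE _ _ _ sN c); last by rewrite -wE.
by apply: contraNneq w0 => c0; rewrite wE c0 scale0r.
Qed.

End SingularVectors.

(** * Schur polynomials and the truncated exponential *)

Section SchurPolynomials.
Context {K : numFieldType} (x : nat -> K) (l : nat).

Definition schur_exponent : {poly K} := \sum_(1 <= n < l.+1) (x n / n%:R) *: 'X^n.
Definition schur_series : {poly K} :=
  \sum_(m < l.+1) (m`!%:R)^-1 *: schur_exponent ^+ m.

Lemma schur_exponent_coef n : (0 < n <= l)%N -> schur_exponent`_n = x n / n%:R.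
Proof.
have U : uniq (index_iota 1 l.+1) by apply: iota_uniq.
move=> nl; have M : n \in index_iota 1 l.+1 by rewrite mem_index_iota.
rewrite coef_sum (bigD1_seq n M U) /=.
rewrite coefZ coefXn eqxx mulr1 big1 ?addr0 // => k kn.
by rewrite coefZ coefXn eq_sym (negbTE kn) mulr0.
Qed.

Lemma schur_exponent_coef0 : schur_exponent`_0 = 0.
Proof.
rewrite coef_sum big_seq big1 // => k; rewrite mem_index_iota => /andP[k0 _].
by rewrite coefZ coefXn; case: k k0 => // k _; rewrite mulr0.
Qed.

Lemma coef_exp_small (p : {poly K}) m i : p`_0 = 0 -> (i < m)%N -> (p ^+ m)`_i = 0.
Proof.
move=> p0; elim: m i => // m IH i im; rewrite exprS coefM big1 // => -[[|j] jl] _ /=.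
  by rewrite p0 mul0r.
by rewrite IH ?mulr0 //; lia.
Qed.

Lemma schur_series0 : schur_series`_0 = 1.
Proof.
rewrite coef_sum big_ord_recl /= fact0 invr1 scale1r expr0 coef1 eqxx big1 ?addr0 //.
by move=> i _; rewrite coefZ coef_exp_small ?mulr0 // schur_exponent_coef0.
Qed.

(* The differential equation g' = p' g satisfied by g = exp p. *)
Lemma schur_series_rec n : (n < l)%N ->
  n.+1%:R * schur_series`_n.+1 = \sum_(i < n.+1) x i.+1 * schur_series`_(n - i).
Proof.
move=> nl; set p := schur_exponent.
(* Truncating the exponential costs the term p^l / l!, which has no coefficient below degree l
   because p has no constant term. *)
have E : schur_series^`() = p^`() * (schur_series - (l`!%:R)^-1 *: p ^+ l).
  rewrite /schur_series raddf_sum /= big_ord_recl expr0 derivZ derivC scaler0 add0r.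
  rewrite big_ord_recr /= addrK mulr_sumr; apply: eq_bigr => i _.
  rewrite derivZ deriv_exp /= -scalerAr -scaler_nat scalerA; congr (_ *: _).
  rewrite factS natrM invfM mulrAC mulVf ?mul1r // pnatr_eq0 //.
have := congr1 (fun q : {poly K} => q`_n) E; rewrite /= coef_deriv => H; rewrite mulr_natl H.
rewrite coefM; apply: eq_bigr => i _; rewrite coef_deriv coefB coefZ.
have -> : (p ^+ l)`_(n - i) = 0.
  by apply: coef_exp_small; [exact: schur_exponent_coef0|lia].
rewrite mulr0 subr0.
rewrite schur_exponent_coef; last by have := ltn_ord i; lia.
have -> : x i.+1 / i.+1%:R *+ i.+1 = x i.+1 by rewrite -[LHS]mulr_natr divfK // pnatr_eq0.
by [].
Qed.

End SchurPolynomials.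

(** * Cauchy products of series with operator coefficients *)

Section Convolution.
Context {K : fieldType} {V : lmodType K}.
Implicit Types (X Y : nat -> V -> V) (p : nat -> V).

Definition conv X p n : V := \sum_(i < n.+1) X i (p (n - i)%N).

Lemma sum_ord_from (U : nmodType) (G : nat -> U) i k :
  \sum_(m < i + k | (i <= m)%N) G m = \sum_(j < k) G (i + j)%N.
Proof.
rewrite big_split_ord /= big_pred0 ?add0r => [|m]; last by rewrite leqNgt ltn_ord.
by apply: eq_bigl => j; rewrite leq_addr.
Qed.

Lemma sum_triangle (U : nmodType) (G : nat -> nat -> U) n :
  \sum_(i < n) \sum_(m < n | (i <= m)%N) G i m = \sum_(m < n) \sum_(i < m.+1) G i m.
Proof.
rewrite (exchange_big_dep xpredT) //=; apply: eq_bigr => m _.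
rewrite (big_ord_widen_cond n xpredT (G^~ m)) //=.
Qed.

Lemma convA X Y p n : (forall i, linear (X i)) -> conv X (conv Y p) n =
  \sum_(m < n.+1) \sum_(i < m.+1) X i (Y (m - i)%N (p (n - m)%N)).
Proof.
move=> lX; rewrite -(sum_triangle (fun i m => X i (Y (m - i)%N (p (n - m)%N)))).
apply: eq_bigr => -[i il] _ /=; rewrite /conv (lf_sum (lX i)).
rewrite -(subnKC (leqW il : (i <= n.+1)%N)) (sum_ord_from
  (fun m => X i (Y (m - i)%N (p (n - m)%N)))) subSn //.
by apply: eq_bigr => k _; rewrite addKn subnDA.
Qed.

End Convolution.

(** * The exceptional vector a(-1)^l 1 and its image under f(0)^l *)

Section SchurVector.
Context {K : numFieldType} {W : opModule K weyl_gen} {vac : W}.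
Hypothesis HW : weyl_vacuum_module vac.
Variable psi : int -> K.
Local Notation A := (@Aop K W).
Local Notation B := (@Bop K W).
Local Notation J := (@Jop K W).
Local Notation F := (@Fop K W).
Local Notation b := (lcoef 1 psi).
Local Notation wf := (wf (W := W) psi).
Local Notation wh := (wh (W := W) psi).
Let lA n := lA HW n.
Let lB n := lB HW n.
Let lJ n := lJ HW n.

(** Each a^*(k) raises the J(0)-eigenvalue by 1. After a maximal word of such operators one reaches
    a vector on which J(0) vanishes, so the word was empty and [u] is itself annihilated. *)
Lemma J0_vac u : (forall n : int, 0 <= n -> A n u = 0) -> J 0 u = 0 ->
  exists c : K, u = c *: vac.
Proof.
move=> uA uJ; have [->|u0] := eqVneq u 0; first by exists 0; rewrite scale0r.
have [t [Pt t0 tP]] := wmax HW (fun i => i.1) u0.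
have E : J 0 (dmon ann t u) = (size t)%:R *: dmon ann t u.
  elim: t Pt {t0 tP} => [|[[] k] t IH] //=; first by rewrite uJ scale0r.
  move=> Pt; rewrite -!/(dmon _ _ _) annT (lfN (lJ _)) (eq_subl (J_B HW _ _ _)) add0r.
  by rewrite (IH Pt) (lfZ (lB _)) -natr1; lmod_of K W.
have At n : 0 <= n -> A n (dmon ann t u) = 0.
  move=> n0; elim: t Pt {t0 tP E} => [|[[] k] t IH] //=; first by move=> _; apply: uA.
  move=> Pt; rewrite -!/(dmon _ _ _) annT (lfN (lA _)) (A_Bne HW) ?IH ?(lf0 (lB _)) ?oppr0 //.
  by lia.
have := E; rewrite (J_killed HW) // => [|n n0]; last first.
  have := tP (true, (absz n).-1) isT; rewrite annT.
  have -> : (absz n).-1.+1%:Z = n by lia.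
  by move/eqP; rewrite oppr_eq0 => /eqP.
move/esym/eqP; rewrite scaler_eq0 (negbTE t0) orbF pnatr_eq0 size_eq0 => /eqP t1.
rewrite t1 in tP; apply: (wvac_unique HW) => -[[] n]; first exact: tP.
by rewrite annF uA.
Qed.

Hypothesis psi0 : forall n, 0 < n -> b n = 0.

Section Extremal.
Variable l : nat.
Hypothesis b0 : b 0 = - l.+1%:R.
Let v := iter l (A (-1)) vac.

Lemma iter_A_depth k : depth 1 (iter k (A (-1)) vac).
Proof.
apply: depth_iter => [u du|]; first exact: (depth_A HW).
by split=> n Hn; [exact: (A_vac HW)|apply: (B_vac HW); lia].
Qed.

Lemma B_iter_A k : B 1 (iter k (A (-1)) vac) = - k%:R *: iter k.-1 (A (-1)) vac.
Proof.
elim: k => [|k IH]; first by rewrite oppr0 scale0r (B_vac HW).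
rewrite iterS; have := A_BE HW (-1) 1 (iter k (A (-1)) vac); rewrite IH scale1r.
move/eqP; rewrite -subr_eq => /eqP <-; rewrite (lfZ (lA _)) -natr1.
by case: k {IH} => [|k] /=; lmod_of K W.
Qed.

Lemma extremal_wf (n : int) : 0 < n -> wf n v = 0.
Proof.
move=> n0; have dv := iter_A_depth l.
(* [wf_depth1] is applied with cutoff [n - 1]; for n = 1 the contributions (l - 1) l and - l (l - 1)
   cancel. *)
have nE : n = (absz n).-1%:Z + 1 by lia.
have := @wf_depth1 _ _ _ HW psi (absz n).-1 _ v dv; rewrite -nE => ->; last first.
  by move=> m Hm; apply: psi0; lia.
have [n1|n1] := eqVneq (absz n).-1 0%N; last first.
  by rewrite scale0r addr0 psi0 ?scale0r //; lia.
rewrite n1 scale1r b0 B_iter_A (lfZ (lB _)) B_iter_A.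
case: (l) => [|[|k]]; rewrite /= ?oppr0 ?scale0r ?scaler0 ?(lf0 (lA _)) ?subr0 ?addr0 //.
  by lmod_of K W.
by rewrite !(lfZ (lA _)) -!natr1; lmod_of K W.
Qed.

Lemma extremal_wh (n : int) : 0 < n -> wh n v = 0.
Proof.
move=> n0; rewrite whE psi0 // scale0r addr0.
by rewrite (J_depth0 HW (iter_A_depth l)) ?scaler0.
Qed.

Lemma extremal_wh0 : wh 0 v = (l%:R - 1) *: v.
Proof.
have JE : J 0 v = - l%:R *: v.
  rewrite (@J_depth _ _ _ HW 0) ?B_iter_A ?(lfZ (lA _)); last exact: iter_A_depth.
  by rewrite /v; case: (l) => [|k] //; rewrite oppr0 !scale0r.
by rewrite whE JE b0 -natr1; lmod_of K W.
Qed.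

Let X j := iter j (wf 0) v.

(** For the sl_2 of zero modes, [v] is a highest weight vector of weight l - 1, and the formulas are
    those of the usual string. *)
Lemma extremal_string j :
  [/\ forall n : int, 0 < n -> [/\ A n (X j) = 0, wh n (X j) = 0 & wf n (X j) = 0],
      wh 0 (X j) = (l%:R - 1 - 2 * j%:R) *: X j &
      A 0 (X j) = (j%:R * (l%:R - j%:R)) *: X j.-1].
Proof.
have lwf n := lwf HW psi0 n.
elim: j => [|j [H1 H2 H3]].
  split=> [n n0||].
  - by rewrite extremal_wh ?extremal_wf // (iter_A_depth l).1 //; lia.
  - by rewrite extremal_wh0 mulr0 subr0.
  - by rewrite (iter_A_depth l).1 // mul0r scale0r.
rewrite /X iterS -/(X j); split=> [n n0||].
- have [E1 E2 E3] := H1 n n0; split.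
  + rewrite (eq_subl (A_wf HW psi0 n 0 _)) E1 add0r E2 (lf0 (lwf _)); lmod_of K W.
  + by rewrite (eq_subl (wh_wf HW psi0 n 0 _)) E2 addr0 E3 (lf0 (lwf _)) scaler0 addr0.
  + by rewrite (wf_wf HW psi0) E3 (lf0 (lwf _)).
- rewrite (eq_subl (wh_wf HW psi0 0 0 _)) H2 (lfZ (lwf _)) addr0 -natr1.
  by lmod_of K W.
- rewrite (eq_subl (A_wf HW psi0 0 0 _)) H3 (lfZ (lwf _)) addr0 H2.
  case: j {H1 H2 H3} => [|j]; rewrite -?natr1 /= ?mulr0 ?mul0r; first by lmod_of K W.
  rewrite -/(X j) -[wf 0 (X j)]/(X j.+1) -?natr1; lmod_of K W.
Qed.

(** At j = l the string coefficient vanishes, so e(0) kills [X l]; its weight - l - 1 equals [b 0],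
    which means J(0) = 0 there. *)
Lemma extremal_end : exists c : K, X l = c *: vac.
Proof.
have [H1 H2 H3] := extremal_string l; apply: J0_vac => [n n0|].
  have [->|n1] := eqVneq n 0; first by rewrite H3 subrr mulr0 scale0r.
  by have [] := H1 n _; first by lia.
by rewrite (wh_J psi) H2 b0 -natr1; lmod_of K W; field.
Qed.
End Extremal.

(* Modulo this space f(0) acts on polynomials in the y_k = a(-k) as the second
   order operator - sum y_(i+k) d_i d_k + sum chi_(-i) d_i, d_i being d/dy_i. *)
Definition creation_ideal : set W := lspan [set u | exists (j : nat) w, u = B (- j%:Z) w].
Local Notation Jid := creation_ideal.

Let sJ : subspace Jid. Proof. exact: subspace_lspan. Qed.

Lemma ideal_B (i : int) w : i <= 0 -> Jid (B i w).
Proof.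
move=> i0; apply: lspan_gen; exists (absz i), w.
by have -> : - (absz i)%:Z = i by lia.
Qed.

Lemma ideal_op (X : W -> W) : linear X -> (forall j w, Jid (X (B (- j%:Z) w))) ->
  forall w, Jid w -> Jid (X w).
Proof.
move=> lX H w /(@lspan_ind _ _ _ (fun u => Jid (X u))); apply=> [|_ [j [u ->]]]; last exact: H.
by split=> [|a x y Hx Hy]; rewrite ?(lf0 lX) ?lX; [apply: (sub0 sJ)|apply: sJ.2].
Qed.

Lemma ideal_A (n : int) w : n < 0 -> Jid w -> Jid (A n w).
Proof.
move=> n0; apply: ideal_op => [|j u]; first exact: lA.
by rewrite (A_Bne HW); [apply: ideal_B; lia|lia].
Qed.

(** For k <= 0, [a^*(k), f(0)] is the mode of a^* a^* of index k, and each of its terms contains an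
    a^* of nonpositive index. *)
Lemma ideal_wf w : Jid w -> Jid (wf 0 w).
Proof.
apply: ideal_op => [|j u]; first exact: (lwf HW psi0).
have -> : wf 0 (B (- j%:Z) u) = B (- j%:Z) (wf 0 u) - AAop (0 + - j%:Z) u.
  by rewrite -(B_wf HW psi0) opprB addrC subrK.
apply: (subB sJ); first by apply: ideal_B; lia.
apply: (np_sub sJ) => i Hi; first by apply: ideal_B; lia.
have [le|lt] := leP i 0; first by rewrite (B_B HW); apply: ideal_B.
by apply: ideal_B; lia.
Qed.

Lemma ideal_created w : Jid w -> wcreated w.
Proof.
move=> H; apply: (lspan_ind (N := wcreated) H) => [|_ [j [u ->]]].
  exact: subspace_lspan.
exact: (@createdP _ _ _ cre (false, j) u).
Qed.

Definition Ap i := A (- i.+1%:Z).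
Definition Jp i := J (- i.+1%:Z).

(* The coefficient of s^n in (sum_k a(-k-1) s^k)^r applied to the vacuum. *)
Fixpoint Pvec (r : nat) : nat -> W :=
  if r is r'.+1 then conv Ap (Pvec r') else fun n => if n is 0%N then vac else 0.

(** With Y(s) = sum a(-k-1) s^k, this says that a^*(i+1) is minus the derivative in a(-i-1), applied
    to Y^r: it gives - r s^i Y^(r-1). *)
Lemma Pvec_B r n i : B i.+1%:Z (Pvec r n) =
  if (i <= n)%N then - r%:R *: Pvec r.-1 (n - i) else 0.
Proof.
elim: r n => [|r IH] n.
  rewrite oppr0 scale0r if_same; case: n => [|n] /=; first by rewrite (B_vac HW).
  by rewrite (lf0 (lB _)).
rewrite [Pvec r.+1]/= {1}/conv (lf_sum (lB _)).
have E (k : 'I_n.+1) : B i.+1%:Z (Ap k (Pvec r (n - k))) =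
    (if (k < (n - i).+1)%N && (i <= n)%N then - r%:R *: Ap k (Pvec r.-1 (n - i - k)) else 0)
    - (if k == i :> nat then Pvec r (n - i) else 0).
  have := A_B HW (- k.+1%:Z) i.+1%:Z (Pvec r (n - k)).
  rewrite IH => /eqP; rewrite subr_eq addrC -subr_eq => /eqP <-; rewrite /Ap.
  have kn := ltn_ord k; congr (_ - _).
    have -> : (k < (n - i).+1)%N && (i <= n)%N = (i <= n - k)%N by lia.
    case: ifP => _; last by rewrite (lf0 (lA _)).
    by rewrite (lfZ (lA _)); congr (_ *: A _ (Pvec _ _)); lia.
  have [->|ne] := eqVneq (k : nat) i; first by rewrite addNr scale1r.
  have -> : (- k.+1%:Z + i.+1%:Z == 0) = false by lia.
  by rewrite scale0r.
rewrite (eq_bigr _ (fun k _ => E k)) sumrB.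
case: leqP => ni; last first.
  rewrite !big1 ?subr0 // => k _; last by rewrite andbF.
  by have kn := ltn_ord k; case: eqP => // e; exfalso; lia.
have -> : \sum_(k < n.+1) (if k == i :> nat then Pvec r (n - i) else 0) = Pvec r (n - i).
  rewrite -big_mkcond (big_pred1 (Ordinal (ni : (i < n.+1)%N))) //.
under eq_bigr do rewrite andbT.
rewrite -big_mkcond -(big_ord_widen _ (fun k => - r%:R *: Ap k (Pvec r.-1 (n - i - k))));
  last by lia.
rewrite -scaler_sumr -natr1.
by case: r {IH E} => [|r] /=; rewrite -?/(conv _ _ _); lmod_of K W.
Qed.

(** The Leibniz rule for the derivative of a product of two series, read off at degree n. *)
Lemma sum_weights (G : nat -> W) n :
  \sum_(j < n.+1) (n - j).+1%:R *: G j + \sum_(m < n.+1) m.+1%:R *: G m.+1 =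
  n.+1%:R *: \sum_(j < n.+2) G j.
Proof.
have -> : \sum_(j < n.+1) (n - j).+1%:R *: G j = \sum_(j < n.+2) (n.+1 - j)%:R *: G j.
  rewrite [RHS]big_ord_recr /= subnn scale0r addr0; apply: eq_bigr => j _.
  by rewrite subSn // -ltnS.
have -> : \sum_(m < n.+1) m.+1%:R *: G m.+1 = \sum_(j < n.+2) j%:R *: G j.
  by rewrite [RHS]big_ord_recl scale0r add0r.
rewrite -big_split scaler_sumr; apply: eq_bigr => j _ /=.
by rewrite -scalerDl -natrD subnK // -ltnS.
Qed.

Lemma lJp i : linear (Jp i). Proof. exact: lJ. Qed.
Lemma lAp i : linear (Ap i). Proof. exact: lA. Qed.

Lemma conv_rev (X Y : nat -> W -> W) m w :
  \sum_(i < m.+1) X i (Y (m - i)%N w) = \sum_(i < m.+1) X (m - i)%N (Y i w).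
Proof.
rewrite (reindex_inj rev_ord_inj) /=; apply: eq_bigr => i _.
by rewrite subSS; congr (X _ (Y _ _)); have := ltn_ord i; lia.
Qed.

(** With J_+(t) = sum J(-i-1) t^i, the commutator of J_+(t) and Y(t) is -Y'(t), and J_+(t) sends the
    vacuum into the ideal; hence J_+ Y^s is congruent to minus the derivative of Y^s. *)
Lemma ideal_conv_J s n : Jid (conv Jp (Pvec s) n + n.+1%:R *: Pvec s n.+1).
Proof.
elim: s n => [|s IH] n.
  rewrite scaler0 addr0; apply: (sub_sum sJ) => i _ /=.
  case: (n - i)%N => [|k]; last by rewrite (lf0 (lJp _)); apply: (sub0 sJ).
  apply: (np_sub sJ) => k Hk; first by apply: ideal_B; lia.
  by rewrite (B_vac HW) ?(lf0 (lA _)); [apply: (sub0 sJ)|lia].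
have JA i k w : Jp i (Ap k w) = Ap k (Jp i w) - Ap (i + k).+1 w.
  rewrite /Jp /Ap (eq_subl (J_A HW _ _ _)); congr (_ - A _ _); lia.
have -> : conv Jp (Pvec s.+1) n = conv Ap (conv Jp (Pvec s)) n
    - \sum_(m < n.+1) m.+1%:R *: Ap m.+1 (Pvec s (n - m)).
  rewrite /= (convA Ap (Pvec s) n lJp) (convA Jp (Pvec s) n lAp) -sumrB.
  apply: eq_bigr => m _; rewrite conv_rev.
  (* The [m + 1] pairs of indices with sum [m] all give the same commutator a(-m-2), which is the
     coefficient in Y'. *)
  have -> : m.+1%:R *: Ap m.+1 (Pvec s (n - m)) =
      \sum_(i < m.+1) Ap m.+1 (Pvec s (n - m)).
    by rewrite sumr_const card_ord -scaler_nat.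
  rewrite -sumrB; apply: eq_bigr => i _; rewrite JA subnK //.
  by rewrite -ltnS.
have -> : n.+1%:R *: Pvec s.+1 n.+1 =
   \sum_(j < n.+1) (n - j).+1%:R *: Ap j (Pvec s (n - j).+1) +
   \sum_(m < n.+1) m.+1%:R *: Ap m.+1 (Pvec s (n - m)).
  rewrite [Pvec s.+1]/= /conv -(sum_weights (fun j => Ap j (Pvec s (n.+1 - j)))).
  congr (_ + _); apply: eq_bigr => j _; rewrite ?subSS // subSn // -ltnS //.
rewrite [X in Jid (_ + X)]addrC addrA subrK /conv -big_split; apply: (sub_sum sJ) => i _ /=.
by rewrite -(lfZ (lAp _)) -(lfD (lAp _)); apply: ideal_A => //; apply: IH.
Qed.

Lemma isum_split (G : int -> W) N : fsupp G -> (forall k : int, N%:Z < k -> G k = 0) ->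
  isum G = isum (fun k => if k < 1 then G k else 0) + \sum_(i < N) G i.+1%:Z.
Proof.
move=> fG HG; have [M HM] := fG.
have -> : \sum_(i < N) G i.+1%:Z = isum (fun k => if k < 1 then 0 else G k).
  rewrite (@isum_seq _ _ [seq i.+1%:Z | i <- iota 0 N]).
  - have -> : iota 0 N = index_iota 0 N by rewrite /index_iota subn0.
    by rewrite big_map big_mkord; apply: eq_bigr.
  - apply/(map_uniq (f := absz)); rewrite -map_comp; under eq_map do rewrite /=.
    by rewrite map_inj_uniq ?iota_uniq // => i j; lia.
  move=> k nk; case: ifP => k1 //; apply: HG; rewrite ltNge; apply: contra nk => kN.
  by apply/mapP; exists (absz k).-1; rewrite ?mem_iota; lia.
rewrite -isumD.
- by apply: eq_isum => k; case: ifP; rewrite ?addr0 ?add0r.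
- by exists M => k /HM; case: ifP.
- by exists M => k /HM; case: ifP.
Qed.

(** Modulo the ideal only the terms of f(0) with a^*(i), i > 0, survive, and these differentiate
    Y^(r+1). The remaining J is given by [ideal_conv_J], the remaining b is a scalar. *)
Lemma ideal_wf_Pvec r n : Jid (wf 0 (Pvec r.+1 n) + r.+1%:R *:
  (n.+1%:R *: Pvec r n.+1 + conv (fun i w => b (- i.+1%:Z) *: w) (Pvec r) n)).
Proof.
set w := Pvec r.+1 n.
have Bw (k : int) : n.+1%:Z < k -> B k w = 0.
  move=> nk; have -> : k = (absz k).-1.+1%:Z by lia.
  by rewrite Pvec_B ifF //; lia.
have Bw' (i : 'I_n.+1) : B i.+1%:Z w = - r.+1%:R *: Pvec r (n - i).
  by rewrite Pvec_B -ltnS ltn_ord.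
have EF : Jid (F 0 w + r.+1%:R *: conv Jp (Pvec r) n).
  rewrite /Fop /np (@isum_split _ n.+1); last first.
  - move=> k nk; rewrite Bw // (lf0 (lJ _)); case: ifP => // k1; lia.
  - exact: (np_fsupp _ _ _ (fB HW) (fJ HW)).
  rewrite -addrA; apply: (subD sJ).
    apply: (isum_sub sJ) => k; case: ifP => k1; last exact: (sub0 sJ).
    by rewrite k1; apply: ideal_B; lia.
  rewrite /conv scaler_sumr -big_split; apply: (sub_sum sJ) => i _ /=.
  by rewrite Bw' sub0r -/(Jp i) (lfZ (lJp _)) scaleNr addNr; apply: (sub0 sJ).
have EB : Jid (Bb psi 0 w + r.+1%:R *: conv (fun i w => b (- i.+1%:Z) *: w) (Pvec r) n).
  rewrite /Bb /np (@isum_split _ n.+1); last first.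
  - move=> k nk; rewrite Bw // /bfield scaler0; case: ifP => // k1; lia.
  - exact: (np_fsupp _ _ _ (fB HW) (fb psi0)).
  rewrite -addrA; apply: (subD sJ).
    apply: (isum_sub sJ) => k; case: ifP => k1; last exact: (sub0 sJ).
    by rewrite k1; apply: ideal_B; lia.
  rewrite /conv scaler_sumr -big_split; apply: (sub_sum sJ) => i _ /=.
  rewrite Bw' sub0r /bfield scalerA mulrC -scalerA scaleNr addNr.
  exact: (sub0 sJ).
have ES := ideal_conv_J r n.
rewrite wfE mulr0 scale0r addr0.
have -> : - F 0 w + Bb psi 0 w + r.+1%:R *:
  (n.+1%:R *: Pvec r n.+1 + conv (fun i w => b (- i.+1%:Z) *: w) (Pvec r) n) =
  (Bb psi 0 w + r.+1%:R *: conv (fun i w => b (- i.+1%:Z) *: w) (Pvec r) n)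
  - (F 0 w + r.+1%:R *: conv Jp (Pvec r) n)
  + r.+1%:R *: (conv Jp (Pvec r) n + n.+1%:R *: Pvec r n.+1) by lmod_of K W.
by apply: (subD sJ); [apply: (subB sJ)|apply: (subZ sJ)].
Qed.

Section Coefficient.
Variable l : nat.
Let x n := b (- n%:Z).
Let g := schur_series x l.
Let Q r n := conv (fun j w => g`_j *: w) (Pvec r) n.

(* With Y(s) = sum y_k s^(k-1) and g = exp (- sum chi_(-n) s^n / n), the operator
   f(0) maps g Y^r to - r (g Y^(r-1))' modulo the ideal. *)
Lemma ideal_wf_Q r n : (n < l)%N ->
  Jid (wf 0 (Q r.+1 n) + (r.+1%:R * n.+1%:R) *: Q r n.+1).
Proof.
move=> nl; have lg j : linear (fun w : W => g`_j *: w) by move=> a u u'; lmod_of K W.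
have -> : (r.+1%:R * n.+1%:R) *: Q r n.+1 = r.+1%:R *:
  (\sum_(j < n.+1) g`_j *: ((n - j).+1%:R *: Pvec r (n - j).+1) +
   conv (fun j w => g`_j *: w) (conv (fun i w => b (- i.+1%:Z) *: w) (Pvec r)) n).
  rewrite -scalerA (convA _ _ _ lg) /Q /conv.
  rewrite -(sum_weights (fun j => g`_j *: Pvec r (n.+1 - j))).
  congr (_ *: (_ + _)); apply: eq_bigr => m _.
    by rewrite scalerA mulrC -scalerA subSn // -ltnS.
  under eq_bigr do rewrite scalerA.
  rewrite -scaler_suml subSS scalerA schur_series_rec; last by have := ltn_ord m; lia.
  congr (_ *: _); rewrite (reindex_inj rev_ord_inj); apply: eq_bigr => i _ /=.
  by rewrite subSS [RHS]mulrC /x subKn // -ltnS.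
rewrite /Q /conv (lf_sum (lwf HW psi0 _)) -big_split scaler_sumr -big_split.
apply: (sub_sum sJ) => j _ /=; rewrite (lfZ (lwf HW psi0 _)).
have := ideal_wf_Pvec r (n - j); set e1 := wf 0 _; set e2 := Pvec r _.+1; set e3 := conv _ _ _.
move=> H; have -> : g`_j *: e1 + r.+1%:R *: (g`_j *: ((n - j).+1%:R *: e2) + g`_j *: e3) =
  g`_j *: (e1 + r.+1%:R *: ((n - j).+1%:R *: e2 + e3)) by lmod_of K W.
exact: (subZ sJ).
Qed.

(** The start is g_0 = 1. Step j multiplies the constant by - (l - j) (j + 1), nonzero for j < l. *)
Lemma iter_wf_Q j : (j <= l)%N -> exists2 c : K, c != 0 &
  Jid (iter j (wf 0) (iter l (A (-1)) vac) - c *: Q (l - j) j).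
Proof.
elim: j => [_|j IH jl].
  exists 1; rewrite ?oner_eq0 // subn0 scale1r /Q /conv big_ord1 schur_series0 scale1r.
  have -> : Pvec l (0 - 0) = iter l (A (-1)) vac; last by rewrite subrr; apply: (sub0 sJ).
  elim: l => // k IH; rewrite [LHS]/= /conv big_ord1 [RHS]/= -IH.
  by rewrite /Ap; congr (A _ (Pvec _ _)).
have [c c0 H] := IH (ltnW jl); exists (- c * ((l - j)%:R * j.+1%:R)).
  by rewrite !mulf_neq0 ?oppr_eq0 ?pnatr_eq0 //; lia.
have lwf n := lwf HW psi0 n.
have := ideal_wf H; rewrite (lfB (lwf _)) (lfZ (lwf _)) -iterS => H1.
have lj : (l - j)%N = (l - j.+1).+1 by lia.
have := ideal_wf_Q (l - j.+1) jl; rewrite -lj => H2.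
have -> : iter j.+1 (wf 0) (iter l (A (-1)) vac)
   - (- c * ((l - j)%:R * j.+1%:R)) *: Q (l - j.+1) j.+1 =
   (iter j.+1 (wf 0) (iter l (A (-1)) vac) - c *: wf 0 (Q (l - j) j)) +
   c *: (wf 0 (Q (l - j) j) + ((l - j)%:R * j.+1%:R) *: Q (l - j.+1) j.+1).
  by move: (wf 0 (Q _ _)) => y; lmod_of K W.
by apply: (subD sJ); [|apply: (subZ sJ)].
Qed.

(** f(0)^l a(-1)^l 1 is an exact multiple of the vacuum by the sl_2 string, and modulo the creation
    ideal a nonzero multiple of the Schur polynomial times it; the vacuum being outside the ideal,
    the two agree. *)
Lemma schur_vac (N : set W) : stable psi N -> b 0 = - l.+1%:R ->
  schur l x != 0 -> N (iter l (A (-1)) vac) -> N vac.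
Proof.
move=> [sN NA NJ Nwf] b0 s0 Nv; have [c E] := extremal_end b0.
have [d d0] := iter_wf_Q (leqnn l); rewrite E subnn.
have -> : Q 0 l = schur l x *: vac.
  rewrite /Q /conv big_ord_recr /= subnn big1 ?add0r // => i _.
  by rewrite -(subnSK (ltn_ord i)) scaler0.
rewrite scalerA -scalerBl => /ideal_created /(wcreated_vac HW)/eqP.
rewrite subr_eq0 => /eqP cd; apply: (@subZE _ _ _ sN c).
  by rewrite cd mulf_neq0.
have H j : N (iter j (wf 0) (iter l (A (-1)) vac)) by elim: j => //= j; apply: Nwf.
by rewrite -E.
Qed.
End Coefficient.

End SchurVector.

(** * Universal property and cyclicity of induced modules *)

Lemma malg_ind (K : fieldType) (I : choiceType) (P : {malg K[I]} -> Prop) :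
  (forall a x y, P x -> P y -> P (a *: x + y)) -> P 0 -> (forall i, P << i >>) ->
  forall x, P x.
Proof.
move=> PD P0 PU x; rewrite [x]monalgE.
elim: (enum_fset (msupp x)) => [|i s IH]; first by rewrite big_nil.
rewrite big_cons; suff -> : << x@_i *g i >> = x@_i *: << i >> by apply: PD.
by apply/malgP => k; rewrite mcoeffZ !mcoeffU mulrnAr mulr1.
Qed.

Section InducedModule.
Context {K : numFieldType} {g : lieAlgType K} (N : opModule K g).
Hypothesis lieN : lie_module N.
Notation falg := {malg K[{fmonom g}]}.
Let actL (w : N) : linear (fun x => act x w). Proof. by case: lieN. Qed.
Let actR x : linear (act x : N -> N). Proof. by case: lieN. Qed.
Let actB x y (w : N) : act (lie x y) w = act x (act y w) - act y (act x w).
Proof. by case: lieN. Qed.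

Definition word_act (w : N) (m : {fmonom g}) : N := foldr act w (m : seq g).
Definition free_act (x : falg) (w : N) : N := lin_ext (word_act w) x.

Lemma lin_word_act (m : {fmonom g}) : linear (word_act^~ m).
Proof.
by move=> a u v; rewrite /word_act; elim: (m : seq g) => //= x s ->; rewrite actR.
Qed.

Lemma free_actL w : linear (free_act^~ w).
Proof. exact: lin_ext_linear. Qed.

Lemma free_actU m w : free_act << m >> w = word_act w m.
Proof. exact: lin_extU. Qed.

Lemma free_actR x : linear (free_act x).
Proof.
move=> a u v; move: x; apply: malg_ind => [b x y Ex Ey||m].
- by rewrite !(free_actL _) Ex Ey; lmod_of K N.
- by rewrite !(lf0 (free_actL _)) scaler0 addr0.
- by rewrite !free_actU lin_word_act.
Qed.

Lemma free_actM x y w : free_act (x * y) w = free_act x (free_act y w).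
Proof.
move: x; apply: malg_ind => [b x z Ex Ez||m].
- by rewrite mulrDl -scalerAl !(free_actL _) Ex Ez.
- by rewrite mul0r !(lf0 (free_actL _)).
move: y; apply: malg_ind => [b x z Ex Ez||m'].
- by rewrite mulrDr -malg_scalerAr !(free_actL _) (free_actR _) Ex Ez.
- by rewrite mulr0 !(lf0 (free_actL _)) (lf0 (free_actR _)).
have -> : (<< m >> * << m' >> : falg) = << mmul m m' >>.
  by rewrite malgM_def fgmulUU mulr1.
by rewrite !free_actU /word_act fmM foldr_cat.
Qed.

Lemma free_act1 w : free_act 1 w = w.
Proof. by rewrite -[1]/(<< mone >>) free_actU /word_act fm1. Qed.

Lemma free_act_sym x w : free_act (Defs.fsym x) w = act x w.
Proof. by rewrite /Defs.fsym free_actU /word_act fmU. Qed.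

Lemma free_act_ideal x w : uea_ideal g x -> free_act x w = 0.
Proof.
pose I : set falg := fun x => forall w, free_act x w = 0.
suff H : (uea_ideal g `<=` I)%classic by move/H; apply.
apply: smallest_sub => [|r].
  split; first split=> [w'|a u v Iu Iv w'].
  - exact: (lf0 (free_actL _)).
  - by rewrite free_actL Iu Iv scaler0 addr0.
  move=> a u Iu; split=> w'; rewrite free_actM; first by rewrite Iu (lf0 (free_actR _)).
  exact: Iu.
case=> -[].
  move=> a [u [v ->]] w'; rewrite (lfB (free_actL _)) free_actL !free_act_sym actL.
  by rewrite subrr.
move=> u [v ->] w'; rewrite !(lfB (free_actL _)) !free_actM !free_act_sym actB.
by rewrite subrr.
Qed.

Definition uea_act (q : uea g) (w : N) : N := free_act (lrepr q) w.

Lemma uea_actE x w : uea_act (lpi (uea_ideal g) x) w = free_act x w.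
Proof.
apply/eqP; rewrite -subr_eq0 -(lfB (free_actL _)); apply/eqP/free_act_ideal.
by apply/uea_eq; rewrite lreprK.
Qed.

Lemma uea_actL w : linear (uea_act^~ w).
Proof.
move=> a p q; rewrite -[p]lreprK -[q]lreprK -linearP !uea_actE.
exact: free_actL.
Qed.

Lemma uea_actM p q w : uea_act (p * q) w = uea_act p (uea_act q w).
Proof. by rewrite -[p]lreprK -[q]lreprK [_ * _]uea_mulE !uea_actE free_actM. Qed.

Lemma uea_act_in x w : uea_act (uea_in x) w = act x w.
Proof. by rewrite uea_actE free_act_sym. Qed.

Lemma induced_lift (S : set g) (phi : g -> K) (v : N) :
  (forall x, S x -> act x v = phi x *: v) ->
  exists F : induced S phi -> N, module_hom F /\ F (induced_vec S phi) = v.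
Proof.
move=> Sv; pose F (q : induced S phi) := uea_act (lrepr q) v.
have FE a : F (lpi (balanced S phi) a) = uea_act a v.
  apply/eqP; rewrite -subr_eq0 -(lfB (uea_actL _)); apply/eqP.
  have : lspan (balanced S phi) (lrepr (lpi (balanced S phi) a) - a).
    by apply/lpiP; rewrite lreprK.
  move/(@lspan_ind _ _ _ (fun q => uea_act q v = 0)); apply=> [|_ [b [x [Sx ->]]]].
    split=> [|b p q Ep Eq]; first exact: (lf0 (uea_actL _)).
    by rewrite uea_actL Ep Eq scaler0 addr0.
  rewrite (lfB (uea_actL _)) (lfZ (uea_actL _)) uea_actM uea_act_in Sv //.
  by rewrite /uea_act (lfZ (free_actR _)) subrr.
exists F; split; last by rewrite FE -[1]/(lpi _ 1) uea_actE free_act1.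
split=> [a p q|x q].
  by rewrite -[p]lreprK -[q]lreprK -linearP !FE uea_actL.
by rewrite -[q]lreprK induced_actE !FE uea_actM uea_act_in.
Qed.

End InducedModule.

Lemma uea_gen (K : fieldType) (g : lieAlgType K) (N : set (uea g)) :
  subspace N -> N 1 -> (forall x p, N p -> N (uea_in x * p)) -> forall p, N p.
Proof.
move=> sN N1 Nx p; rewrite -[p]lreprK; move: (lrepr p).
apply: malg_ind => [a x y Nx' Ny||m].
- by rewrite linearP; apply: sN.2.
- by rewrite linear0; apply: (sub0 sN).
have : exists s : seq g, m = FMonom s by case: m => s; exists s.
case=> s -> {m}; elim: s => [|x s IH].
  have -> : << FMonom [::] >> = 1 :> {malg K[{fmonom g}]}; last exact: N1.
  by rewrite -[RHS]/(<< mone >>); congr (<< _ >>); apply/val_inj; rewrite /= fm1.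
have -> : << FMonom (x :: s) >> = Defs.fsym x * << FMonom s >> :> {malg K[{fmonom g}]}.
  rewrite malgM_def fgmulUU mulr1; congr (<< _ >>); apply/val_inj.
  by rewrite /= fmM fmU.
have := Nx x _ IH; congr N; exact: uea_mulE.
Qed.

Lemma gen_submodule_induced (K : fieldType) (g : lieAlgType K) (S : set g) (phi : g -> K)
    (N : set (induced S phi)) :
  submodule N -> N (induced_vec S phi) -> forall w, N w.
Proof.
move=> [sN actN] Nv w; rewrite -[w]lreprK; move: (lrepr w).
apply: (@uea_gen _ _ (fun p => N (lpi (balanced S phi) p))) => // [|x p Np].
  by split=> [|a x y Nx Ny]; rewrite ?linear0 ?linearP; [apply: (sub0 sN)|apply: sN.2].
by rewrite -induced_actE; apply: actN.
Qed.

Lemma character_lie_gen (K : numFieldType) (g : lieAlgType K) (M : opModule K g)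
    (G : set g) (phi : g -> K) (v : M) : lie_module M ->
  lie_character (lie_gen G) phi -> (forall x, G x -> act x v = phi x *: v) ->
  forall x, lie_gen G x -> act x v = phi x *: v.
Proof.
move=> [aL aR aB] [phiD phiB] H.
have subG : lie_subalgebra (lie_gen G).
  split=> [|x y Gx Gy]; first split=> [|a x y Gx Gy]; move=> S [sS GS].
  - by case: sS => -[].
  - by case: (sS) => -[_ D] _; apply: D; [apply: Gx|apply: Gy].
  - by case: (sS) => _; apply; [apply: Gx|apply: Gy].
have G0 : lie_gen G 0 by case: subG => -[].
have phi0 : phi 0 = 0.
  have := phiD 1 0 0 G0 G0; rewrite scaler0 addr0 mul1r => /eqP.
  by rewrite -subr_eq subrr eq_sym => /eqP.
(* Membership in the generated subalgebra is carried along because [phi] is controlled only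
   there. *)
pose T : set g := fun x => lie_gen G x /\ act x v = phi x *: v.
suff H' : (lie_gen G `<=` T)%classic by move=> x /H'[].
apply: smallest_sub => [|x Gx]; last first.
  by split; [move=> S [_]; apply|apply: H].
have [sG GB] := subG; split; first split=> [|a x y [Gx Ex] [Gy Ey]].
- by split=> //; rewrite phi0 scale0r (lf0 (aL v)).
- by split; [apply: sG.2|rewrite aL Ex Ey phiD // scalerDl scalerA].
move=> x y [Gx Ex] [Gy Ey]; split; first exact: GB.
rewrite aB phiB // scale0r Ex Ey !(lfZ (aR _)) Ex Ey !scalerA mulrC subrr //.
Qed.

(** * Simplicity of the Wakimoto module *)

Section SimpleQuotient.
Context {K : numFieldType} {W : opModule K weyl_gen} {vac : W}.
Hypothesis HW : weyl_vacuum_module vac.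
Variables (p : nat) (chi : int -> K).
Let psi k := - chi k.
Hypothesis chi0 : forall n : int, p%:Z < n -> lcoef 1 chi n = 0.

Lemma psi_chi n : lcoef 1 psi n = - lcoef 1 chi n. Proof. by []. Qed.

Lemma psi0 n : p%:Z < n -> lcoef 1 psi n = 0.
Proof. by move=> /chi0; rewrite psi_chi => ->; rewrite oppr0. Qed.

Lemma wakimoto_vac_act (phi : affine_sl2 K -> K) :
  lie_character (S_alg p) phi -> phi central = - 2 ->
  (forall i : nat, phi (mode sl2_h i%:Z) = - lcoef 1 chi i%:Z) ->
  (forall i : nat, phi (mode sl2_e i%:Z) = 0) ->
  (forall i : nat, phi (mode sl2_f (i + p + 1)%:Z) = 0) ->
  forall x, S_alg p x -> act (o := wakimoto W psi) x vac = phi x *: (vac : W).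
Proof.
move=> charphi phiK phih phie phif.
have [lieW actK _] := wakimoto_vertex_module HW psi0.
apply: (character_lie_gen lieW charphi) => x.
have E := wakimoto_act_mode HW psi0.
case=> [->|[n n1 ->]|[m pm ->]|[k k0 ->]].
- by rewrite actK phiK.
- rewrite E (A_vac HW); last by lia.
  have -> : n = (absz n)%:Z by lia.
  by rewrite phie scale0r.
- have mE : m = (absz m)%:Z by lia.
  (* For an f(m) with m > p, [wf_vac_pow] is used at cutoff m itself, where its coefficient [b m]
     vanishes. *)
  have bm : forall n : int, (absz m)%:Z < n -> lcoef 1 psi n = 0.
    by move=> n mn; apply: psi0; lia.
  rewrite E {1}mE (wf_vac_pow HW 0 bm) mulr0 subr0 -mE psi0 // scale0r.
  have -> : m = (absz (m - p%:Z - 1)%R + p + 1)%N%:Z by lia.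
  by rewrite phif scale0r.
- rewrite E whE (J_killed HW) //; [|exact: (A_vac HW)|exact: (B_vac HW)].
  have -> : k = (absz k)%:Z by lia.
  by rewrite phih scaler0 add0r psi_chi.
Qed.

Definition simple_condition : Prop :=
  [\/ exists p' : nat,
        [/\ (0 < p')%N,
            forall n : int, p'%:Z < n -> lcoef 1 chi n = 0 &
            lcoef 1 chi p'%:Z <> 0],
      (forall n : int, 0 < n -> lcoef 1 chi n = 0) /\
      (lcoef 1 chi 0 = 1 \/ forall m : int, lcoef 1 chi 0 <> m%:~R) |
      exists l : nat,
        [/\ (0 < l)%N,
            lcoef 1 chi 0 = l%:R + 1,
            forall n : int, 0 < n -> lcoef 1 chi n = 0 &
            schur l (fun n => - lcoef 1 chi (- n%:Z)) <> 0]].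

Lemma stable_vac_in (N : set W) w : simple_condition -> stable psi N -> N w -> w != 0 ->
  N vac.
Proof.
move=> cond stN Nw w0; case: cond => [[q [q0 bq bq0]]|[bq b0]|[l [l0 b0 bq sl]]].
- have bq' n : q%:Z < n -> lcoef 1 psi n = 0 by move=> /bq; rewrite psi_chi => ->; rewrite oppr0.
  have bq0' : (0 < q)%N -> lcoef 1 psi q%:Z != 0 by move=> _; rewrite psi_chi oppr_eq0; apply/eqP.
  have [//|[k [qk]]] := stable_vac HW bq' stN bq0' Nw w0.
  by rewrite qk in q0.
- have bq' (n : int) : 0%N%:Z < n -> lcoef 1 psi n = 0 by move=> /bq; rewrite psi_chi => ->; rewrite oppr0.
  have [//|//|[k [_ k0 bk _]]] := stable_vac HW bq' stN _ Nw w0.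
  have ck : lcoef 1 chi 0 = k.+1%:R by apply: oppr_inj; rewrite -bk.
  case: b0 => [c1|/(_ k.+1)]; last by rewrite ck.
  have : 1%:R = k.+1%:R :> K by rewrite -ck c1.
  by move/eqP; rewrite eqr_nat => /eqP[k1]; rewrite -k1 in k0.
- have bq' (n : int) : 0%N%:Z < n -> lcoef 1 psi n = 0 by move=> /bq; rewrite psi_chi => ->; rewrite oppr0.
  have [//|//|[k [_ k0 bk Nk]]] := stable_vac HW bq' stN _ Nw w0.
  have lb : lcoef 1 psi 0 = - l.+1%:R by rewrite psi_chi b0 natr1.
  have kl : k = l.
    have : k.+1%:R = l.+1%:R :> K by apply: oppr_inj; rewrite -bk.
    by move/eqP; rewrite eqr_nat => /eqP[].
  apply: (schur_vac HW (l := l) bq' stN lb _); last by rewrite -kl.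
  by apply/eqP; apply: contra_not sl => <-.
Qed.

(** When the cutoff is 0, the coefficient of f(0) on the r-th power of a^*(0) is - (chi_0 + r); it
    never vanishes, chi_0 being a positive integer or no integer at all. *)
Lemma stable_setT (N : set W) : simple_condition -> stable psi N -> N vac -> forall w, N w.
Proof.
move=> cond stN Nvac.
have fin (q : nat) : (forall n, q%:Z < n -> lcoef 1 chi n = 0) ->
    (forall r : nat, lcoef 1 psi q%:Z - (q == 0%N)%:R * r%:R != 0) -> forall w, N w.
  move=> bq; apply: (stable_full HW stN Nvac) => n /bq.
  by rewrite psi_chi => ->; rewrite oppr0.
case: cond => [[q [q0 bq bq0]]|[bq b0]|[l [l0 b0 bq sl]]].
- apply: (fin q) => // r; rewrite psi_chi (_ : (q == 0%N) = false); last by lia.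
  by rewrite mul0r subr0 oppr_eq0; apply/eqP.
- apply: (fin 0%N) => // r; rewrite psi_chi eqxx mul1r -opprD oppr_eq0.
  case: b0 => [->|b0]; first by rewrite addrC natr1 pnatr_eq0.
  apply/eqP => /eqP; rewrite addr_eq0 => /eqP E; apply: (b0 (- r%:Z)).
  by rewrite E mulrNz.
- apply: (fin 0%N) => // r; rewrite psi_chi eqxx mul1r -opprD oppr_eq0 b0.
  by rewrite natr1 -natrD pnatr_eq0.
Qed.

Lemma wakimoto_simple : simple_condition -> simple_module (wakimoto W psi).
Proof.
move=> cond; split=> [|N subN]; first by exists (vac : W); exact: (vac_neq0 HW).
have stN := stable_submodule HW psi0 subN.
have [[w [Nw w0]]|no] := pselect (exists w : W, N w /\ w != 0).
  right; apply/seteqP; split=> // u _.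
  exact: (stable_setT cond stN (stable_vac_in cond stN Nw w0)).
left; apply/seteqP; split=> [u Nu|u ->]; last by case: subN => -[].
by apply/eqP; apply: contra_notT no => u0; exists u.
Qed.

Lemma hom_image_submodule (M N : opModule K (affine_sl2 K)) (F : M -> N) :
  module_hom F -> submodule (fun w => exists v, F v = w).
Proof.
move=> [lF FA]; split; first split=> [|a x y [u <-] [v <-]].
- by exists 0; rewrite (lf0 lF).
- by exists (a *: u + v); rewrite lF.
- by move=> i w [v <-]; exists (act i v); rewrite FA.
Qed.

Lemma simple_hom_surj (M N : opModule K (affine_sl2 K)) (F : M -> N) u :
  simple_module N -> module_hom F -> F u != 0 -> forall w, exists v, F v = w.
Proof.
move=> [_ simN] homF u0 w; case: (simN _ (hom_image_submodule homF)) => E.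
  have : (set1 0 : set N) (F u) by rewrite -E; exists u.
  by move=> e; rewrite e eqxx in u0.
suff : (setT : set N) w by rewrite -E.
by [].
Qed.

End SimpleQuotient.

(** * Sugawara operators at the critical level *)

Lemma isum_scale (K : fieldType) (V : lmodType K) (c : int -> K) (w : V) : fsupp (fun k => c k : K^o) ->
  isum (fun k => c k *: w) = (isum (fun k => c k : K^o) : K) *: w.
Proof.
move=> fc; have lw : linear (fun a : K^o => a *: w).
  by move=> a u v; rewrite scalerDl scalerA.
by rewrite (lf_isum lw fc).
Qed.

Section Sugawara.
Context {K : numFieldType} {M : opModule K (affine_sl2 K)}.
Hypothesis vM : vertex_module (- 2) M.

Definition sl2_field : sl2_basis -> field_on M := locked (fun x n w => act (mode x n) w).
Lemma sl2_fieldE x n w : sl2_field x n w = act (mode x n) w.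
Proof. by rewrite /sl2_field -lock. Qed.
Lemma sl2_field_fun x : sl2_field x = fun n w => act (mode x n) w.
Proof. by rewrite /sl2_field -lock. Qed.
Local Notation e := (sl2_field sl2_e).
Local Notation f := (sl2_field sl2_f).
Local Notation h := (sl2_field sl2_h).

Let aL (w : M) : linear (fun x : affine_sl2 K => act x w).
Proof. by case: vM => -[]. Qed.
Let aR (x : affine_sl2 K) : linear (act x : M -> M).
Proof. by case: vM => -[]. Qed.

Lemma field_sl2 x : is_field (sl2_field x).
Proof.
rewrite sl2_field_fun; split=> [n|w]; first exact: aR.
by case: vM => _ _ /(_ x w).
Qed.
Let fe := field_sl2 sl2_e.
Let ff := field_sl2 sl2_f.
Let fh := field_sl2 sl2_h.

Lemma sl2_field_comm x y n m w :
  sl2_field x n (sl2_field y m w) - sl2_field y m (sl2_field x n w) =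
  act (sl2_lie x y (n + m) : affine_sl2 K) w +
  (-2 * n%:~R * sl2_form x y * (n + m == 0)%:R) *: w.
Proof.
case: vM => -[_ _ aB] aK _; rewrite !sl2_fieldE -aB [lie _ _]affine_lieE /=.
by rewrite (lfD (aL w)) (lfZ (aL w)) aK scalerA; congr (_ + _ *: _); ring.
Qed.

Lemma e_f n m w : e n (f m w) - f m (e n w) =
  h (n + m) w + (-2 * n%:~R * (n + m == 0)%:R) *: w.
Proof. by rewrite sl2_field_comm mulr1 -sl2_fieldE. Qed.
Lemma h_e n m w : h n (e m w) - e m (h n w) = 2 *: e (n + m) w.
Proof. by rewrite sl2_field_comm mulr0 mul0r scale0r addr0 (lfZ (aL w)) -sl2_fieldE. Qed.
Lemma h_f n m w : h n (f m w) - f m (h n w) = -2 *: f (n + m) w.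
Proof.
by rewrite sl2_field_comm mulr0 mul0r scale0r addr0 (lfN (aL w)) (lfZ (aL w)) scaleNr -sl2_fieldE.
Qed.
Lemma e_e n m w : e n (e m w) = e m (e n w).
Proof.
by apply/eqP; rewrite -subr_eq0 sl2_field_comm mulr0 mul0r scale0r addr0 (lf0 (aL w)).
Qed.
Lemma f_f n m w : f n (f m w) = f m (f n w).
Proof.
by apply/eqP; rewrite -subr_eq0 sl2_field_comm mulr0 mul0r scale0r addr0 (lf0 (aL w)).
Qed.

Let lsl2 x n : linear (sl2_field x n). Proof. exact: (field_sl2 x).1. Qed.

Lemma sugawara_np n w : sugawara n w =
  2^-1 *: (np 0 e f n w + np 0 f e n w + 2^-1 *: np 0 h h n w).
Proof.
have E X Y (fX : is_field X) (fY : is_field Y) :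
    normal_prod X Y (n + 1) w = np 0 X Y n w.
  by rewrite (normal_prodE _ _ fX fY) addrK.
transitivity (2^-1 *: (normal_prod e f (n + 1) w + normal_prod f e (n + 1) w +
    2^-1 *: normal_prod h h (n + 1) w)); first by rewrite /sl2_field -lock.
by congr (_ *: (_ + _ + _ *: _)); [exact: (E e f fe ff)|exact: (E f e ff fe)|exact: (E h h fh fh)].
Qed.

Lemma lin_sugawara n : linear (fun w : M => sugawara n w).
Proof.
move=> a u v; rewrite !sugawara_np (lin_np 0 n fe ff) (lin_np 0 n ff fe).
by rewrite (lin_np 0 n fh fh); lmod_of K M.
Qed.

(* The shifts of the normal ordering cut compensate the central terms exactly
   when the level is -2. *)
Lemma critical_comm (X Y H : field_on M) (eps : K) n m w :
  is_field X -> is_field Y -> is_field H -> eps * eps = 1 ->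
  (forall i j u, X i (X j u) = X j (X i u)) ->
  (forall i j u, X i (Y j u) - Y j (X i u) =
     eps *: H (i + j) u + (-2 * i%:~R * (i + j == 0)%:R) *: u) ->
  (forall i j u, H i (X j u) - X j (H i u) = (2 * eps) *: X (i + j) u) ->
  X m (np 0 X Y n w + np 0 Y X n w + 2^-1 *: np 0 H H n w) =
  np 0 X Y n (X m w) + np 0 Y X n (X m w) + 2^-1 *: np 0 H H n (X m w).
Proof.
move=> fX fY fH ee XX XY HX.
have shf (Z : field_on M) c : is_field Z -> is_field (fun i => Z (i + c)).
  move=> fZ; split=> [i|u]; first exact: fZ.1.
  by have [N HN] := fZ.2 u; exists (N - c) => i Hi; apply: HN; lia.
have fH' := shf H m fH; have fX' := shf X m fX.
have fdel a : is_field (fun i (u : M) => ((m + i == 0)%:R * a) *: u).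
  split=> [i b u u'|u]; first by lmod_of K M.
  exists (- m) => i Hi; have -> : (m + i == 0) = false by lia.
  by rewrite mul0r scale0r.
have feH : is_field (fun i u => eps *: H (i + m) u).
  split=> [i b u u'|u]; first by rewrite fH'.1; lmod_of K M.
  by have [N HN] := fH'.2 u; exists N => i Hi; rewrite HN ?scaler0.
(* The cut stays free because the product in the order Y, X cut at 0 is the product X, Y cut at
   [n + 1]. *)
have d1 c : X m (np c X Y n w) - np c X Y n (X m w) =
    eps *: np c X H (n + m) w + (-2 * m%:~R) *: X (n + m) w.
  rewrite (@np_der _ _ _ _ _ (fun _ _ => 0) (fun i u => eps *: H (i + m) u +
     ((m + i == 0)%:R * (-2 * m%:~R)) *: u) (X m) n w fX fY (fX.1 m)).
  - rewrite (np_0l _ _ _ fY) add0r (np_addr _ _ _ fX feH (fdel _)).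
    by rewrite (np_scaler _ _ _ _ fX fH') np_shiftr (np_deltar _ _ _ _ _ fX).
  - by move=> i u; rewrite XX subrr.
  - by move=> i u; rewrite XY (addzC m i) (mulrC (-2 * _)).
have d3 : X m (np 0 H H n w) - np 0 H H n (X m w) =
    (-2 * eps) *: (np m X H (n + m) w + np (n + m + 1) X H (n + m) w).
  have HX' i u : X m (H i u) - H i (X m u) = (-2 * eps) *: X (i + m) u.
    by apply: subr_sym; rewrite HX -scaleNr; congr (_ *: _); ring.
  rewrite (np_der 0 n w fH fH (fX.1 m) HX' HX').
  rewrite (np_scalel _ _ _ _ fX' fH) (np_scaler _ _ _ _ fH fX') np_shiftl np_shiftr.
  by rewrite add0r (np_flip 0 H X) subr0 scalerDr.
have cut c : np c X H (n + m) w = np 0 X H (n + m) w + c%:~R *: ((-2 * eps) *: X (n + m) w).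
  rewrite (np_linear_cut 0 c fX fH (g := (-2 * eps) *: X (n + m) w)) ?subr0 // => i.
  apply: subr_sym; rewrite HX -scaleNr (_ : n + m - i + i = n + m); last by lia.
  by congr (_ *: _); ring.
have lX := fX.1 m; rewrite !(lfD lX) (lfZ lX) !(np_flip 0 Y X) subr0.
rewrite (eq_subl (d1 0)) (eq_subl (d1 (n + 1))) (eq_subl d3).
rewrite (cut (n + 1)) (cut m) (cut (n + m + 1)).
move: (np 0 X H _ _) (np 0 X Y _ _) (np (n + 1) X Y _ _) (np 0 H H _ _) (X (n + m) w).
move=> x1 x2 x3 x4 x5; rewrite !intrD.
(* The sums in X and H cancel. In front of X(n+m) the central terms contribute -4m and the displaced
   cuts 4 eps^2 m. *)
have -> : x2 + (eps *: x1 + (-2 * m%:~R) *: x5) +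
  (x3 + (eps *: (x1 + (n%:~R + 1%:~R) *: ((-2 * eps) *: x5)) + (-2 * m%:~R) *: x5)) +
  2^-1 *: (x4 + (-2 * eps) *: (x1 + m%:~R *: ((-2 * eps) *: x5) +
    (x1 + (n%:~R + m%:~R + 1%:~R) *: ((-2 * eps) *: x5)))) =
  x2 + x3 + 2^-1 *: x4 + ((eps * eps - 1) * 4 * m%:~R) *: x5.
  by lmod_of K M; field.
by rewrite ee subrr !mul0r scale0r addr0.
Qed.

Lemma sugawara_e n m w : sugawara n (e m w) = e m (sugawara n w).
Proof.
rewrite !sugawara_np (lfZ (lsl2 _ _)); congr (_ *: _).
apply/esym/(@critical_comm e f h 1) => //; rewrite ?mulr1 //.
- exact: e_e.
- by move=> i j u; rewrite e_f scale1r.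
- exact: h_e.
Qed.

Lemma sugawara_f n m w : sugawara n (f m w) = f m (sugawara n w).
Proof.
rewrite !sugawara_np (lfZ (lsl2 _ _)); congr (_ *: _).
rewrite [np 0 e f n (f m w) + _]addrC [np 0 e f n w + _]addrC.
(* The involution exchanging e and f changes the sign of h, whence [eps = -1]. *)
apply/esym/(@critical_comm f e h (-1)) => //; rewrite ?mulrN1 ?opprK //.
- exact: f_f.
- move=> i j u; apply: subr_sym; rewrite e_f (addzC j i).
  have [ij|_] := eqVneq (i + j) 0; last by rewrite !mulr0 !scale0r !addr0 scaleN1r opprK.
  have -> : j = - i by lia.
  by rewrite mulrNz; lmod_of K M.
- exact: h_f.
Qed.

Lemma h_ef m w : h m w = e m (f 0 w) - f 0 (e m w).
Proof.
rewrite e_f addr0; have [->|_] := eqVneq m 0; last by rewrite mulr0 scale0r addr0.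
by rewrite mulr0 mul0r scale0r addr0.
Qed.

Lemma sugawara_comm n (x : affine_sl2 K) (w : M) :
  sugawara n (act x w) = act x (sugawara n w).
Proof.
have lT := lin_sugawara n; move: x; apply: affine_ind => [|a x y Ex Ey|].
- by rewrite !(lf0 (aL _)) (lf0 lT).
- by rewrite !aL lT Ex Ey.
case=> [[x m]|]; last by case: vM => _ aK _; rewrite !aK (lfZ lT).
rewrite -/(mode x m) -!sl2_fieldE; case: x; [exact: sugawara_e|exact: sugawara_f|].
by rewrite !h_ef (lfB lT) !(sugawara_e, sugawara_f).
Qed.

Lemma sugawara_normal n w : sugawara n w =
  np 0 e f n w + ((n + 1)%:~R / 2) *: h n w + 4^-1 *: np 0 h h n w.
Proof.
rewrite sugawara_np (np_flip 0 f e) subr0.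
(* The function is a discrete primitive of [e(i), f(n-i)]. Its central part at [n + 1] is n (n + 1)
   delta_{n,0}, which is 0, so only h(n) remains. *)
rewrite (@np_cut _ _ e f n w (fun i => i%:~R *: h n w -
   ((i * (i - 1))%:~R * (n == 0)%:R) *: w) 0 (n + 1) fe ff) => [|i].
  have -> : ((n + 1) * (n + 1 - 1))%:~R * (n == 0)%:R = 0 :> K.
    by rewrite addrK; have [->|_] := eqVneq n 0; [rewrite mulr0 mul0r|rewrite mulr0].
  have -> : (0 * (0 - 1))%:~R * (n == 0)%:R = 0 :> K by rewrite !mul0r.
  by lmod_of K M; field.
rewrite e_f (_ : i + (n - i) = n); last by lia.
by rewrite !rmorphM !rmorphB !rmorphD /=; lmod_of K M.
Qed.

(** The coefficient of z^(-n-2) in (b(z)^2 - 2 b'(z)) / 4. *)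
Definition theta_of (b : int -> K) (n : int) : K :=
  4^-1 * ((isum (fun k => b k * b (n - k) : K^o) : K) + 2 * (n + 1)%:~R * b n).

Lemma fsupp_square (b : int -> K) (p n : int) : (forall k, p < k -> b k = 0) ->
  fsupp (fun k => b k * b (n - k) : K^o).
Proof.
move=> bp; apply: (@fsupp_bounds _ _ _ (n - p) p) => k Hk.
  by rewrite [b (n - k)]bp ?mulr0 //; lia.
by rewrite bp ?mul0r.
Qed.

Lemma sugawara_highest (b : int -> K) (p : nat) (u : M) (n : int) :
  (forall k : int, p%:Z < k -> b k = 0) ->
  (forall k : int, 0 <= k -> e k u = 0) -> (forall k : int, p%:Z < k -> f k u = 0) ->
  (forall k : int, 0 <= k -> h k u = b k *: u) -> p%:Z <= n ->
  sugawara n u = theta_of b n *: u.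
Proof.
move=> bp eu fu hu pn; rewrite sugawara_normal.
have -> : np 0 e f n u = 0.
  apply: isum0 => i; case: ifP => i0; first by rewrite fu ?(lf0 (lsl2 _ _)) //; lia.
  by rewrite eu ?(lf0 (lsl2 _ _)) //; lia.
have -> : np 0 h h n u = (isum (fun k => b k * b (n - k) : K^o) : K) *: u.
  rewrite -isum_scale; last exact: fsupp_square bp.
  apply: eq_isum => k; case: ifP => k0.
    (* As n >= p, a negative k is paired with n - k > p, so no negative mode of h ever acts. *)
    have E0 : b (n - k) = 0 by apply: bp; lia.
    rewrite (hu (n - k)); last by lia.
    by rewrite E0 mulr0 !scale0r (lf0 (lsl2 _ _)).
  rewrite (hu k) ?(lfZ (lsl2 _ _)); last by lia.
  have [pk|kp] := ltP p%:Z k; first by rewrite (bp k) ?mul0r ?scale0r.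
  rewrite (hu (n - k)); last by lia.
  by rewrite scalerA.
by rewrite (hu n) /theta_of; [lmod_of K M; field|lia].
Qed.

End Sugawara.

Lemma sugawara_hom (K : numFieldType) (M N : opModule K (affine_sl2 K)) (F : M -> N) n w :
  vertex_module (- 2) M -> vertex_module (- 2) N -> module_hom F ->
  F (sugawara n w) = sugawara n (F w).
Proof.
move=> vM vN [lF FA]; rewrite (sugawara_np vM) (sugawara_np vN).
have E x y : F (np 0 (sl2_field x) (sl2_field y) n w) =
    np 0 (sl2_field x) (sl2_field y) n (F w).
  have fs := np_fsupp 0 n w (field_sl2 vM x) (field_sl2 vM y).
  rewrite /np (lf_isum lF fs); apply: eq_isum => i; rewrite !sl2_fieldE.
  by case: ifP; rewrite !FA.
by rewrite (lfZ lF) !(lfD lF) (lfZ lF) !E.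
Qed.

(** * Spanning the quotient on which T(z) is scalar *)

Section Spanning.
Context {K : numFieldType} {M : opModule K (affine_sl2 K)}.
Hypothesis vM : vertex_module (- 2) M.
Variables (p : nat) (b theta : int -> K) (u : M).
Local Notation e := (sl2_field (M := M) sl2_e).
Local Notation f := (sl2_field (M := M) sl2_f).
Local Notation h := (sl2_field (M := M) sl2_h).
Hypothesis p0 : (0 < p)%N.
Hypothesis bp : forall k : int, p%:Z < k -> b k = 0.
Hypothesis bp0 : b p%:Z != 0.
Hypothesis eu : forall k : int, 0 <= k -> e k u = 0.
Hypothesis fu : forall k : int, p%:Z < k -> f k u = 0.
Hypothesis hu : forall k : int, 0 <= k -> h k u = b k *: u.
Hypothesis Tu : forall n (w : M), sugawara n w = theta n *: w.
Hypothesis gen_u : forall N : set M, submodule N -> N u -> forall w, N w.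
Let le n := (field_sl2 vM sl2_e).1 n.
Let lf n := (field_sl2 vM sl2_f).1 n.
Let lh n := (field_sl2 vM sl2_h).1 n.

Definition weight (i : bool * nat) : nat := if i.1 then i.2.+1 else i.2.
Local Notation en := (energy weight).

(** Each of [eop] and [fop] ignores the letters of the other kind. In [ymon] the e modes thus stand
    left of the f modes, and permuted words give equal vectors although e and f do not commute. *)
Definition eop (i : bool * nat) (w : M) : M := if i.1 then e (- i.2.+1%:Z) w else w.
Definition fop (i : bool * nat) (w : M) : M := if i.1 then w else f (p%:Z - i.2%:Z) w.
Definition ymon (s : seq (bool * nat)) : M := mon eop s (mon fop s u).

Lemma eopC i j w : eop i (eop j w) = eop j (eop i w).
Proof. by case: i j => [[] i] [[] j] //; exact: (e_e vM). Qed.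
Lemma fopC i j w : fop i (fop j w) = fop j (fop i w).
Proof. by case: i j => [[] i] [[] j] //; exact: (f_f vM). Qed.

Lemma ymon_perm s t : perm_eq s t -> ymon s = ymon t.
Proof. by move=> st; rewrite /ymon (mon_perm eopC _ st) (mon_perm fopC _ st). Qed.

Lemma energyT k s : en ((true, k) :: s) = (k.+1 + en s)%N. Proof. by []. Qed.
Lemma energyF k s : en ((false, k) :: s) = (k + en s)%N. Proof. by []. Qed.

Lemma ymon_e k s : ymon ((true, k) :: s) = e (- k.+1%:Z) (ymon s).
Proof. by []. Qed.

Lemma mon_eop_id s w : all (fun i => ~~ i.1) s -> mon eop s w = w.
Proof. by elim: s => //= -[[] j] s IH /andP[//= _ /IH]. Qed.

Lemma ymon_f j s : all (fun i => ~~ i.1) s ->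
  ymon ((false, j) :: s) = f (p%:Z - j%:Z) (ymon s).
Proof. by move=> s0; rewrite /ymon !mon_eop_id. Qed.

Lemma ymon_case s : [\/ s = [::],
  exists k t, [/\ ymon s = e (- k.+1%:Z) (ymon t), en s = (k.+1 + en t)%N & size s = (size t).+1] |
  exists j t, [/\ all (fun i => ~~ i.1) s, ymon s = f (p%:Z - j%:Z) (ymon t),
                 en s = (j + en t)%N & size s = (size t).+1]].
Proof.
have [s0|/allPn[[[] k] ks //= _]] := boolP (all (fun i => ~~ i.1) s).
  case: s s0 => [|[[] j] t] //=; first by constructor 1.
  by move=> t0; constructor 3; exists j, t; rewrite ymon_f.
have st := perm_to_rem ks; constructor 2; exists k, (rem (true, k) s).
by rewrite (ymon_perm st) (energy_perm weight st) (perm_size st).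
Qed.

Definition Sp (E : int) : set M :=
  lspan (fun w => exists2 s, (en s)%:Z <= E & w = ymon s).

Lemma sSp E : subspace (Sp E). Proof. exact: subspace_lspan. Qed.

Lemma Sp_ymon s E : (en s)%:Z <= E -> Sp E (ymon s).
Proof. by move=> sE; apply: lspan_gen; exists s. Qed.

Lemma Sp_le E E' w : E <= E' -> Sp E w -> Sp E' w.
Proof.
move=> EE /(@lspan_ind _ _ _ (Sp E')); apply=> [|_ [s sE ->]]; first exact: sSp.
by apply: Sp_ymon; apply: le_trans EE.
Qed.

Lemma Sp_ind (X : M -> M) E E' w : linear X ->
  (forall s, (en s)%:Z <= E -> Sp E' (X (ymon s))) -> Sp E w -> Sp E' (X w).
Proof.
move=> lX H /(@lspan_ind _ _ _ (fun w => Sp E' (X w))); apply=> [|_ [s sE ->]]; last exact: H.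
by split=> [|a x y Hx Hy]; rewrite ?(lf0 lX) ?lX; [apply: (sub0 (sSp _))|apply: (sSp _).2].
Qed.

Lemma Sp_creation (n : int) E w : n < 0 -> Sp E w -> Sp (E - n) (e n w).
Proof.
move=> n0; apply: Sp_ind => [|s sE]; first exact: le.
have -> : n = - ((absz n).-1).+1%:Z by lia.
by rewrite -ymon_e; apply: Sp_ymon; rewrite energyT; lia.
Qed.

(** The scalar part of h(n) preserves the energy whatever n is; without it the mode lowers the
    energy by n. *)
Definition D n w := h n w - b n *: w.
Lemma lD n : linear (D n).
Proof. by move=> a x y; rewrite /D lh; lmod_of K M. Qed.
Lemma hD n w : h n w = D n w + b n *: w. Proof. by rewrite /D subrK. Qed.

Lemma f_eE n i w : f n (e i w) =
  e i (f n w) - h (i + n) w - (-2 * i%:~R * (i + n == 0)%:R) *: w.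
Proof. by rewrite (eq_subl (e_f vM i n w)); lmod_of K M. Qed.
Lemma e_fE n i w : e n (f i w) =
  f i (e n w) + (h (n + i) w + (-2 * n%:~R * (n + i == 0)%:R) *: w).
Proof. by rewrite (eq_subl (e_f vM n i w)). Qed.
Lemma D_e n i w : D n (e i w) = e i (D n w) + 2 *: e (n + i) w.
Proof. by rewrite /D (lfB (le _)) (lfZ (le _)) (eq_subl (h_e vM n i w)); lmod_of K M. Qed.
Lemma D_f n i w : D n (f i w) = f i (D n w) - 2 *: f (n + i) w.
Proof. by rewrite /D (lfB (lf _)) (lfZ (lf _)) (eq_subl (h_f vM n i w)); lmod_of K M. Qed.

Lemma f_large s (n : int) : all (fun i => ~~ i.1) s -> p%:Z < n -> f n (ymon s) = 0.
Proof.
move=> s0 pn; rewrite /ymon mon_eop_id //; elim: s s0 => [|[[] j] s IH] //=.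
  by move=> _; apply: fu.
by move=> s0; rewrite /fop /= (f_f vM) IH // (lf0 (lf _)).
Qed.

Lemma negative_output s : [/\
  forall n : int, (en s)%:Z - n + p%:Z < 0 -> f n (ymon s) = 0,
  forall n : int, (en s)%:Z - n < 0 -> e n (ymon s) = 0 &
  forall n : int, (en s)%:Z - n < 0 -> D n (ymon s) = 0].
Proof.
have [m] := ubnP (size s); elim: m s => // m IH s sm.
case: (ymon_case s) => [->|[k [t [-> -> st]]]|[j [t [s0 sE -> st]]]].
- split=> n Hn; [apply: fu|apply: eu|rewrite /D hu ?subrr //];
    move: Hn; rewrite /energy /=; lia.
- have [|F1 F2 F3] := IH t; first by move: sm; rewrite st.
  split=> n Hn.
  + rewrite f_eE F1 ?(lf0 (le _)); last by lia.
    rewrite hD F3 ?bp ?scale0r; try by lia.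
    have -> : (- k.+1%:Z + n == 0) = false by lia.
    by rewrite mulr0 scale0r addr0 !subr0.
  + by rewrite (e_e vM) F2 ?(lf0 (le _)) //; lia.
  + rewrite D_e F3 ?F2 ?(lf0 (le _)) ?scaler0 ?addr0 //; lia.
have [|F1 F2 F3] := IH t; first by move: sm; rewrite st.
rewrite sE; split=> n Hn.
- by rewrite -sE f_large //; lia.
- rewrite e_fE F2 ?(lf0 (lf _)); last by lia.
  rewrite hD F3 ?bp ?scale0r; try by lia.
  have -> : (n + (p%:Z - j%:Z) == 0) = false by lia.
  by rewrite mulr0 scale0r !addr0.
rewrite D_f F3 ?F1 ?(lf0 (lf _)) ?scaler0 ?subrr //; lia.
Qed.

Definition cF (o : int) := forall s n, (en s)%:Z - n + p%:Z = o -> Sp o (f n (ymon s)).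
Definition cE (o : int) := forall s n, (en s)%:Z - n = o -> Sp o (e n (ymon s)).
Definition cH (o : int) := forall s n, (en s)%:Z - n = o -> Sp o (D n (ymon s)).

Lemma liftF X E n w : (forall o : int, o <= X -> cF o) -> E - n + p%:Z <= X ->
  Sp E w -> Sp X (f n w).
Proof.
move=> H EX; apply: Sp_ind => [|s sE]; first exact: lf.
by apply: (@Sp_le ((en s)%:Z - n + p%:Z)); [lia|apply: H => //; lia].
Qed.
Lemma liftE X E n w : (forall o : int, o <= X -> cE o) -> E - n <= X ->
  Sp E w -> Sp X (e n w).
Proof.
move=> H EX; apply: Sp_ind => [|s sE]; first exact: le.
by apply: (@Sp_le ((en s)%:Z - n)); [lia|apply: H => //; lia].
Qed.
Lemma liftD X E n w : (forall o : int, o <= X -> cH o) -> E - n <= X ->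
  Sp E w -> Sp X (D n w).
Proof.
move=> H EX; apply: Sp_ind => [|s sE]; first exact: lD.
by apply: (@Sp_le ((en s)%:Z - n)); [lia|apply: H => //; lia].
Qed.
Lemma lifth X Y E n w : (forall o : int, o <= Y -> cH o) -> E - n <= Y -> Y <= X ->
  (n <= p%:Z -> E <= X) -> Sp E w -> Sp X (h n w).
Proof.
move=> H EY YX EX Sw; rewrite hD; apply: (subD (sSp _)).
  by apply: Sp_le YX _; apply: liftD Sw.
have [np|pn] := leP n p%:Z; last by rewrite bp // scale0r; apply: (sub0 (sSp _)).
by apply: (subZ (sSp _)); apply: Sp_le Sw; apply: EX.
Qed.

(* The induction is on the energy o of the result: the energy of the argument can
   grow when T(p - i) is used to express h(-i). *)
Section Step.
Variable o : nat.
Hypothesis IHF : forall o' : int, o' < o%:Z -> cF o'.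
Hypothesis IHE : forall o' : int, o' < o%:Z -> cE o'.
Hypothesis IHH : forall o' : int, o' < o%:Z -> cH o'.

Let IHF' X : X < o%:Z -> forall o', o' <= X -> cF o'.
Proof. by move=> Xo o' oX; apply: IHF; apply: le_lt_trans Xo. Qed.
Let IHE' X : X < o%:Z -> forall o', o' <= X -> cE o'.
Proof. by move=> Xo o' oX; apply: IHE; apply: le_lt_trans Xo. Qed.
Let IHH' X : X < o%:Z -> forall o', o' <= X -> cH o'.
Proof. by move=> Xo o' oX; apply: IHH; apply: le_lt_trans Xo. Qed.

Lemma stepF : cF o%:Z.
Proof.
move=> s n so; have fcreate : all (fun i => ~~ i.1) s -> Sp o%:Z (f n (ymon s)).
  move=> s0; have [pn|np] := ltP p%:Z n.
    by rewrite f_large //; apply: (sub0 (sSp _)).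
  have -> : n = p%:Z - (absz (p%:Z - n)%R)%:Z by lia.
  by rewrite -ymon_f //; apply: Sp_ymon; rewrite energyF; lia.
case: (ymon_case s) => [s0|[k [t [-> sk st]]]|[j [t [s0 _ _ _]]]].
- by apply: fcreate; rewrite s0.
- rewrite f_eE; apply: (subB (sSp _)); first apply: (subB (sSp _)).
  + have -> : o%:Z = o%:Z - k.+1%:Z - (- k.+1%:Z) by lia.
    apply: Sp_creation; first by lia.
    by apply: IHF; lia.
  (* f(n) shifts the energy by p - n but the commutator h only by minus its index, so the result has
     energy o - p < o up to its scalar part. *)
  + apply: (@lifth _ (o%:Z - p%:Z) (en t)%:Z); try lia; last exact: Sp_ymon.
    by apply: IHH'; lia.
  have [kn|_] := eqVneq (- k.+1%:Z + n) 0; last first.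
    by rewrite mulr0 scale0r; apply: (sub0 (sSp _)).
  by apply: (subZ (sSp _)); apply: Sp_ymon; lia.
- exact: fcreate.
Qed.

Let IHFo o' : o' <= o%:Z -> cF o'.
Proof.
by rewrite le_eqVlt => /orP[/eqP ->|]; [exact: stepF|exact: IHF].
Qed.

Lemma stepE : cE o%:Z.
Proof.
move=> s n so; have [n0|n0] := ltP n 0.
  by rewrite -so; apply: Sp_creation => //; apply: Sp_ymon.
(* The letter f(p) has energy 0, so removing it does not decrease [o]; an inner induction on the
   length handles it. *)
have [m] := ubnP (size s); elim: m s so => // m IH s so sm.
case: (ymon_case s) => [->|[k [t [-> sk st]]]|[j [t [_ -> sj st]]]].
- by rewrite /ymon /= eu //; apply: (sub0 (sSp _)).
- rewrite (e_e vM).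
  have -> : o%:Z = o%:Z - k.+1%:Z - (- k.+1%:Z) by lia.
  by apply: Sp_creation; [lia|apply: IHE; lia].
have Et : Sp (o%:Z - j%:Z) (e n (ymon t)).
  have [j0|j0] := posnP j; last by apply: IHE; lia.
  by rewrite j0 subr0; apply: IH; [lia|rewrite -ltnS -st].
rewrite e_fE; apply: (subD (sSp _)); last apply: (subD (sSp _)).
- by apply: (liftF IHFo _ Et); lia.
- apply: (@lifth _ (o%:Z - p%:Z) (en t)%:Z); try lia; last exact: Sp_ymon.
  by apply: IHH'; lia.
have [kn|_] := eqVneq (n + (p%:Z - j%:Z)) 0; last first.
  by rewrite mulr0 scale0r; apply: (sub0 (sSp _)).
by apply: (subZ (sSp _)); apply: Sp_ymon; lia.
Qed.

Lemma stepH_nonneg s (n : int) : 0 <= n -> (en s)%:Z - n = o%:Z -> Sp o%:Z (D n (ymon s)).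
Proof.
move=> n0 so; have [m] := ubnP (size s); elim: m s so => // m IH s so sm.
case: (ymon_case s) => [->|[k [t [-> sk st]]]|[j [t [_ -> sj st]]]].
- by rewrite /ymon /= /D hu // subrr; apply: (sub0 (sSp _)).
- rewrite D_e; apply: (subD (sSp _)).
    have -> : o%:Z = o%:Z - k.+1%:Z - (- k.+1%:Z) by lia.
    by apply: Sp_creation; [lia|apply: IHH; lia].
  by apply: (subZ (sSp _)); apply: stepE; lia.
have Dt : Sp (o%:Z - j%:Z) (D n (ymon t)).
  have [j0|j0] := posnP j; last by apply: IHH; lia.
  by rewrite j0 subr0; apply: IH; [lia|rewrite -ltnS -st].
rewrite D_f; apply: (subB (sSp _)); first by apply: (liftF IHFo _ Dt); lia.
by apply: (subZ (sSp _)); apply: stepF; lia.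
Qed.

(* T(p - i) acts by a scalar, and its expression in the modes contains
   chi_p h(-i) / 2 up to terms of lower energy. *)
Lemma stepH : cH o%:Z.
Proof.
move=> s n so; have [n0|n0] := leP 0 n; first exact: stepH_nonneg.
(* With this [m], the quadratic term h(p) h(n) occurs in T(m), and h(p) contributes its nonzero
   eigenvalue [b p]. *)
set w := ymon s; pose m := p%:Z + n.
have Sw : Sp (en s)%:Z w by exact: Sp_ymon.
have Dw a : n < a -> Sp ((en s)%:Z - a) (D a w) by move=> na; apply: IHH; lia.
pose x := D n w.
pose G k := if k < 0 then h k (h (m - k) w) else h (m - k) (h k w).
(* The side condition is the normal ordering; it forces [n < a], so the inner mode [D a] falls under
   the induction hypothesis. *)
have pair a c : a + c = m -> 0 <= a \/ c < 0 ->
    Sp o%:Z (h c (h a w) - (if a == p%:Z then b p%:Z else 0) *: x).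
  move=> ac aorc; have na : n < a by lia.
  rewrite [h a w]hD (lfD (lh c)) (lfZ (lh c)) [h c w]hD.
  have S1 : Sp o%:Z (h c (D a w)).
    apply: (@lifth _ (o%:Z - p%:Z) ((en s)%:Z - a)); try lia; last exact: Dw.
    by apply: IHH'; lia.
  have S2 : Sp o%:Z (b a *: (b c *: w)).
    by do 2!apply: (subZ (sSp _)); apply: Sp_le Sw; lia.
  have S3 : Sp o%:Z (b a *: D c w - (if a == p%:Z then b p%:Z else 0) *: x).
    have [ap|ap] := eqVneq a p%:Z.
      have -> : c = n by lia.
      by rewrite ap subrr; apply: (sub0 (sSp _)).
    rewrite scale0r subr0; have [pa|ap'] := ltP p%:Z a.
      by rewrite bp // scale0r; apply: (sub0 (sSp _)).
    apply: (subZ (sSp _)); apply: (@Sp_le ((en s)%:Z - c)); first by lia.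
    by apply: Dw; lia.
  have -> : h c (D a w) + b a *: (D c w + b c *: w) -
      (if a == p%:Z then b p%:Z else 0) *: x =
    h c (D a w) + b a *: (b c *: w) +
      (b a *: D c w - (if a == p%:Z then b p%:Z else 0) *: x) by lmod_of K M.
  by apply: (subD (sSp _)) => //; apply: (subD (sSp _)).
have fG : fsupp G by exact: (np_fsupp 0 m w (field_sl2 vM sl2_h) (field_sl2 vM sl2_h)).
(* The inner mode is h(p) for exactly two indices of the normally ordered sum, k = n and k = p,
   which gives the factor 2. *)
pose H k := (if (k == n) || (k == p%:Z) then b p%:Z else 0) *: x.
have fH : fsupp H.
  apply: (@fsupp_bounds _ _ _ n p%:Z) => k Hk; rewrite /H ifF ?scale0r //; lia.
have HE : isum H = (2 * b p%:Z) *: x.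
  rewrite (@isum_seq _ _ [:: n; p%:Z]) => [||k].
  - by rewrite big_cons big_seq1 /H !eqxx orbT /= -scalerDl mulr_natl mulr2n.
  - by rewrite /= inE andbT; lia.
  by rewrite !inE /H => /negbTE ->; rewrite scale0r.
have SG : Sp o%:Z (np 0 h h m w - (2 * b p%:Z) *: x).
  rewrite -HE -(isumB fG fH); apply: (isum_sub (sSp _)) => k; rewrite /G /H.
  case: ltP => k0.
    have -> : (k == n) || (k == p%:Z) = (m - k == p%:Z) by lia.
    by apply: pair; [lia|right].
  have -> : (k == n) || (k == p%:Z) = (k == p%:Z) by lia.
  by apply: pair; [lia|left].
have SEF : Sp o%:Z (np 0 e f m w).
  apply: (np_sub (sSp _)) => k k0.
    have -> : o%:Z = o%:Z + k - k by lia.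
    apply: Sp_creation => //; apply: (liftF _ _ Sw); last by lia.
    by apply: IHF'; lia.
  have Se : Sp ((en s)%:Z - k) (e k w).
    by apply: (liftE _ _ Sw); [apply: IHE'; lia|lia].
  by apply: (liftF IHFo _ Se); lia.
have Sh : Sp o%:Z (h m w).
  apply: (@lifth _ (o%:Z - p%:Z) (en s)%:Z); try lia; last exact: Sw.
  by apply: IHH'; lia.
have ST : Sp o%:Z (theta m *: w) by apply: (subZ (sSp _)); apply: Sp_le Sw; lia.
apply: (@subZE _ _ _ (sSp _) (2^-1 * b p%:Z)); first by rewrite mulf_neq0 ?invr_eq0 ?pnatr_eq0.
have Te := Tu m w; rewrite (sugawara_normal vM) in Te.
have -> : (2^-1 * b p%:Z) *: D n w = theta m *: w - np 0 e f m w -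
    ((m + 1)%:~R / 2) *: h m w - 4^-1 *: (np 0 h h m w - (2 * b p%:Z) *: x).
  rewrite -Te -/x; move: (np 0 e f m w) (np 0 h h m w) => y1 y2.
  by lmod_of K M; field.
apply: (subB (sSp _)); last exact: (subZ (sSp _)).
by apply: (subB (sSp _)); [apply: (subB (sSp _))|exact: (subZ (sSp _))].
Qed.
End Step.

Lemma all_outputs o : [/\ cF o, cE o & cH o].
Proof.
suff H (m : nat) : forall o : int, o < m%:Z -> [/\ cF o, cE o & cH o].
  by apply: (H (absz (o + 1)%R)); lia.
elim: m => [|m IH] o' om.
  split=> s n sn; have [F1 F2 F3] := negative_output s;
    rewrite ?F1 ?F2 ?F3; try lia; exact: (sub0 (sSp _)).
have [o'm|mo'] := ltP o' m%:Z; first exact: IH.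
have -> : o' = m%:Z by lia.
have IHF o2 : o2 < m%:Z -> cF o2 by move=> /IH[].
have IHE o2 : o2 < m%:Z -> cE o2 by move=> /IH[].
have IHH o2 : o2 < m%:Z -> cH o2 by move=> /IH[].
by split; [exact: stepF|exact: stepE|exact: stepH].
Qed.

Lemma ymon_span w : lspan (fun w => exists2 s, True & w = ymon s) w.
Proof.
have : exists E, Sp E w.
  apply: (gen_u (N := fun w => exists E, Sp E w)); last first.
    by exists 0; apply: (@Sp_ymon [::]).
  have sN : subspace (fun w => exists E, Sp E w).
    split=> [|a x y [E1 H1] [E2 H2]]; first by exists 0; apply: (sub0 (sSp _)).
    exists (Order.max E1 E2); apply: (sSp _).2; [apply: Sp_le H1|apply: Sp_le H2]; lia.
  split=> // i x [E Sx]; have aL : linear (fun i : affine_sl2 K => act i x).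
    by case: vM => -[aL _ _] _ _; apply: aL.
  move: i; apply: affine_ind => [|a i j Hi Hj|[[z n]|]].
  - by rewrite (lf0 aL); apply: (sub0 sN).
  - by rewrite aL; apply: sN.2.
  - have cF' o (_ : o <= E - n + p%:Z) : cF o by case: (all_outputs o).
    have cE' o (_ : o <= E - n) : cE o by case: (all_outputs o).
    have cH' o (_ : o <= E - n) : cH o by case: (all_outputs o).
    rewrite -/(mode z n) -(sl2_fieldE z n x); case: z.
    + by exists (E - n); apply: (liftE cE' _ Sx).
    + by exists (E - n + p%:Z); apply: (liftF cF' _ Sx).
    exists (Order.max E (E - n)); apply: (@lifth _ (E - n) E) => //; lia.
  - by case: vM => _ aK _; rewrite -/central aK; exists E; apply: (subZ (sSp _)).
case=> E Sw; apply: (lspan_ind Sw) => [|_ [s _ ->]]; first exact: subspace_lspan.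
by apply: lspan_gen; exists s.
Qed.

End Spanning.

(** * The series theta, cyclic vertex modules and quotients *)

Lemma lcoef_theta (K : numFieldType) (chi : int -> K) (n : int) :
  lcoef 2 (theta_series chi) n = theta_of (fun k => - lcoef 1 chi k) n.
Proof.
rewrite /lcoef /theta_series /theta_of /laurent_deriv.
have -> : - n - 2 + 1 = - (n + 1) by lia.
have -> : - n - 1 = - (n + 1) by lia.
have -> : laurent_mul chi chi (- n - 2) =
    (isum (fun k => - chi (- k - 1) * - chi (- (n - k) - 1) : K^o) : K).
  have bh : bijective (fun k : int => - k - 1) by exists (fun k => - k - 1) => k; lia.
  have -> : (fun k => - chi (- k - 1) * - chi (- (n - k) - 1) : K^o) =
      (fun i => chi i * chi (- n - 2 - i) : K^o) \o (fun k : int => - k - 1).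
    by apply/funext => k /=; rewrite mulrNN; congr (_ * chi _); lia.
  by rewrite (isum_reindex _ bh).
by rewrite mulrNz; congr (_ * (_ + _)); ring.
Qed.

Lemma theta_of_large (K : numFieldType) (b : int -> K) (p : nat) (n : int) :
  (forall k, p%:Z < k -> b k = 0) -> 2 * p%:Z < n -> theta_of b n = 0.
Proof.
move=> bp pn; rewrite /theta_of isum0 => [|k]; last first.
  have [pk|kp] := ltP p%:Z k; first by rewrite bp ?mul0r.
  by rewrite [b (n - k)]bp ?mulr0 //; lia.
by rewrite bp ?mulr0 ?addr0 ?mulr0 //; lia.
Qed.

Lemma eq_of_sub (U : zmodType) (x y z : U) : x = y - z -> z = 0 -> y = x.
Proof. by move=> -> ->; rewrite subr0. Qed.

Lemma eq0_of_sub (U : zmodType) (x y z : U) : x = y - z -> x = 0 -> y = 0 -> z = 0.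
Proof. by move=> -> + y0; rewrite y0 sub0r => /eqP; rewrite oppr_eq0 => /eqP. Qed.

(** Level and smoothness need to be checked only on a generator: the central element commutes with
    the action, and commutators turn a bound for [v] into one for any mode applied to [v]. *)
Lemma cyclic_vertex_module (K : numFieldType) (M : opModule K (affine_sl2 K)) (u : M) :
  lie_module M -> (forall N : set M, submodule N -> N u -> forall w, N w) ->
  act central u = - 2 *: u ->
  (exists N : int, forall x n, N < n -> act (mode x n) u = 0) ->
  vertex_module (- 2) M.
Proof.
move=> lM gen uK us; have [aL aR aB] := lM.
have lieK x : lie central x = 0 :> affine_sl2 K.
  by rewrite [lie _ _]affine_lieC affine_lie_central oppr0.
split=> // [w|x w].
  apply: (gen (fun w => act central w = - 2 *: w)) => //; split.
    split=> [|a v v' Hv Hv']; first by rewrite (lf0 (aR _)) scaler0.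
    by rewrite aR Hv Hv'; lmod_of K M.
  move=> x v Hv; have := aB central x v; rewrite lieK (lf0 (aL v)) Hv (lfZ (aR x)).
  by move/esym/eqP; rewrite subr_eq0 => /eqP.
suff: exists N : int, forall x n, N < n -> act (mode x n) w = 0.
  by case=> N HN; exists N => n; apply: HN.
move: w; apply: (gen (fun w => exists N : int, forall x n, N < n -> act (mode x n) w = 0)) => //.
have sN : subspace (fun w : M => exists N : int, forall x n, N < n -> act (mode x n) w = 0).
  split=> [|a v v' [N1 H1] [N2 H2]]; first by exists 0 => y n _; rewrite (lf0 (aR _)).
  exists (Order.max N1 N2) => y n Hn; rewrite aR H1 ?H2 ?scaler0 ?addr0 //; lia.
split=> // i v [N HN]; move: i; apply: affine_ind => [|a i j Hi Hj|[[y m]|]].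
- by rewrite (lf0 (aL v)); apply: (sub0 sN).
- by rewrite aL; apply: sN.2.
- exists (Order.max N (Order.max (- m) (N - m))) => z n Hn.
  have nN : N < n by lia.
  have E3 := etrans (congr1 (act (mode y m)) (HN z n nN)) (lf0 (aR _)).
  apply: etrans (eq_of_sub (aB (mode z n) (mode y m) v) E3) _.
  rewrite [lie _ _]affine_lieE /=.
  have -> : (n + m == 0) = false by lia.
  rewrite mulr0 scale0r addr0; have nm : N < n + m by lia.
  by case: z y {Hn nN E3} (fun x => HN x _ nm) => [] [] H;
    rewrite /= ?(lfN (aL v)) ?(lfZ (aL v)) ?H ?(lf0 (aL v)) ?scaler0 ?oppr0.
- exists N => z n Hn; apply: (eq0_of_sub (aB central (mode z n) v)).
    by rewrite lieK (lf0 (aL v)).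
  exact: etrans (congr1 (act central) (HN z n Hn)) (lf0 (aR _)).
Qed.

Lemma quotient_lift (K : numFieldType) (I : Type) (M N : opModule K I) (S : set M)
    (F : M -> N) : (forall i, linear (act i : M -> M)) ->
  (forall i, linear (act i : N -> N)) -> module_hom F -> (forall x, S x -> F x = 0) ->
  exists G : quotient_module S -> N,
    module_hom G /\ forall x, G (lpi (gen_submodule S) x) = F x.
Proof.
move=> lM lN [lF FA] FS; pose G (q : quotient_module S) := F (lrepr q).
have GE x : G (lpi (gen_submodule S) x) = F x.
  apply/eqP; rewrite -subr_eq0 -(lfB lF); apply/eqP.
  have : lspan (gen_submodule S) (lrepr (lpi (gen_submodule S) x) - x).
    by apply/lpiP; rewrite lreprK.
  have sk : subspace (fun y : M => F y = 0).
    split=> [|a y z Hy Hz]; first exact: (lf0 lF).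
    by rewrite lF Hy Hz scaler0 addr0.
  move/(@lspan_ind _ _ _ (fun y => F y = 0)); apply=> // y.
  move=> Gy; apply: (Gy (fun y => F y = 0)); split=> //; split=> // i z Hz.
  by rewrite FA Hz (lf0 (lN i)).
exists G; split=> //; split=> [a q r|i q].
  by rewrite -[q]lreprK -[r]lreprK -linearP !GE lF.
by rewrite -[q]lreprK (quotient_moduleE S _ (lM i)) !GE FA.
Qed.

Lemma gen_quotient (K : numFieldType) (I : Type) (M : opModule K I) (S : set M) (u : M) :
  (forall i, linear (act i : M -> M)) ->
  (forall N : set M, submodule N -> N u -> forall w, N w) ->
  forall N : set (quotient_module S), submodule N -> N (lpi (gen_submodule S) u) ->
  forall w, N w.
Proof.
move=> lM gen N [sN AN] Nu w; rewrite -[w]lreprK; move: (lrepr w).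
apply: (gen (fun x => N (lpi (gen_submodule S) x))) => //; split.
  by split=> [|a x y Nx Ny]; rewrite ?linear0 ?linearP; [apply: (sub0 sN)|apply: sN.2].
by move=> i x Nx; rewrite -(quotient_moduleE S _ (lM i)); apply: AN.
Qed.

(** * T(n) on the vacuum and the energy filtration of the Wakimoto module *)

Section WakimotoFiltration.
Context {K : numFieldType} {W : opModule K weyl_gen} {vac : W}.
Hypothesis HW : weyl_vacuum_module vac.
Variables (psi : int -> K) (p : nat).
Hypothesis psi0 : forall n, p%:Z < n -> lcoef 1 psi n = 0.
Local Notation A := (@Aop K W).
Local Notation B := (@Bop K W).
Local Notation J := (@Jop K W).
Local Notation F := (@Fop K W).
Local Notation b := (lcoef 1 psi).
Local Notation wf := (wf (W := W) psi).
Local Notation wh := (wh (W := W) psi).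
Local Notation en := (energy weight).
Let lA n := lA HW n.
Let lB n := lB HW n.
Let lJ n := lJ HW n.
Let vW : vertex_module (- 2) (wakimoto W psi) := wakimoto_vertex_module HW psi0.

Lemma wakimoto_fieldE x n (w : W) : sl2_field (M := wakimoto W psi) x n w =
  match x with sl2_e => A n w | sl2_h => wh n w | sl2_f => wf n w end.
Proof. by rewrite sl2_fieldE (wakimoto_act_mode HW psi0). Qed.

(** For n < p negative modes contribute and a direct evaluation fails. As T(n) commutes with the
    action, [J0_vac] makes T(n) vac a multiple of the vacuum, and the multiple is read off modulo
    created vectors. *)
Lemma sugawara_vac (n : int) :
  sugawara (M := wakimoto W psi) n vac = theta_of b n *: (vac : W).
Proof.
pose T (w : W) : W := sugawara (M := wakimoto W psi) n w.
have lT : linear T by exact: (lin_sugawara vW n).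
have TX x m w : sl2_field (M := wakimoto W psi) x m (T w) =
    T (sl2_field (M := wakimoto W psi) x m w).
  by rewrite /T !sl2_fieldE (sugawara_comm vW).
have [|| c Tc] := @J0_vac _ _ _ HW (T vac).
- move=> m m0; rewrite -(wakimoto_fieldE sl2_e) TX wakimoto_fieldE (A_vac HW) //.
  exact: (lf0 lT).
- rewrite (wh_J psi) -(wakimoto_fieldE sl2_h) TX wakimoto_fieldE whE.
  rewrite (J_killed HW) //; [|exact: (A_vac HW)|exact: (B_vac HW)].
  by rewrite scaler0 add0r (lfZ lT) subrr scaler0.
suff : wcreated ((c - theta_of b n) *: vac).
  by move/(wcreated_vac HW)/eqP; rewrite subr_eq0 => /eqP <-; exact: Tc.
rewrite scalerBl -Tc /T.
have sC : subspace (@wcreated K W) by exact: subspace_lspan.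
have CA m w : m < 0 -> wcreated (A m w).
  move=> m0; have -> : m = - (absz m).-1.+1%:Z by lia.
  exact: (@createdP _ _ _ cre (true, (absz m).-1) w).
have CB m w : m <= 0 -> wcreated (B m w).
  move=> m0; have -> : m = - (absz m)%:Z by lia.
  exact: (@createdP _ _ _ cre (false, absz m) w).
have CJ m w : m < 0 -> wcreated (J m w).
  by move=> m0; apply: (np_sub sC) => i Hi; [apply: CB|apply: CA]; lia.
have Ch m w : m < 0 -> wcreated (wh m w - b m *: w).
  by move=> m0; rewrite whE addrK; apply: (subZ sC); apply: CJ.
have hv m : 0 <= m -> wh m vac = b m *: vac.
  move=> m0; rewrite whE (J_killed HW) ?scaler0 ?add0r //; [exact: (A_vac HW)|exact: (B_vac HW)].
have Chv m : wcreated (wh m vac - b m *: vac).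
  have [m0|m0] := ltP m 0; first exact: Ch.
  by rewrite hv // subrr; apply: (sub0 sC).
have hE : (sl2_field (M := wakimoto W psi) sl2_h : field_on W) = wh.
  by apply/funext => m; apply/funext => w; rewrite wakimoto_fieldE.
have eE : (sl2_field (M := wakimoto W psi) sl2_e : field_on W) = A.
  by apply/funext => m; apply/funext => w; rewrite wakimoto_fieldE.
have fE : (sl2_field (M := wakimoto W psi) sl2_f : field_on W) = wf.
  by apply/funext => m; apply/funext => w; rewrite wakimoto_fieldE.
rewrite (sugawara_normal vW) hE eE fE.
have C1 : wcreated (np 0 A wf n vac).
  apply: (np_sub sC) => i i0; first exact: CA.
  by rewrite (A_vac HW) ?(lf0 (lwf HW psi0 _)) //; apply: (sub0 sC).
have C3 : wcreated (np 0 wh wh n vac - (isum (fun k => b k * b (n - k) : K^o) : K) *: vac).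
  have fs := fsupp_square n psi0.
  rewrite -(isum_scale vac fs) /np -isumB.
  - apply: (isum_sub sC) => k; case: ltP => k0.
      have -> : wh k (wh (n - k) vac) - (b k * b (n - k)) *: vac =
        (wh k (wh (n - k) vac) - b k *: wh (n - k) vac) +
        b k *: (wh (n - k) vac - b (n - k) *: vac) by lmod_of K W.
      by apply: (subD sC); [apply: Ch|apply: (subZ sC)].
    rewrite (hv k k0) (lfZ (lwh HW psi _)).
    have -> : b k *: wh (n - k) vac - (b k * b (n - k)) *: vac =
      b k *: (wh (n - k) vac - b (n - k) *: vac) by lmod_of K W.
    exact: (subZ sC).
  - exact: (np_fsupp 0 n vac (wh_field HW psi0) (wh_field HW psi0)).
  - by case: fs => N HN; exists N => k /HN E; rewrite [_ * _]E scale0r.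
have C2 := Chv n.
move: C1 C2 C3; rewrite /theta_of; move: (np 0 A wf n vac) (np 0 wh wh n vac) (isum _) => x1 x3 s.
move=> C1 C2 C3.
have -> : x1 + ((n + 1)%:~R / 2) *: wh n vac + 4^-1 *: x3 -
    (4^-1 * (s + 2 * (n + 1)%:~R * b n)) *: vac =
  x1 + ((n + 1)%:~R / 2) *: (wh n vac - b n *: vac) + 4^-1 *: (x3 - (s : K) *: vac).
  by lmod_of K W; field.
by apply: (subD sC); [apply: (subD sC)|]; rewrite //; apply: (subZ sC).
Qed.

Definition WE (E : int) : set W :=
  lspan (fun w => exists2 s, (en s)%:Z <= E & w = mon cre s vac).

Lemma sWE E : subspace (WE E). Proof. exact: subspace_lspan. Qed.

Lemma WE_mon s E : (en s)%:Z <= E -> WE E (mon cre s vac).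
Proof. by move=> sE; apply: lspan_gen; exists s. Qed.

Lemma WE_le E E' w : E <= E' -> WE E w -> WE E' w.
Proof.
move=> EE /(@lspan_ind _ _ _ (WE E')); apply=> [|_ [s sE ->]]; first exact: sWE.
by apply: WE_mon; apply: le_trans EE.
Qed.

Lemma WE_ind (X : W -> W) E E' w : linear X ->
  (forall s, (en s)%:Z <= E -> WE E' (X (mon cre s vac))) -> WE E w -> WE E' (X w).
Proof.
move=> lX H /(@lspan_ind _ _ _ (fun w => WE E' (X w))); apply=> [|_ [s sE ->]]; last exact: H.
by split=> [|a x y Hx Hy]; rewrite ?(lf0 lX) ?lX; [apply: (sub0 (sWE _))|apply: (sWE _).2].
Qed.

Lemma WE_cre i E w : WE E w -> WE (E + (weight i)%:Z) (cre i w).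
Proof.
apply: WE_ind => [|s sE]; first exact: (lcre HW).
apply: (@WE_mon (i :: s)).
by have -> : en (i :: s) = (weight i + en s)%N by []; lia.
Qed.

Lemma WE_ann i E w : WE E w -> WE (E - (weight i)%:Z) (ann i w).
Proof.
apply: WE_ind => [|s sE]; first exact: (lann HW).
rewrite (d_mon (lcre HW) (creC HW) (ann_cre HW) (ann_vac HW)).
have [ins|nin] := boolP (i \in s); last first.
  by rewrite (count_memPn nin) scale0r; apply: (sub0 (sWE _)).
apply: (subZ (sWE _)); apply: WE_mon.
have es : en s = (weight i + en (rem i s))%N := energy_perm weight (perm_to_rem ins).
by move: sE; rewrite es; lia.
Qed.

Lemma WE_A (n : int) E w : WE E w -> WE (E - n) (A n w).
Proof.
move=> Ew; case: n => n; first exact: (@WE_ann (false, n) _ _ Ew).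
by rewrite NegzE opprK; exact: (@WE_cre (true, n) _ _ Ew).
Qed.

Lemma WE_B (n : int) E w : WE E w -> WE (E - n) (B n w).
Proof.
move=> Ew; case: n => [[|n]|n].
- by rewrite subr0; have := @WE_cre (false, 0%N) _ _ Ew; rewrite addr0.
- by rewrite -[B _ w]opprK; apply: (subN (sWE _)); exact: (@WE_ann (true, n) _ _ Ew).
- by rewrite NegzE opprK; exact: (@WE_cre (false, n.+1) _ _ Ew).
Qed.

Lemma WE_J (n : int) E w : WE E w -> WE (E - n) (J n w).
Proof.
move=> Ew; apply: (np_sub (sWE _)) => i Hi.
  have -> : E - n = E - (n - i) - i by lia.
  by apply: WE_B; apply: WE_A.
have -> : E - n = E - i - (n - i) by lia.
by apply: WE_A; apply: WE_B.
Qed.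

Lemma WE_F (n : int) E w : WE E w -> WE (E - n) (F n w).
Proof.
move=> Ew; apply: (np_sub (sWE _)) => i Hi.
  have -> : E - n = E - (n - i) - i by lia.
  by apply: WE_B; apply: WE_J.
have -> : E - n = E - i - (n - i) by lia.
by apply: WE_J; apply: WE_B.
Qed.

Hypothesis p0 : (0 < p)%N.

(** Multiplication by [b p] yields the highest energy. The cubic and derivative terms of f(n) shift
    by -n only, which is strictly lower since p > 0. *)
Lemma wf_top (n : int) E w : WE E w ->
  WE (E - n + p%:Z - 1) (wf n w - b p%:Z *: B (n - p%:Z) w).
Proof.
move=> Ew; rewrite wfE.
have -> : - F n w + (2 * n%:~R) *: B n w + Bb psi n w - b p%:Z *: B (n - p%:Z) w =
  - F n w + (2 * n%:~R) *: B n w + (Bb psi n w - b p%:Z *: B (n - p%:Z) w) by lmod_of K W.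
apply: (subD (sWE _)); first apply: (subD (sWE _)).
- by apply: (subN (sWE _)); apply: WE_le (@WE_F n _ _ Ew); lia.
- by apply: (subZ (sWE _)); apply: WE_le (@WE_B n _ _ Ew); lia.
pose H k := (if k == n - p%:Z then b p%:Z else 0) *: B k w.
have HE : isum H = b p%:Z *: B (n - p%:Z) w.
  by rewrite (@isum1 _ _ (n - p%:Z)) /H ?eqxx // => k /negbTE ->; rewrite scale0r.
have fH : fsupp H.
  apply: (@fsupp_bounds _ _ _ (n - p%:Z) (n - p%:Z)) => k Hk;
    by rewrite /H ifF ?scale0r //; lia.
rewrite -HE /Bb /np -isumB //; last first.
  exact: (np_fsupp 1 n w (fB HW) (fb psi0)).
apply: (isum_sub (sWE _)) => k.
have -> : (if k < 1 then B k (bfield psi (n - k) w) else bfield psi (n - k) (B k w)) =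
  b (n - k) *: B k w by rewrite /bfield (lfZ (lB _)) if_same.
rewrite /H; have [->|ne] := eqVneq k (n - p%:Z).
  have -> : n - (n - p%:Z) = p%:Z by lia.
  by rewrite subrr; apply: (sub0 (sWE _)).
rewrite scale0r subr0; have [lt|ge] := ltP k (n - p%:Z).
  by rewrite psi0 ?scale0r; [apply: (sub0 (sWE _))|lia].
by apply: (subZ (sWE _)); apply: WE_le (@WE_B k _ _ Ew); lia.
Qed.

Local Notation eopW := (eop (M := wakimoto W psi)).
Local Notation fopW := (fop (M := wakimoto W psi) p).
Definition asop (i : bool * nat) (w : W) : W := if i.1 then w else B (- i.2%:Z) w.
Definition enF (s : seq (bool * nat)) := energy (fun i => if i.1 then 0%N else i.2) s.
Definition enE (s : seq (bool * nat)) := energy (fun i => if i.1 then i.2.+1 else 0%N) s.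

Lemma enFE s : en s = (enF s + enE s)%N.
Proof.
elim: s => // -[[] j] s IH; rewrite /enF /enE /energy /= -!/(energy _ s) IH /weight /=;
  rewrite -/(enF s) -/(enE s); lia.
Qed.

Lemma eopW_T k (w : W) : eopW (true, k) w = A (- k.+1%:Z) w.
Proof. by rewrite /eop /= wakimoto_fieldE. Qed.
Lemma fopW_F j (w : W) : fopW (false, j) w = wf (p%:Z - j%:Z) w.
Proof. by rewrite /fop /= wakimoto_fieldE. Qed.

Lemma mon_asop s : mon eopW s (mon asop s vac) = mon cre s vac.
Proof.
have C t j (w : W) : mon eopW t (B (- j%:Z) w) = B (- j%:Z) (mon eopW t w).
  elim: t => //= -[[] k] t IH; rewrite -!/(mon _ _ _) IH ?eopW_T // (A_Bne HW) //; lia.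
elim: s => // -[[] j] s IH; rewrite [mon cre _ _]/= -/(mon cre s vac) -IH.
  by rewrite [LHS]/= -!/(mon _ _ _) eopW_T.
by rewrite [LHS]/= -!/(mon _ _ _) [asop _ _]/= C.
Qed.

Lemma WE_eop s E w : WE E w -> WE (E + (enE s)%:Z) (mon eopW s w).
Proof.
move=> Ew; elim: s => [|[[] k] s IH]; rewrite ?addr0 //=.
rewrite -/(mon eopW s w) eopW_T.
have -> : E + (enE ((true, k) :: s))%:Z = E + (enE s)%:Z - (- k.+1%:Z).
  by rewrite /enE /energy /= -/(energy _ s); lia.
exact: WE_A.
Qed.

Definition lead (s : seq (bool * nat)) : K := b p%:Z ^+ count (fun i => ~~ i.1) s.

Lemma WE_fop s : WE (enF s)%:Z (mon asop s vac) /\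
  WE ((enF s)%:Z - 1) (mon fopW s (vac : W) - lead s *: mon asop s vac).
Proof.
elim: s => [|[[] j] s [IH1 IH2]].
- by split; [apply: (@WE_mon [::])|rewrite /lead scale1r subrr; apply: (sub0 (sWE _))].
- by [].
have -> : (enF ((false, j) :: s))%:Z = (enF s)%:Z - (- j%:Z).
  by rewrite /enF /energy /= -/(energy _ s); lia.
rewrite [mon asop _ _]/= [mon fopW _ _]/= -!/(mon _ _ _) [asop _ _]/= fopW_F.
split; first exact: WE_B.
set X : W := mon fopW s (vac : W); set Y := mon asop s vac.
have EX : WE (enF s)%:Z X.
  rewrite -(subrK (lead s *: Y) X); apply: (subD (sWE _)); last exact: (subZ (sWE _)).
  by apply: WE_le IH2; lia.
have -> : lead ((false, j) :: s) = b p%:Z * lead s by rewrite /lead /= exprS.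
have -> : wf (p%:Z - j%:Z) X - (b p%:Z * lead s) *: B (- j%:Z) Y =
  (wf (p%:Z - j%:Z) X - b p%:Z *: B (- j%:Z) X) + b p%:Z *: B (- j%:Z) (X - lead s *: Y).
  by rewrite (lfB (lB _)) (lfZ (lB _)); lmod_of K W.
apply: (subD (sWE _)).
  have := @wf_top (p%:Z - j%:Z) _ _ EX.
  have -> : p%:Z - j%:Z - p%:Z = - j%:Z by lia.
  by apply: WE_le; lia.
by apply: (subZ (sWE _)); have := @WE_B (- j%:Z) _ _ IH2; apply: WE_le; lia.
Qed.

(** To leading order f(p-j) is [b p] times a^*(-j), whence the power [lead s], while e(-k) is
    exactly a(-k). *)
Lemma low_ymon s : low ann weight (en s)
  (ymon (M := wakimoto W psi) p vac s - lead s *: mon cre s vac).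
Proof.
have lE t : linear (mon eopW t : W -> W).
  by move=> a x y; elim: t => //= -[[] k] t IH; rewrite -!/(mon _ _ _) IH ?eopW_T ?lA.
have : WE ((en s)%:Z - 1) (ymon (M := wakimoto W psi) p vac s - lead s *: mon cre s vac).
  rewrite /ymon -mon_asop -(lfZ (lE s)) -(lfB (lE s)).
  have [_ H] := WE_fop s; have := @WE_eop s _ _ H; apply: WE_le.
  by rewrite enFE; lia.
move=> Ew t st; move: Ew.
have ld := lin_dmon (lann HW) t.
move/(@lspan_ind _ _ _ (fun w => dmon ann t w = 0)); apply=> [|_ [s' s'E ->]].
  by split=> [|a x y Hx Hy]; rewrite ?(lf0 ld) // ld Hx Hy scaler0 addr0.
have [//|/eqP ne] := eqVneq (dmon ann t (mon cre s' vac)) 0.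
have [r sr] := dmon_mon (lcre HW) (lann HW) (creC HW) (annC HW) (ann_cre HW) (ann_vac HW) ne.
move: s'E; rewrite (energy_perm weight sr) energy_cat.
by move: st; move: (energy weight t) (energy weight s) (energy weight r) => i1 i2 i3; lia.
Qed.

End WakimotoFiltration.

(** * The quotient of the induced module and its isomorphism with the Wakimoto module *)

Section CriticalQuotient.
Context {K : numFieldType} {W : opModule K weyl_gen} {vac : W}.
Hypothesis HW : weyl_vacuum_module vac.
Variables (p : nat) (chi : int -> K) (phi : affine_sl2 K -> K).
Let psi k := - chi k.
Let theta := theta_series chi.
Hypothesis chi0 : forall n : int, p%:Z < n -> lcoef 1 chi n = 0.
Hypothesis charphi : lie_character (S_alg p) phi.
Hypothesis phiK : phi central = - 2.
Hypothesis phih : forall i : nat, phi (mode sl2_h i%:Z) = - lcoef 1 chi i%:Z.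
Hypothesis phie : forall i : nat, phi (mode sl2_e i%:Z) = 0.
Hypothesis phif : forall i : nat, phi (mode sl2_f (i + p + 1)%:Z) = 0.
Local Notation b := (lcoef 1 psi).
Local Notation u := (Mhat_vec p phi).
Let psi0 := psi0 chi0.

Let S_gen x : [\/ x = central,
    exists2 n : int, -1 < n & x = mode sl2_e n,
    exists2 m : int, p%:Z < m & x = mode sl2_f m |
    exists2 k : int, 0 <= k & x = mode sl2_h k] -> S_alg (K := K) p x.
Proof. by move=> Gx S [_]; apply. Qed.

Lemma Mhat_e (k : int) : 0 <= k -> act (mode sl2_e k) u = 0.
Proof.
move=> k0; rewrite [act _ _]induced_vecE; last first.
  by apply: S_gen; constructor 2; exists k => //; lia.
have -> : k = (absz k)%:Z by lia.
by rewrite phie scale0r.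
Qed.

Lemma Mhat_f (k : int) : p%:Z < k -> act (mode sl2_f k) u = 0.
Proof.
move=> k0; rewrite [act _ _]induced_vecE; last first.
  by apply: S_gen; constructor 3; exists k.
have -> : k = (absz (k - p%:Z - 1)%R + p + 1)%N%:Z by lia.
by rewrite phif scale0r.
Qed.

Lemma Mhat_h (k : int) : 0 <= k -> act (mode sl2_h k) u = b k *: u.
Proof.
move=> k0; rewrite [act _ _]induced_vecE; last first.
  by apply: S_gen; constructor 4; exists k.
have -> : k = (absz k)%:Z by lia.
by rewrite phih.
Qed.

Lemma Mhat_gen (N : set (Mhat p phi)) : submodule N -> N u -> forall w, N w.
Proof. exact: gen_submodule_induced. Qed.

Lemma Mhat_vertex_module : vertex_module (- 2) (Mhat p phi).
Proof.
apply: (cyclic_vertex_module (u := u)); [exact: lie_module_induced|exact: Mhat_gen|..].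
  rewrite [act _ _]induced_vecE ?phiK //; apply: S_gen; by constructor 1.
exists p%:Z => -[] n pn; [apply: Mhat_e; lia|exact: Mhat_f|].
by rewrite Mhat_h ?psi0 ?scale0r //; lia.
Qed.

Lemma sugawara_Mhat (n : int) : p%:Z <= n -> sugawara n u = lcoef 2 theta n *: u.
Proof.
move=> pn; rewrite lcoef_theta.
apply: (sugawara_highest Mhat_vertex_module (b := b) (p := p)) => // k k0;
  rewrite sl2_fieldE; [exact: Mhat_e|exact: Mhat_f|exact: Mhat_h].
Qed.

Lemma theta_large (n : int) : 2 * p%:Z < n -> lcoef 2 theta n = 0.
Proof. by rewrite lcoef_theta; apply: (theta_of_large (p := p)) => k; apply: psi0. Qed.

Lemma wakimoto_quotient_map : exists F : Mhat p phi -> wakimoto W psi,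
  module_hom F /\ F u = vac.
Proof.
have [lieW _ _] := wakimoto_vertex_module HW psi0.
exact: (induced_lift lieW (wakimoto_vac_act HW chi0 charphi phiK phih phie phif)).
Qed.

Lemma wakimoto_simple_quotient : simple_condition chi ->
  simple_quotient (Mhat p phi) (wakimoto W psi).
Proof.
move=> cond; have simW := wakimoto_simple HW chi0 cond; split=> //.
have [F [homF Fu]] := wakimoto_quotient_map; exists F; split=> //.
by apply: (simple_hom_surj (u := u) simW homF); rewrite Fu (vac_neq0 HW).
Qed.

Hypothesis p0 : (0 < p)%N.
Hypothesis chip : lcoef 1 chi p%:Z <> 0.

Let S : set (Mhat p phi) := fun w => exists2 n : int, n < p%:Z &
  w = sugawara n u - lcoef 2 theta n *: u.
Let M : opModule K (affine_sl2 K) := quotient_module S.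
Let v : M := lpi (gen_submodule S) u.
Let actR (x : affine_sl2 K) : linear (act x : Mhat p phi -> Mhat p phi).
Proof. by case: Mhat_vertex_module => -[]. Qed.
Let actE x w : act (o := M) x (lpi (gen_submodule S) w) = lpi (gen_submodule S) (act x w).
Proof. exact: quotient_moduleE. Qed.

Lemma Mbar_gen (N : set M) : submodule N -> N v -> forall w, N w.
Proof. exact: (gen_quotient actR Mhat_gen). Qed.

Lemma Mbar_vertex_module : vertex_module (- 2) M.
Proof.
have [lM aK sm] := Mhat_vertex_module.
apply: (cyclic_vertex_module (u := v)); [exact: lie_module_quotient|exact: Mbar_gen|..].
  by rewrite actE aK linearZ.
exists p%:Z => -[] n pn; rewrite actE.
- by rewrite Mhat_e ?linear0 //; lia.
- by rewrite Mhat_f ?linear0.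
- by rewrite Mhat_h ?psi0 ?scale0r ?linear0 //; lia.
Qed.

(** T(n) commutes with the action, so the generator suffices: the quotient imposes the value for n <
    p, and the character already forces it for n >= p. *)
Lemma sugawara_Mbar n (w : M) : sugawara n w = lcoef 2 theta n *: w.
Proof.
have vM := Mbar_vertex_module; have lT := lin_sugawara vM n.
have [[aL aR aB] _ _] := vM.
have homp : module_hom (lpi (gen_submodule S) : Mhat p phi -> M).
  by split=> [a x y|i x]; [exact: linearP|rewrite actE].
move: w; apply: (Mbar_gen (N := fun w => sugawara n w = lcoef 2 theta n *: w)).
  split; first split=> [|a x y Hx Hy]; first by rewrite (lf0 lT) scaler0.
    by rewrite lT Hx Hy; lmod_of K M.
  move=> i x Hx; apply: etrans (sugawara_comm vM n i x) _.
  exact: etrans (congr1 (act i) Hx) (lfZ (aR i) _ _).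
rewrite /v -(sugawara_hom n u Mhat_vertex_module vM homp) -linearZ.
have [np|pn] := ltP n p%:Z; last by rewrite sugawara_Mhat.
apply/lpiP; apply: lspan_gen => N [_]; apply.
by exists n.
Qed.

Lemma Mbar_iso : simple_condition chi -> module_iso M (wakimoto W psi).
Proof.
move=> cond; have [F [homF Fu]] := wakimoto_quotient_map.
have vW := wakimoto_vertex_module HW psi0; have vM := Mbar_vertex_module.
have [[_ aRW _] _ _] := vW.
have [lF FA] := homF.
have FS x : S x -> F x = 0.
  move=> [n _ ->]; apply: etrans (lfB lF _ _) _.
  have cE : lcoef 2 theta n = theta_of b n by exact: lcoef_theta.
  rewrite cE; set c := theta_of b n.
  have E1 : F (sugawara n u) = c *: (vac : wakimoto W psi).
    apply: etrans (sugawara_hom n u Mhat_vertex_module vW homF) _.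
    by apply: etrans (sugawara_vac HW psi0 n); congr sugawara.
  have E2 : F (c *: u) = c *: (vac : wakimoto W psi).
    by apply: etrans (lfZ lF c u) _; congr (_ *: _).
  by apply/eqP; rewrite subr_eq0; apply/eqP; apply: etrans E1 (esym E2).
have [G [homG Gpi]] := quotient_lift actR aRW homF FS.
have Gv : G v = vac by rewrite Gpi.
have [lG GA] := homG.
have surjG := simple_hom_surj (u := v) (wakimoto_simple HW chi0 cond) homG.
have kerG w : G w = 0 -> w = 0.
  move=> Gw; have bp0 : b p%:Z != 0 by rewrite psi_chi oppr_eq0; apply/eqP.
  have : lspan (fun w : M => exists2 s, True & w = ymon p v s) w.
    apply: (ymon_span vM p0 psi0 bp0 (theta := lcoef 2 theta)) => [k k0|k k0|k k0|n x|].
    - rewrite sl2_fieldE; apply: etrans (actE _ _) _.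
      exact: etrans (congr1 (lpi _) (Mhat_e k0)) (linear0 _).
    - rewrite sl2_fieldE; apply: etrans (actE _ _) _.
      exact: etrans (congr1 (lpi _) (Mhat_f k0)) (linear0 _).
    - rewrite sl2_fieldE; apply: etrans (actE _ _) _.
      exact: etrans (congr1 (lpi _) (Mhat_h k0)) (linearZ_LR _ _ _).
    - exact: sugawara_Mbar.
    - exact: Mbar_gen.
  move/lspan_list => [L _ wE].
  have Gy s : G (ymon p v s) = ymon (M := wakimoto W psi) p vac s.
    have E1 t x : G (mon (eop (M := M)) t x) = mon (eop (M := wakimoto W psi)) t (G x).
      elim: t => //= -[[] k] t IH; rewrite -!/(mon _ _ _) -IH // /eop /=.
      by rewrite !sl2_fieldE GA.
    have E2 t x : G (mon (fop (M := M) p) t x) = mon (fop (M := wakimoto W psi) p) t (G x).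
      elim: t => //= -[[] k] t IH; rewrite -!/(mon _ _ _) -IH // /fop /=.
      by rewrite !sl2_fieldE GA.
    by rewrite /ymon E1 E2 Gv.
  (* A combination of the vectors [ymon] of the quotient with zero image in W gives a relation among
     their images, whose leading terms are independent; triangularity carries it back, so the
     combination is 0. *)
  rewrite wE; apply: (triangular_relation (lcre HW) (lann HW) (creC HW) (annC HW)
    (ann_cre HW) (ann_vac HW) (vac_neq0 HW) (e := weight) (k := lead psi p)
    (y := ymon (M := wakimoto W psi) p vac)) => [s|s|s t|s t|q _].
  - by rewrite expf_neq0.
  - exact: (low_ymon HW psi0 p0).
  - exact: (ymon_perm vW).
  - exact: (ymon_perm vM).
  have -> : \sum_(q <- L) q.1 *: (ymon (M := wakimoto W psi) p vac q.2 : W) = 0.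
    rewrite -[RHS]Gw wE (lf_sum lG); apply: eq_bigr => r _.
    by rewrite (lfZ lG) Gy.
  exact: (lf0 (lin_dmon (lann HW) _)).
exists G; split=> //.
have injG : injective G.
  move=> x y Gxy; apply/eqP; rewrite -subr_eq0; apply/eqP/kerG.
  by rewrite (lfB lG) Gxy subrr.
have {}surjG : forall w, exists x, G x = w by apply: surjG; rewrite Gv (vac_neq0 HW).
have [g gK] := choice surjG; exists g => // x.
by apply: injG; rewrite gK.
Qed.

End CriticalQuotient.

(* [lcoef 1 chi n] is chi_n and [lcoef 2 theta n] is theta_n. *)
Theorem theorem6p2 (R : realType) (W : opModule R[i] weyl_gen) (vac : W)
    (p : nat) (chi : int -> R[i]) (phi : affine_sl2 R[i] -> R[i])
    (theta := theta_series chi) :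
  weyl_vacuum_module vac ->
  (forall n : int, p%:Z < n -> lcoef 1 chi n = 0) ->
  lie_character (S_alg p) phi ->
  phi central = - 2 ->
  (forall i : nat, phi (mode sl2_h i%:Z) = - lcoef 1 chi i%:Z) ->
  (forall i : nat, phi (mode sl2_e i%:Z) = 0) ->
  (forall i : nat, phi (mode sl2_f (i + p + 1)%:Z) = 0) ->
  [\/ exists p' : nat,
        [/\ (0 < p')%N,
            forall n : int, p'%:Z < n -> lcoef 1 chi n = 0 &
            lcoef 1 chi p'%:Z <> 0],
      (forall n : int, 0 < n -> lcoef 1 chi n = 0) /\
      (lcoef 1 chi 0 = 1 \/ forall m : int, lcoef 1 chi 0 <> m%:~R) |
      exists l : nat,
        [/\ (0 < l)%N,
            lcoef 1 chi 0 = l%:R + 1,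
            forall n : int, 0 < n -> lcoef 1 chi n = 0 &
            schur l (fun n => - lcoef 1 chi (- n%:Z)) <> 0]] ->
  [/\ vertex_module (- 2) (wakimoto W (fun k => - chi k)),
      simple_quotient (Mhat p phi) (wakimoto W (fun k => - chi k)) &
      (1 <= p)%N -> lcoef 1 chi p%:Z <> 0 ->
      [/\ forall n : int, 2 * p%:Z < n -> lcoef 2 theta n = 0,
          forall n : int, p%:Z <= n ->
            sugawara n (Mhat_vec p phi) = lcoef 2 theta n *: Mhat_vec p phi &
          module_iso (Mbar p phi (lcoef 2 theta))
            (wakimoto W (fun k => - chi k))]].
Proof.
move=> HW chi0 charphi phiK phih phie phif cond; split.
- exact: (wakimoto_vertex_module HW (psi0 chi0)).
- exact: (wakimoto_simple_quotient HW chi0 charphi phiK phih phie phif cond).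
move=> p0 chip; split=> [n pn|n pn|].
- exact: (theta_large chi0 pn).
- exact: (sugawara_Mhat chi0 phiK phih phie phif pn).
- exact: (Mbar_iso HW chi0 charphi phiK phih phie phif p0 chip cond).
Qed.
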